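(* For every instance of the Colored Knapsack Problem with $n$ items, an optimal solution of the linear program $\text{LP}_{\text{CKP}}$ (the linear relaxation of the CKP integer program, defined in the context) can be computed in $\mathcal{O}(n)$ time.
   Context: An instance of the Colored Knapsack Problem (CKP) consists of a set of items $\mathcal{I}=\{1,\dots,n\}$ with profits $p_i\in\mathbb{Z}$ (zero and negative profits allowed) and weights $w_i\in\mathbb{Z}_{>0}$, a capacity $b\in\mathbb{Z}_{>0}$ with $b<\sum_{i=1}^n w_i$, a set of colors $\mathcal{C}=\{1,\dots,m\}$, and a color $\kappa_i\in\mathcal{C}$ for each item $i$. For $c\in\mathcal{C}$ let $\mathcal{I}_c=\{i\in\mathcal{I}\mid \kappa_i=c\}$ and $\bar{\mathcal{I}}_c=\mathcal{I}\setminus\mathcal{I}_c$. The color classes $\mathcal{I}_1,\dots,\mathcal{I}_m$ partition the items into nonempty classes (so $m\le n$). $\text{LP}_{\text{CKP}}$ is the linear program: maximize $\sum_{i\in\mathcal{I}}p_ix_i$ subject to $\sum_{i\in\mathcal{I}}w_ix_i\le b$; $\sum_{i\in\mathcal{I}_c}x_i-\sum_{i\in\bar{\mathcal{I}}_c}x_i\le 1$ for all $c\in\mathcal{C}$; and $0\le x_i\le 1$ for all $i\in\mathcal{I}$. Running time is counted as the number of elementary operations (arithmetic operations and comparisons on numbers, and table accesses, at unit cost). *)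

(* Defs.v *)
From HB Require Import structures.
From mathcomp Require Import all_boot all_order all_algebra.

Set Implicit Arguments.
Unset Strict Implicit.
Unset Printing Implicit Defensive.

Import Order.TTheory GRing.Theory Num.Theory.
Local Open Scope ring_scope.

(* Items are 'I_n and colors are 'I_m: item (resp. color) k of the paper is   *)
(* the ordinal k - 1.                                                         *)
Record ckp (n m : nat) := Ckp {
  profit : 'I_n -> int;
  weight : 'I_n -> int;
  capacity : int;
  color : 'I_n -> 'I_m;
  weight_gt0 : forall i, 0 < weight i;
  capacity_gt0 : 0 < capacity;
  capacity_lt : capacity < \sum_(i < n) weight i;
  color_nonempty : forall c, exists i, color i = c
}.

Section LP.
Variables (R : realFieldType) (n m : nat) (I : ckp n m).
Implicit Types x y : 'I_n -> R.

Definition lp_objective x : R := \sum_(i < n) (profit I i)%:~R * x i.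

Definition lp_feasible x : Prop :=
  [/\ \sum_(i < n) (weight I i)%:~R * x i <= (capacity I)%:~R,
      forall c : 'I_m,
        \sum_(i < n | color I i == c) x i - \sum_(i < n | color I i != c) x i
          <= 1
    & forall i, 0 <= x i <= 1].

Definition lp_optimal x : Prop :=
  lp_feasible x /\ forall y, lp_feasible y -> lp_objective y <= lp_objective x.

End LP.

(******************************************************************************)
(* Machine model: a unit-cost random access machine, presented as an          *)
(* imperative language with first-order recursive procedures.                 *)
(*                                                                            *)
(* As in the real RAM, there are two disjoint kinds of data: indices (nat)    *)
(* and numbers (elements of R).  Each kind has registers, local to a          *)
(* procedure call, and tables, shared by all calls.  Only indices address     *)
(* tables.  Indices can be added, subtracted and compared; numbers can be     *)
(* added, subtracted, multiplied, divided and compared.  There is no          *)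
(* conversion between the two kinds, in particular no rounding of numbers:    *)
(* with the inputs used below all the numbers computed are rational.          *)
(*                                                                            *)
(* A program is a finite piece of syntax that depends neither on the instance *)
(* nor on R, so it uses finitely many registers and tables; the cost of       *)
(* setting up the frame of a call is accounted for by the cost of Call.       *)
(******************************************************************************)

Inductive iexp :=
| IConst of nat
| IReg of nat
| IAdd of iexp & iexp
| ISub of iexp & iexp
| IRead of nat & iexp.

Inductive nexp :=
| NConst of int
| NReg of nat
| NAdd of nexp & nexp
| NSub of nexp & nexp
| NMul of nexp & nexp
| NDiv of nexp & nexp
| NRead of nat & iexp.

Inductive bexp :=
| ILe of iexp & iexp
| NLe of nexp & nexp
| BNot of bexp
| BAnd of bexp & bexp.

(* Call f ies nes xi xn runs procedure f in a fresh frame, whose first        *)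
(* registers hold the values of ies and nes and whose other registers are 0;  *)
(* on return, index register 0 and number register 0 of the callee are        *)
(* copied to the registers xi and xn of the caller.                           *)
Inductive cmd :=
| Skip
| ISet of nat & iexp
| NSet of nat & nexp
| IWrite of nat & iexp & iexp
| NWrite of nat & iexp & nexp
| Seq of cmd & cmd
| If of bexp & cmd & cmd
| While of bexp & cmd
| Call of nat & seq iexp & seq nexp & nat & nat.

Record program := Program { procs : seq cmd; main : cmd }.

(* Every constant, register access, table access, operation, comparison and   *)
(* boolean connective costs one; both sides of BAnd are always charged.       *)
Fixpoint icost (e : iexp) : nat :=
  match e with
  | IConst _ | IReg _ => 1
  | IAdd e1 e2 | ISub e1 e2 => (icost e1 + icost e2).+1
  | IRead _ e1 => (icost e1).+1
  end.

Fixpoint ncost (e : nexp) : nat :=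
  match e with
  | NConst _ | NReg _ => 1
  | NAdd e1 e2 | NSub e1 e2 | NMul e1 e2 | NDiv e1 e2 =>
      (ncost e1 + ncost e2).+1
  | NRead _ e1 => (icost e1).+1
  end.

Fixpoint bcost (e : bexp) : nat :=
  match e with
  | ILe e1 e2 => (icost e1 + icost e2).+1
  | NLe e1 e2 => (ncost e1 + ncost e2).+1
  | BNot e1 => (bcost e1).+1
  | BAnd e1 e2 => (bcost e1 + bcost e2).+1
  end.

Definition upd (T : Type) (f : nat -> T) (k : nat) (v : T) (j : nat) : T :=
  if j == k then v else f j.

Section Semantics.
Variable R : realFieldType.

Record frame := Frame { ireg : nat -> nat; nreg : nat -> R }.

(* itab s a k is entry k of index table a, and likewise for ntab. *)
Record store := Store { itab : nat -> nat -> nat; ntab : nat -> nat -> R }.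

(* ISub is truncated subtraction, and division by 0 yields 0. *)
Fixpoint ieval (fr : frame) (s : store) (e : iexp) : nat :=
  match e with
  | IConst k => k
  | IReg x => ireg fr x
  | IAdd e1 e2 => (ieval fr s e1 + ieval fr s e2)%N
  | ISub e1 e2 => (ieval fr s e1 - ieval fr s e2)%N
  | IRead a e1 => itab s a (ieval fr s e1)
  end.

Fixpoint neval (fr : frame) (s : store) (e : nexp) : R :=
  match e with
  | NConst k => k%:~R
  | NReg x => nreg fr x
  | NAdd e1 e2 => neval fr s e1 + neval fr s e2
  | NSub e1 e2 => neval fr s e1 - neval fr s e2
  | NMul e1 e2 => neval fr s e1 * neval fr s e2
  | NDiv e1 e2 => neval fr s e1 / neval fr s e2
  | NRead a e1 => ntab s a (ieval fr s e1)
  end.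

Fixpoint beval (fr : frame) (s : store) (e : bexp) : bool :=
  match e with
  | ILe e1 e2 => (ieval fr s e1 <= ieval fr s e2)%N
  | NLe e1 e2 => neval fr s e1 <= neval fr s e2
  | BNot e1 => ~~ beval fr s e1
  | BAnd e1 e2 => beval fr s e1 && beval fr s e2
  end.

Definition set_ireg (fr : frame) (x v : nat) : frame :=
  Frame (upd (ireg fr) x v) (nreg fr).

Definition set_nreg (fr : frame) (x : nat) (v : R) : frame :=
  Frame (ireg fr) (upd (nreg fr) x v).

Definition set_itab (s : store) (a k v : nat) : store :=
  Store (upd (itab s) a (upd (itab s a) k v)) (ntab s).

Definition set_ntab (s : store) (a k : nat) (v : R) : store :=
  Store (itab s) (upd (ntab s) a (upd (ntab s a) k v)).

Definition call_frame (fr : frame) (s : store)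
    (ies : seq iexp) (nes : seq nexp) : frame :=
  Frame (nth 0%N (map (ieval fr s) ies)) (nth 0 (map (neval fr s) nes)).

(* exec ps c fr s t fr' s': with procedures ps, the command c started in      *)
(* frame fr and store s halts in frame fr' and store s' after t elementary    *)
(* operations.                                                                *)
Inductive exec (ps : seq cmd) :
    cmd -> frame -> store -> nat -> frame -> store -> Prop :=
| ExecSkip fr s :
    exec ps Skip fr s 1 fr s
| ExecISet x e fr s :
    exec ps (ISet x e) fr s (icost e).+1 (set_ireg fr x (ieval fr s e)) s
| ExecNSet x e fr s :
    exec ps (NSet x e) fr s (ncost e).+1 (set_nreg fr x (neval fr s e)) s
| ExecIWrite a k e fr s :
    exec ps (IWrite a k e) fr s (icost k + icost e).+1
      fr (set_itab s a (ieval fr s k) (ieval fr s e))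
| ExecNWrite a k e fr s :
    exec ps (NWrite a k e) fr s (icost k + ncost e).+1
      fr (set_ntab s a (ieval fr s k) (neval fr s e))
| ExecSeq c1 c2 fr s t1 fr1 s1 t2 fr2 s2 :
    exec ps c1 fr s t1 fr1 s1 -> exec ps c2 fr1 s1 t2 fr2 s2 ->
    exec ps (Seq c1 c2) fr s (t1 + t2)%N fr2 s2
| ExecIf b c1 c2 fr s t fr' s' :
    exec ps (if beval fr s b then c1 else c2) fr s t fr' s' ->
    exec ps (If b c1 c2) fr s (bcost b + t).+1 fr' s'
| ExecWhileEnd b c fr s :
    beval fr s b = false ->
    exec ps (While b c) fr s (bcost b).+1 fr s
| ExecWhileStep b c fr s t1 fr1 s1 t2 fr2 s2 :
    beval fr s b = true ->
    exec ps c fr s t1 fr1 s1 -> exec ps (While b c) fr1 s1 t2 fr2 s2 ->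
    exec ps (While b c) fr s (bcost b + t1 + t2).+1 fr2 s2
| ExecCall f ies nes xi xn fr s t fr' s' :
    exec ps (nth Skip ps f) (call_frame fr s ies nes) s t fr' s' ->
    exec ps (Call f ies nes xi xn) fr s
      (sumn (map icost ies) + sumn (map ncost nes) + t).+1
      (set_nreg (set_ireg fr xi (ireg fr' 0%N)) xn (nreg fr' 0%N)) s'.

Lemma exec_det ps c fr s t1 fr1 s1 t2 fr2 s2 :
  exec ps c fr s t1 fr1 s1 -> exec ps c fr s t2 fr2 s2 ->
  [/\ t1 = t2, fr1 = fr2 & s1 = s2].
Proof.
move=> H; elim: H t2 fr2 s2 => {c fr s t1 fr1 s1}.
- by move=> fr s t2 fr2 s2 H; inversion H.
- by move=> x e fr s t2 fr2 s2 H; inversion H.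
- by move=> x e fr s t2 fr2 s2 H; inversion H.
- by move=> a k e fr s t2 fr2 s2 H; inversion H.
- by move=> a k e fr s t2 fr2 s2 H; inversion H.
- move=> c1 c2 fr s t1 fr1 s1 t2 fr2 s2 _ IH1 _ IH2 t3 fr3 s3 H.
  inversion H; subst.
  have [? ? ?] := IH1 _ _ _ ltac:(eassumption); subst.
  by have [-> -> ->] := IH2 _ _ _ ltac:(eassumption).
- move=> b c1 c2 fr s t fr' s' _ IH t3 fr3 s3 H; inversion H; subst.
  by have [-> -> ->] := IH _ _ _ ltac:(eassumption).
- by move=> b c fr s bF t3 fr3 s3 H; inversion H; subst=> //; congruence.
- move=> b c fr s t1 fr1 s1 t2 fr2 s2 bT _ IH1 _ IH2 t3 fr3 s3 H.
  inversion H; subst; first by congruence.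
  have [? ? ?] := IH1 _ _ _ ltac:(eassumption); subst.
  by have [-> -> ->] := IH2 _ _ _ ltac:(eassumption).
- move=> f ies nes xi xn fr s t fr' s' _ IH t3 fr3 s3 H; inversion H; subst.
  by have [-> -> ->] := IH _ _ _ ltac:(eassumption).
Qed.

End Semantics.

Section InputOutput.
Variables (R : realFieldType) (n m : nat) (I : ckp n m).

(* The table holding f 0, ..., f (n - 1), followed by z. *)
Definition table_of (T : Type) (z : T) (f : 'I_n -> T) (k : nat) : T :=
  if insub k is Some i then f i else z.

(* Index registers 0 and 1 hold n and m, number register 0 holds the          *)
(* capacity, number tables 0 and 1 the profits and the weights, and index     *)
(* table 0 the colors; the rest of the memory is 0.                           *)
Definition input_frame : frame R :=
  Frame (nth 0%N [:: n; m]) (nth 0 [:: (capacity I)%:~R]).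

Definition input_store : store R :=
  Store
    (nth (fun=> 0%N) [:: table_of 0%N (fun i => nat_of_ord (color I i))])
    (nth (fun=> 0) [:: table_of 0 (fun i => (profit I i)%:~R);
                       table_of 0 (fun i => (weight I i)%:~R)]).

(* The solution is read in number table 2. *)
Definition output (s : store R) (i : 'I_n) : R := ntab s 2%N i.

(* On the instance I, program P halts after t elementary operations with the  *)
(* solution x.                                                                *)
Definition computes_in (P : program) (t : nat) (x : 'I_n -> R) : Prop :=
  exists fr s, exec (procs P) (main P) input_frame input_store t fr s
            /\ x = output s.

End InputOutput.

(* Main.v *)
Require Import Defs.
From mathcomp Require Import all_boot all_order all_algebra.
From mathcomp Require Import zify ring lra.

(** The color constraint of [c] says that the sum of [x] over color [c] exceeds
    the rest by at most 1, so two color constraints cannot be violated at the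
    same time (excess_other).  The knapsack relaxation without colors is
    therefore solved first.  If its optimum violates no color constraint it is
    optimal; if it violates the constraint of [c], then by convexity this
    constraint can be made tight without loss, and once it is tight the other
    colors are harmless (tight_colored).  Complementing the items of the other
    colors, the remaining program is to maximize [q y] over the unit box subject
    to [sum y = K] and [s y <= B], and again either the second constraint can be
    dropped or it can be made tight (cheap_optimal, equality_optimal).

    A program with a single equality constraint is a fractional knapsack.  Its
    greedy solution is given by a threshold on the ratios (fill_opt), which is
    found in linear time by weighted selection, with medians of medians of three
    as pivots (runs_wsel).  Lexicographic ratios give, among the optimal
    solutions, the extreme ones for a second objective at no additional cost
    (runs_lks).

    The program with two equality constraints is solved by the prune-and-search
    technique of Megiddo and Dyer (runs_psearch).  Fixing the multiplier of one
    constraint leaves a program with a single constraint; the extreme optimal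
    solutions of the latter either mix to a solution of the whole program or show
    on which side of the chosen value the optimal multiplier strictly lies
    (runs_query).  In the plane of the two multipliers an item is the line where
    its reduced profit vanishes.  The slopes are shifted so that their median is
    0, lines of opposite slopes are paired, and one query is made at the median
    of each coordinate of the crossing points.  A constant fraction of the lines
    then misses the open quadrant that contains the optimal multipliers
    (count_pruned), and the variables of these items can be fixed
    (cornered_fix, prune_optimal).  A round costs time linear in the number of
    items left and removes a twelfth of them, so the total cost is linear. *)

Set Implicit Arguments.
Unset Strict Implicit.
Unset Printing Implicit Defensive.

Import Order.TTheory GRing.Theory Num.Theory.
Local Open Scope ring_scope.

(** * Executions with a cost bound *)
Section Calculus.
Variable R : realFieldType.
Implicit Types (fr : frame R) (s : store R) (c : cmd).

Fixpoint straight c : bool :=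
  match c with
  | Skip | ISet _ _ | NSet _ _ | IWrite _ _ _ | NWrite _ _ _ => true
  | Seq c1 c2 | If _ c1 c2 => straight c1 && straight c2
  | While _ _ | Call _ _ _ _ _ => false
  end.

(** The state transformer of a loop-free and call-free command.  It computes by
    simplification, which is how all loop bodies below are executed. *)
Fixpoint run c (st : frame R * store R) : frame R * store R :=
  match c with
  | ISet x e => (set_ireg st.1 x (ieval st.1 st.2 e), st.2)
  | NSet x e => (set_nreg st.1 x (neval st.1 st.2 e), st.2)
  | IWrite a k e =>
      (st.1, set_itab st.2 a (ieval st.1 st.2 k) (ieval st.1 st.2 e))
  | NWrite a k e =>
      (st.1, set_ntab st.2 a (ieval st.1 st.2 k) (neval st.1 st.2 e))
  | Seq c1 c2 => run c2 (run c1 st)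
  | If b c1 c2 => if beval st.1 st.2 b then run c1 st else run c2 st
  | Skip | While _ _ | Call _ _ _ _ _ => st
  end.

Fixpoint max_cost c : nat :=
  match c with
  | ISet _ e => (icost e).+1
  | NSet _ e => (ncost e).+1
  | IWrite _ k e => (icost k + icost e).+1
  | NWrite _ k e => (icost k + ncost e).+1
  | Seq c1 c2 => max_cost c1 + max_cost c2
  | If b c1 c2 => (bcost b + (max_cost c1 + max_cost c2)).+1
  | Skip | While _ _ | Call _ _ _ _ _ => 1
  end.

Lemma exec_straight ps c fr s : straight c ->
  exists2 t, (t <= max_cost c)%N
    & exec ps c fr s t (run c (fr, s)).1 (run c (fr, s)).2.
Proof.
elim: c fr s => //=.
- by move=> fr s _; exists 1%N => //; constructor.
- by move=> x e fr s _; exists (icost e).+1 => //; constructor.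
- by move=> x e fr s _; exists (ncost e).+1 => //; constructor.
- by move=> a k e fr s _; exists (icost k + icost e).+1 => //; constructor.
- by move=> a k e fr s _; exists (icost k + ncost e).+1 => //; constructor.
- move=> c1 IH1 c2 IH2 fr s /andP[s1 s2].
  have [t1 le1 e1] := IH1 fr s s1.
  have [t2 le2] := IH2 (run c1 (fr, s)).1 (run c1 (fr, s)).2 s2.
  rewrite -surjective_pairing => e2.
  by exists (t1 + t2)%N; [exact: leq_add | exact: ExecSeq e1 e2].
- move=> b c1 IH1 c2 IH2 fr s /andP[s1 s2].
  case bE: (beval fr s b).
  + have [t1 le1 e1] := IH1 fr s s1; exists (bcost b + t1).+1; first by lia.
    by apply: ExecIf; rewrite bE.
  + have [t1 le1 e1] := IH2 fr s s2; exists (bcost b + t1).+1; first by lia.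
    by apply: ExecIf; rewrite bE.
Qed.

Fixpoint written_iregs c : seq nat :=
  match c with
  | ISet x _ => [:: x]
  | Seq c1 c2 | If _ c1 c2 => written_iregs c1 ++ written_iregs c2
  | _ => [::]
  end.

Fixpoint written_nregs c : seq nat :=
  match c with
  | NSet x _ => [:: x]
  | Seq c1 c2 | If _ c1 c2 => written_nregs c1 ++ written_nregs c2
  | _ => [::]
  end.

Fixpoint written_itabs c : seq nat :=
  match c with
  | IWrite a _ _ => [:: a]
  | Seq c1 c2 | If _ c1 c2 => written_itabs c1 ++ written_itabs c2
  | _ => [::]
  end.

Fixpoint written_ntabs c : seq nat :=
  match c with
  | NWrite a _ _ => [:: a]
  | Seq c1 c2 | If _ c1 c2 => written_ntabs c1 ++ written_ntabs c2
  | _ => [::]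
  end.

(** The four lists are the registers and tables that may have changed.  A run of
    a straight command can only change what it syntactically writes, so these
    frame conditions come for free and invariants only mention what changes. *)
Record same_off (xi xn ti tn : seq nat) fr s fr' s' : Prop := SameOff {
  same_ireg : forall x, x \notin xi -> ireg fr' x = ireg fr x;
  same_nreg : forall x, x \notin xn -> nreg fr' x = nreg fr x;
  same_itab : forall a, a \notin ti -> itab s' a = itab s a;
  same_ntab : forall a, a \notin tn -> ntab s' a = ntab s a }.

Lemma same_off_trans xi xn ti tn fr1 s1 fr2 s2 fr3 s3 :
  same_off xi xn ti tn fr1 s1 fr2 s2 -> same_off xi xn ti tn fr2 s2 fr3 s3 ->
  same_off xi xn ti tn fr1 s1 fr3 s3.
Proof.
move=> [a1 b1 c1 d1] [a2 b2 c2 d2]; split=> x xP.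
- by rewrite a2 // a1.
- by rewrite b2 // b1.
- by rewrite c2 // c1.
- by rewrite d2 // d1.
Qed.

Lemma same_off_sub xi xn ti tn xi' xn' ti' tn' fr s fr' s' :
  same_off xi xn ti tn fr s fr' s' ->
  {subset xi <= xi'} -> {subset xn <= xn'} ->
  {subset ti <= ti'} -> {subset tn <= tn'} ->
  same_off xi' xn' ti' tn' fr s fr' s'.
Proof.
move=> [a1 b1 c1 d1] i1 i2 i3 i4; split=> x xP.
- by apply: a1; apply: contra xP => /i1.
- by apply: b1; apply: contra xP => /i2.
- by apply: c1; apply: contra xP => /i3.
- by apply: d1; apply: contra xP => /i4.
Qed.

Lemma run_same_off c fr s :
  same_off (written_iregs c) (written_nregs c) (written_itabs c)
    (written_ntabs c) fr s (run c (fr, s)).1 (run c (fr, s)).2.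
Proof.
elim: c fr s => //=.
- move=> x e fr s; split=> //= y; rewrite inE /upd => /negbTE yx.
  by rewrite yx.
- move=> x e fr s; split=> //= y; rewrite inE /upd => /negbTE yx.
  by rewrite yx.
- move=> a k e fr s; split=> //= y; rewrite inE /upd => /negbTE yx.
  by rewrite yx.
- move=> a k e fr s; split=> //= y; rewrite inE /upd => /negbTE yx.
  by rewrite yx.
- move=> c1 IH1 c2 IH2 fr s.
  have := IH2 (run c1 (fr, s)).1 (run c1 (fr, s)).2.
  rewrite -surjective_pairing => H2; have H1 := IH1 fr s.
  apply: same_off_trans (same_off_sub H1 _ _ _ _) (same_off_sub H2 _ _ _ _);
    by move=> x xP; rewrite mem_cat xP ?orbT.
- move=> b c1 IH1 c2 IH2 fr s; case: ifP => _.
  + by apply: same_off_sub (IH1 fr s) _ _ _ _ => x xP; rewrite mem_cat xP.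
  + by apply: same_off_sub (IH2 fr s) _ _ _ _ => x xP;
      rewrite mem_cat xP orbT.
Qed.

(** Total correctness with a cost bound.  The rules below are stated backwards:
    a rule spends a part of the budget [N] and passes on the rest. *)
Definition runs ps c fr s (N : nat) (Q : frame R -> store R -> Prop) : Prop :=
  exists t fr' s', [/\ exec ps c fr s t fr' s', (t <= N)%N & Q fr' s'].

Lemma runs_weaken ps c fr s N N' (Q Q' : frame R -> store R -> Prop) :
  runs ps c fr s N Q -> (N <= N')%N -> (forall fr' s', Q fr' s' -> Q' fr' s') ->
  runs ps c fr s N' Q'.
Proof.
move=> [t [fr' [s' [e le q]]]] leN QQ'; exists t, fr', s'; split=> //.
  exact: leq_trans le leN.
exact: QQ'.
Qed.

Lemma runs_straight ps c fr s N Q :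
  straight c -> (max_cost c <= N)%N ->
  Q (run c (fr, s)).1 (run c (fr, s)).2 -> runs ps c fr s N Q.
Proof.
move=> sc le q; have [t let' e] := exec_straight ps fr s sc.
by exists t, (run c (fr, s)).1, (run c (fr, s)).2; split=> //;
  exact: leq_trans let' le.
Qed.

Lemma runs_seq ps c1 c2 fr s N1 N Q1 Q :
  runs ps c1 fr s N1 Q1 -> (N1 <= N)%N ->
  (forall fr' s', Q1 fr' s' -> runs ps c2 fr' s' (N - N1) Q) ->
  runs ps (Seq c1 c2) fr s N Q.
Proof.
move=> [t1 [fr1 [s1 [e1 le1 q1]]]] le H.
have [t2 [fr2 [s2 [e2 le2 q2]]]] := H _ _ q1.
by exists (t1 + t2)%N, fr2, s2; split=> //; [exact: ExecSeq e1 e2 | lia].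
Qed.

Lemma runs_seq_straight ps c1 c2 fr s k N Q :
  straight c1 -> (max_cost c1 <= k <= N)%N ->
  runs ps c2 (run c1 (fr, s)).1 (run c1 (fr, s)).2 (N - k) Q ->
  runs ps (Seq c1 c2) fr s N Q.
Proof.
move=> sc /andP[lek leN] H.
apply: (@runs_seq _ _ _ _ _ k _
  (fun fr' s' => fr' = (run c1 (fr, s)).1 /\ s' = (run c1 (fr, s)).2)) => //.
  exact: runs_straight.
by move=> fr' s' [-> ->].
Qed.

Lemma runs_if ps b c1 c2 fr s k N Q :
  (bcost b < k <= N)%N ->
  (beval fr s b -> runs ps c1 fr s (N - k) Q) ->
  (~~ beval fr s b -> runs ps c2 fr s (N - k) Q) ->
  runs ps (If b c1 c2) fr s N Q.
Proof.
move=> lek H1 H2; case bE: (beval fr s b).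
  have [t [fr' [s' [e le q]]]] := H1 bE.
  by exists (bcost b + t).+1, fr', s'; split=> //;
    [apply: ExecIf; rewrite bE | lia].
have [|t [fr' [s' [e le q]]]] := H2; first by rewrite bE.
by exists (bcost b + t).+1, fr', s'; split=> //;
    [apply: ExecIf; rewrite bE | lia].
Qed.

Lemma runs_call ps f ies nes xi xn fr s k N Q :
  (sumn (map icost ies) + sumn (map ncost nes) < k <= N)%N ->
  runs ps (nth Skip ps f) (call_frame fr s ies nes) s (N - k)
    (fun fr' s' =>
       Q (set_nreg (set_ireg fr xi (ireg fr' 0%N)) xn (nreg fr' 0%N)) s') ->
  runs ps (Call f ies nes xi xn) fr s N Q.
Proof.
move=> lek [t [fr' [s' [e le q]]]].
exists (sumn (map icost ies) + sumn (map ncost nes) + t).+1.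
exists (set_nreg (set_ireg fr xi (ireg fr' 0%N)) xn (nreg fr' 0%N)), s'.
by split; [exact: ExecCall e | lia | exact: q].
Qed.

(** The number [m] of iterations is known beforehand, and the body is straight, so
    the cost of one iteration is bounded by a syntactic constant. *)
Lemma runs_while ps b c fr s (m k : nat)
    (Inv : nat -> frame R -> store R -> Prop) :
  straight c -> (bcost b + max_cost c < k)%N ->
  Inv 0%N fr s ->
  (forall j fr' s', (j < m)%N ->
     same_off (written_iregs c) (written_nregs c) (written_itabs c)
       (written_ntabs c) fr s fr' s' ->
     Inv j fr' s' ->
     beval fr' s' b
     /\ Inv j.+1 (run c (fr', s')).1 (run c (fr', s')).2) ->
  (forall fr' s',
     same_off (written_iregs c) (written_nregs c) (written_itabs c)
       (written_ntabs c) fr s fr' s' ->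
     Inv m fr' s' -> ~~ beval fr' s' b) ->
  runs ps (While b c) fr s (k * m.+1) (fun fr' s' =>
    same_off (written_iregs c) (written_nregs c) (written_itabs c)
       (written_ntabs c) fr s fr' s' /\ Inv m fr' s').
Proof.
move=> sc lek I0 Istep Iend.
suff H d : (d <= m)%N -> forall fr' s',
    same_off (written_iregs c) (written_nregs c) (written_itabs c)
       (written_ntabs c) fr s fr' s' ->
    Inv (m - d)%N fr' s' ->
    runs ps (While b c) fr' s' (k * d.+1) (fun fr' s' =>
      same_off (written_iregs c) (written_nregs c) (written_itabs c)
       (written_ntabs c) fr s fr' s' /\ Inv m fr' s').
  by apply: (H m) => //; rewrite subnn.
elim: d => [|d IH] led fr1 s1 so I1.
  rewrite subn0 in I1; have bE := Iend _ _ so I1.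
  exists (bcost b).+1, fr1, s1; split=> //; last by rewrite muln1; lia.
  by apply: ExecWhileEnd; exact: negbTE.
have [|bE I2] := Istep _ _ _ _ so I1; first by lia.
have [t1 le1 e1] := exec_straight ps fr1 s1 sc.
have so2 := same_off_trans so (run_same_off c fr1 s1).
have [||t2 [fr2 [s2 [e2 le2 q2]]]] := IH _ _ _ so2; first by lia.
  by have -> : (m - d = (m - d.+1).+1)%N by lia.
exists (bcost b + t1 + t2).+1, fr2, s2; split=> //.
  exact: ExecWhileStep e1 e2.
by rewrite mulnS; lia.
Qed.

(** Sets of items are lists of indices, stored as contiguous blocks of index
    table 1. *)
Definition block s src len : seq nat := [seq itab s 1%N j | j <- iota src len].

Lemma size_block s src len : size (block s src len) = len.
Proof. by rewrite size_map size_iota. Qed.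

Lemma nth_block s src len j :
  (j < len)%N -> nth 0%N (block s src len) j = itab s 1%N (src + j).
Proof. by move=> lt; rewrite (nth_map 0%N) ?size_iota // nth_iota. Qed.

Lemma eq_block s s' src len :
  (forall j, (src <= j < src + len)%N -> itab s' 1%N j = itab s 1%N j) ->
  block s' src len = block s src len.
Proof. by move=> H; apply/eq_in_map => j; rewrite mem_iota => /H. Qed.

Lemma eq_block_tab s s' src len :
  itab s' 1%N = itab s 1%N -> block s' src len = block s src len.
Proof. by move=> H; apply: eq_block => j _; rewrite H. Qed.

Lemma block_push s dst cnt i :
  block (set_itab s 1%N (dst + cnt) i) dst cnt.+1 = rcons (block s dst cnt) i.
Proof.
rewrite /block -(addn1 cnt) iotaD map_cat /= /upd eqxx -cats1.
congr (_ ++ _); last by rewrite eqxx.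
apply/eq_in_map => j; rewrite mem_iota => /andP[_ lt].
by rewrite ltn_eqF.
Qed.

Lemma block_take s src len k :
  (k <= len)%N -> block s src k = take k (block s src len).
Proof. by move=> le; rewrite /block -map_take take_iota (minn_idPl le). Qed.

(** Register 3 is the position in the list and register 4 the current item; the
    list is the block of index table 1 that starts at register [rs] and has the
    length held by register [rl]. *)
Definition foreach (rs rl : nat) (body : cmd) : cmd :=
  Seq (ISet 3 (IConst 0))
   (While (BNot (ILe (IReg rl) (IReg 3)))
      (Seq (ISet 4 (IRead 1 (IAdd (IReg rs) (IReg 3))))
        (Seq body (ISet 3 (IAdd (IReg 3) (IConst 1)))))).

(** The invariant is indexed by the part of the list already treated, and it must
    be blind to the two loop registers.  The list is read while the loop runs:
    either the body leaves index table 1 alone, or the invariant protects the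
    block of the list. *)
Lemma runs_foreach ps rs rl body l fr s
    (Inv : seq nat -> frame R -> store R -> Prop) k N Q :
  straight body -> (max_cost body + 20 <= k)%N ->
  (k * (size l).+2 <= N)%N ->
  [/\ rs \notin 3%N :: 4%N :: written_iregs body,
      rl \notin 3%N :: 4%N :: written_iregs body
    & 3%N \notin written_iregs body] ->
  block s (ireg fr rs) (ireg fr rl) = l ->
  Inv [::] fr s ->
  (forall x pre fr1 s1 v, x \in [:: 3; 4]%N -> Inv pre fr1 s1 ->
     Inv pre (set_ireg fr1 x v) s1) ->
  (forall pre i post fr1 s1, l = pre ++ i :: post ->
     same_off (3%N :: 4%N :: written_iregs body) (written_nregs body)
       (written_itabs body) (written_ntabs body) fr s fr1 s1 ->
     ireg fr1 4%N = i -> Inv pre fr1 s1 ->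
     Inv (rcons pre i) (run body (fr1, s1)).1 (run body (fr1, s1)).2) ->
  (1%N \notin written_itabs body \/
   forall pre post fr1 s1, l = pre ++ post -> Inv pre fr1 s1 ->
     block s1 (ireg fr rs) (ireg fr rl) = l) ->
  (forall fr1 s1,
     same_off (3%N :: 4%N :: written_iregs body) (written_nregs body)
       (written_itabs body) (written_ntabs body) fr s fr1 s1 ->
     Inv l fr1 s1 -> Q fr1 s1) ->
  runs ps (foreach rs rl body) fr s N Q.
Proof.
move=> sb lek leN [rsN rlN N3] lE I0 Ireg Istep Itab IQ.
rewrite mulnS in leN.
have szl : size l = ireg fr rl by rewrite -lE size_block.
set c := Seq (ISet 4 (IRead 1 (IAdd (IReg rs) (IReg 3))))
        (Seq body (ISet 3 (IAdd (IReg 3) (IConst 1)))).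
have soW fr1 s1 fr2 s2 : same_off (written_iregs c) (written_nregs c)
    (written_itabs c) (written_ntabs c) fr1 s1 fr2 s2 ->
    same_off (3%N :: 4%N :: written_iregs body) (written_nregs body)
       (written_itabs body) (written_ntabs body) fr1 s1 fr2 s2.
  move=> H; apply: same_off_sub H _ _ _ _ => x; rewrite /= ?cats0 //.
  rewrite inE mem_cat !inE => /orP[/eqP ->|/orP[->|/eqP->]] //;
    by rewrite ?eqxx ?orbT.
have so3 v : same_off (3%N :: 4%N :: written_iregs body) (written_nregs body)
       (written_itabs body) (written_ntabs body) fr s (set_ireg fr 3 v) s.
  split=> //= x; rewrite inE negb_or /upd => /andP[/negbTE -> //].
pose J j fr1 s1 := [/\ (j <= size l)%N, ireg fr1 3%N = j,
  Inv (take j l) fr1 s1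
  & same_off (3%N :: 4%N :: written_iregs body) (written_nregs body)
       (written_itabs body) (written_ntabs body) fr s fr1 s1].
apply: (@runs_seq_straight _ _ _ _ _ 2) => //=; first by lia.
set fr0 := set_ireg fr 3 0%N.
have W := @runs_while ps (BNot (ILe (IReg rl) (IReg 3))) c fr0 s (size l) k J.
apply: runs_weaken (W _ _ _ _ _) _ _ => //=; first by rewrite sb.
- by lia.
- by split=> //; [rewrite take0; apply: (Ireg) | exact: so3].
- move=> j fr1 s1 ltj _ [lej r3 Ij so].
  have rl1 : ireg fr1 rl = ireg fr rl by apply: (same_ireg so).
  have rs1 : ireg fr1 rs = ireg fr rs by apply: (same_ireg so).
  split; first by rewrite rl1 r3 -szl -ltnNge.
  have rd : itab s1 1%N (ireg fr1 rs + ireg fr1 3%N) = nth 0%N l j.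
    rewrite rs1 r3 -(nth_block s1 (ireg fr rs) ltj); congr (nth _ _ _).
    case: Itab => [n1|]; last first.
      move=> H; rewrite szl; apply: (H (take j l) (drop j l) fr1) => //.
      by rewrite cat_take_drop.
    rewrite szl; apply: etrans lE; apply: eq_block_tab; exact: (same_itab so).
  rewrite /c /= rd; set fr2 := set_ireg fr1 4 _.
  have so2 : same_off (3%N :: 4%N :: written_iregs body) (written_nregs body)
       (written_itabs body) (written_ntabs body) fr s fr2 s1.
    apply: same_off_trans so _; split=> //= x.
    by rewrite !inE !negb_or /upd => /and3P[_ /negbTE ->].
  have so4 : same_off (3%N :: 4%N :: written_iregs body) (written_nregs body)
      (written_itabs body) (written_ntabs body) fr s (run body (fr2, s1)).1
      (run body (fr2, s1)).2.
    apply: same_off_trans so2 (same_off_sub (run_same_off body fr2 s1) _ _ _ _)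
      => // x xP; by rewrite !inE xP !orbT.
  have r3' : ireg (run body (fr2, s1)).1 3%N = j.
    by rewrite (same_ireg (run_same_off body fr2 s1)) // /fr2 /= r3.
  split=> //=.
  + by rewrite /upd eqxx r3' addn1.
  + apply: (Ireg) => //; rewrite (take_nth 0%N) //.
    apply: (Istep _ _ (drop j.+1 l)) => //.
    * by rewrite -(drop_nth 0%N) // cat_take_drop.
    * by apply: (Ireg).
  + apply: same_off_trans so4 _; split=> //= x.
    by rewrite !inE !negb_or /upd => /and3P[/negbTE ->].
- move=> fr1 s1 _ [_ r3 _ so]; rewrite (same_ireg so) // r3 -szl.
  by rewrite leqnn.
- by lia.
- by move=> fr1 s1 [_ [_ _ I so]]; apply: IQ => //; rewrite take_size in I.
Qed.

End Calculus.

(** * Thresholds and medians *)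
Section Threshold.
Variables (disp : Order.disp_t) (K : orderType disp) (R : realFieldType).
Variables (key : nat -> K).
Implicit Types (l : seq nat) (w : nat -> R) (p : nat).

Definition above p l w : R := \sum_(i <- l | (key p < key i)%O) w i.
Definition from p l w : R := \sum_(i <- l | (key p <= key i)%O) w i.

(** Filling a knapsack of capacity [T] by decreasing keys stops at item [p]: the
    items strictly above it fit, those from its key on fill the knapsack.  With
    unit weights and [T] half of the size, [p] is a median. *)
Definition threshold l w (T : R) p : Prop := above p l w <= T <= from p l w.

Lemma eq_above p l w w' : {in l, w =1 w'} -> above p l w = above p l w'.
Proof.
move=> E; rewrite /above big_seq_cond [RHS]big_seq_cond.
by apply: eq_bigr => i /andP[/E].
Qed.

Lemma eq_from p l w w' : {in l, w =1 w'} -> from p l w = from p l w'.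
Proof.
move=> E; rewrite /from big_seq_cond [RHS]big_seq_cond.
by apply: eq_bigr => i /andP[/E].
Qed.

Lemma eq_threshold l w w' T p :
  {in l, w =1 w'} -> threshold l w T p -> threshold l w' T p.
Proof. by move=> E; rewrite /threshold (eq_above p E) (eq_from p E). Qed.

(** If the items above [p] already overfill the knapsack, then the other items can
    be discarded; [threshold_lt] is the opposite case, where the items from the
    key of [p] on are taken and their weight is deducted. *)
Lemma threshold_gt l w T p p' :
  (key p < key p')%O ->
  threshold [seq i <- l | (key p < key i)%O] w T p' -> threshold l w T p'.
Proof.
move=> lt; rewrite /threshold /above /from !big_filter_cond.
suff E (r : rel K) : (forall x y, r x y -> (x <= y)%O) ->
    \sum_(i <- l | (key p < key i)%O && r (key p') (key i)) w i =
    \sum_(i <- l | r (key p') (key i)) w i.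
  by rewrite (E <%O) ?(E <=%O) // => x y /ltW.
move=> rle; apply: eq_bigl => i; case rE: (r _ _); last by rewrite andbF.
by rewrite andbT (lt_le_trans lt) // rle.
Qed.

Lemma threshold_lt l w T p p' :
  (key p' < key p)%O ->
  threshold [seq i <- l | (key i < key p)%O] w (T - from p l w) p' ->
  threshold l w T p'.
Proof.
move=> lt; rewrite /threshold /above /from !big_filter_cond.
suff E (r : rel K) : (forall x y, r x y -> (x <= y)%O) ->
    (forall x y, (x < y)%O -> r x y) ->
    \sum_(i <- l | r (key p') (key i)) w i =
    \sum_(i <- l | (key i < key p)%O && r (key p') (key i)) w i
     + \sum_(i <- l | (key p <= key i)%O) w i.
  by rewrite (E <%O) ?(E <=%O) ?lerBrDr ?lerBlDr // => x y /ltW.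
move=> rle rlt; rewrite (bigID (fun i => (key i < key p)%O)) /=; congr (_ + _).
  by apply: eq_bigl => i; rewrite andbC.
apply: eq_bigl => i; rewrite -leNgt; case: leP; rewrite ?andbF // andbT => le.
by rewrite rlt // (lt_le_trans lt).
Qed.

Lemma from_split l w p :
  \sum_(i <- l) w i = from p l w + \sum_(i <- l | (key i < key p)%O) w i.
Proof.
rewrite (bigID (fun i => (key p <= key i)%O)) /=; congr (_ + _).
by apply: eq_bigl => i; rewrite -ltNge.
Qed.

Lemma threshold_count l p :
  threshold l (fun=> 1) ((size l)%:R / 2%:R) p ->
  (size l <= (count (fun i => key i <= key p)%O l).*2)%N
  /\ (size l <= (count (fun i => key p <= key i)%O l).*2)%N.
Proof.
rewrite /threshold /above /from !big_const_seq !iter_addr_0 => /andP[h1 h2].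
have E : (count (fun i => key i <= key p)%O l +
          count (fun i => key p < key i)%O l = size l)%N.
  rewrite -(count_predC (fun i => key i <= key p)%O l); congr (_ + _)%N.
  by apply: eq_count => i /=; rewrite ltNge.
set a := count _ _ in E *; set b := count _ _ in E h1; set c := count _ _.
have h1' : (b.*2 <= size l)%N.
  by rewrite -(ler_nat R) -muln2 natrM; move: h1; rewrite -/b; lra.
have h2' : (size l <= c.*2)%N.
  by rewrite -(ler_nat R) -muln2 natrM; move: h2; rewrite -/c; lra.
by lia.
Qed.

(** Medians of groups of three, applied twice, take the place of medians of groups
    of five: a single round would leave a recursion of total size n, whereas two
    rounds give n/9 + 7n/9. *)
Definition median3 (a b c : nat) : nat :=
  if (key a <= key b)%O then
    if (key b <= key c)%O then b else if (key a <= key c)%O then c else a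
  else
    if (key a <= key c)%O then a else if (key b <= key c)%O then c else b.

Fixpoint medians l : seq nat :=
  match l with
  | [:: a, b, c & l'] => median3 a b c :: medians l'
  | _ => [::]
  end.

Lemma seq_ind3 (P : seq nat -> Prop) :
  (forall l, (size l < 3)%N -> P l) ->
  (forall a b c l, P l -> P [:: a, b, c & l]) -> forall l, P l.
Proof.
move=> P0 P3 l; have [n] := ubnP (size l).
elim: n l => // n IH [|a [|b [|c l]]] lt; try by apply: P0.
by apply/P3/IH; move: lt => /=; lia.
Qed.

Lemma size_medians l : size (medians l) = (size l %/ 3)%N.
Proof.
elim/seq_ind3: l => [[|a [|b [|]]]|a b c l IH] //=; rewrite IH; lia.
Qed.

Lemma nth_medians l j : (j < size l %/ 3)%N ->
  nth 0%N (medians l) j =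
  median3 (nth 0%N l (3 * j)) (nth 0%N l (3 * j + 1)) (nth 0%N l (3 * j + 2)).
Proof.
elim/seq_ind3: l j => [l lt j|a b c l IH [|j] //]; first by lia.
have -> : (3 * j.+1 = (3 * j).+3)%N by lia.
by rewrite !addSn /= => lt; rewrite IH //; lia.
Qed.

Lemma mem_medians l : {subset medians l <= l}.
Proof.
elim/seq_ind3: l => [[|a [|b [|]]]|a b c l IH] //= x.
rewrite inE => /orP[/eqP->|/IH]; rewrite !inE; last by move->; rewrite !orbT.
by rewrite /median3; do !case: ifP => _; rewrite eqxx ?orbT.
Qed.

(** Half of a predicate closed under larger keys is seen by the medians: if the
    median of a group satisfies it, so does another member of the group. *)
Lemma count_medians_up (P : pred nat) l :
  (forall x y, (key x <= key y)%O -> P x -> P y) ->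
  ((count P (medians l)).*2 <= count P l)%N.
Proof.
move=> mono; elim/seq_ind3: l => [[|a [|b [|]]]|a b c l IH] //=; try by lia.
suff : ((P (median3 a b c)).*2 <= P a + P b + P c)%N by lia.
rewrite /median3.
case: (leP (key a) (key b)) => [|/ltW] /mono ab;
  case: (leP (key b) (key c)) => [|/ltW] /mono bc;
  case: (leP (key a) (key c)) => [|/ltW] /mono ac;
  case: (P a) (P b) (P c) ab bc ac => [] [] [] //= ab bc ac;
  solve [by have := ab isT | by have := bc isT | by have := ac isT].
Qed.

Lemma count_medians_down (P : pred nat) l :
  (forall x y, (key x <= key y)%O -> P y -> P x) ->
  ((count P (medians l)).*2 <= count P l)%N.
Proof.
move=> mono; elim/seq_ind3: l => [[|a [|b [|]]]|a b c l IH] //=; try by lia.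
suff : ((P (median3 a b c)).*2 <= P a + P b + P c)%N by lia.
rewrite /median3.
case: (leP (key a) (key b)) => [|/ltW] /mono ab;
  case: (leP (key b) (key c)) => [|/ltW] /mono bc;
  case: (leP (key a) (key c)) => [|/ltW] /mono ac;
  case: (P a) (P b) (P c) ab bc ac => [] [] [] //= ab bc ac;
  solve [by have := ab isT | by have := bc isT | by have := ac isT].
Qed.

(** Each of the two rounds of medians doubles the count, and the median of what
    remains has half of the n/9 survivors on either side. *)
Lemma pivot_rank l p :
  threshold (medians (medians l)) (fun=> 1)
    ((size (medians (medians l)))%:R / 2%:R) p ->
  ((size l %/ 9).*2 <= count (fun i => key i <= key p)%O l)%N
  /\ ((size l %/ 9).*2 <= count (fun i => key p <= key i)%O l)%N.
Proof.
move=> /threshold_count; rewrite !size_medians => -[h1 h2]; split.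
- have D : forall x y, (key x <= key y)%O -> (key y <= key p)%O ->
    (key x <= key p)%O by move=> x y; apply: le_trans.
  have := count_medians_down (medians l) D; have := count_medians_down l D.
  by lia.
- have U : forall x y, (key x <= key y)%O -> (key p <= key x)%O ->
    (key p <= key y)%O by move=> x y xy px; apply: le_trans px xy.
  have := count_medians_up (medians l) U; have := count_medians_up l U.
  by lia.
Qed.

End Threshold.

Lemma eq_threshold_key disp (K : orderType disp) (R : realFieldType)
    (key key' : nat -> K) l (w : nat -> R) T p :
  p \in l -> {in l, key =1 key'} -> threshold key l w T p ->
  threshold key' l w T p.
Proof.
move=> pl E; rewrite /threshold /above /from big_seq_cond.
rewrite [X in _ <= _ <= X -> _]big_seq_cond.
rewrite [X in _ -> X <= _ <= _]big_seq_cond [X in _ -> _ <= _ <= X]big_seq_cond.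
rewrite (eq_bigl (fun i => (i \in l) && (key' p < key' i)%O)); last first.
  by move=> i; case il: (i \in l); rewrite //= !E.
rewrite [X in _ <= _ <= X -> _](eq_bigl (fun i => (i \in l) && (key' p <= key' i)%O)) //.
by move=> i; case il: (i \in l); rewrite //= !E.
Qed.

(** * Linear programs with one equality constraint *)
Section Vectors.
Variable R : realFieldType.
Implicit Types (l : seq nat) (c x y z : nat -> R) (t : R).

Definition dot l c y : R := \sum_(i <- l) c i * y i.
Definition in_box l y : Prop := forall i, i \in l -> 0 <= y i <= 1.
Definition comb t y z (i : nat) : R := (1 - t) * y i + t * z i.

Lemma eq_dot l c y y' : {in l, y =1 y'} -> dot l c y = dot l c y'.
Proof. by move=> E; apply: eq_big_seq => i /E ->. Qed.

Lemma dot_lin l c a b y z :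
  dot l c (fun i => a * y i + b * z i) = a * dot l c y + b * dot l c z.
Proof.
rewrite /dot !mulr_sumr -big_split /=; apply: eq_bigr => i _; ring.
Qed.

Lemma dot_comb l c t y z :
  dot l c (comb t y z) = (1 - t) * dot l c y + t * dot l c z.
Proof. exact: dot_lin. Qed.

Lemma convex_unit t (y z : R) :
  0 <= t <= 1 -> 0 <= y <= 1 -> 0 <= z <= 1 ->
  0 <= (1 - t) * y + t * z <= 1.
Proof. by nra. Qed.

Lemma box_comb l t y z :
  0 <= t <= 1 -> in_box l y -> in_box l z -> in_box l (comb t y z).
Proof. by move=> t01 by_ bz i il; apply: convex_unit; [|exact: by_|exact: bz]. Qed.

Lemma between (a b c : R) : a <= c <= b ->
  let t := (c - a) / (b - a) in 0 <= t <= 1 /\ (1 - t) * a + t * b = c.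
Proof.
move=> /andP[ac cb] /=; have [ab|ab] := eqVneq a b.
  by rewrite ab subrr invr0 mulr0 lexx ler01; split=> //; lra.
have ba : 0 < b - a by rewrite subr_gt0 lt_neqAle ab (le_trans ac).
split; last by field; rewrite gt_eqF.
apply/andP; split; first by apply: divr_ge0; [rewrite subr_ge0 | exact: ltW].
by rewrite ler_pdivrMr // mul1r lerD2r.
Qed.

(** An optimum that overshoots a constraint can be pulled back, along the segment
    to any point within the constraint, until the constraint is tight; the
    objective of that point is not lost. *)
Lemma reach l g f (d : R) y z :
  in_box l y -> in_box l z ->
  dot l g y <= d -> d <= dot l g z -> dot l f y <= dot l f z ->
  exists t, [/\ 0 <= t <= 1, in_box l (comb t y z),
    dot l g (comb t y z) = d & dot l f y <= dot l f (comb t y z)].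
Proof.
move=> by_ bz gy gz fyz; have [|t01 tE] := @between (dot l g y) (dot l g z) d.
  by rewrite gy.
set t := _ / _ in t01 tE; exists t; split=> //; first exact: box_comb.
  by rewrite dot_comb.
by rewrite dot_comb; nra.
Qed.

Lemma dot_delta l c i y (a b : R) : uniq l -> i \in l ->
  dot l c (fun j => a * y j + b * (j == i)%:R) = a * dot l c y + b * c i.
Proof.
move=> ul il; rewrite dot_lin; congr (_ + b * _).
rewrite /dot (bigD1_seq i) //= eqxx mulr1 big1 ?addr0 // => j /negbTE ->.
by rewrite mulr0.
Qed.

End Vectors.

Notation lexkey R := (R *lexi[ring_display] R)%type.

Section OneConstraint.
Variable R : realFieldType.
Implicit Types (l : seq nat) (v u a x y : nat -> R) (T : R).

Definition lex_le (x1 x2 y1 y2 : R) : bool :=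
  (x1 <= y1) && ~~ ((y1 <= x1) && ~~ (x2 <= y2)).

Definition lkey (k1 k2 : nat -> R) (i : nat) : lexkey R := (k1 i, k2 i).

Lemma lex_leE k1 k2 i j :
  lex_le (k1 i) (k2 i) (k1 j) (k2 j) = (lkey k1 k2 i <= lkey k1 k2 j)%O.
Proof.
by rewrite /lex_le Order.ProdLexiOrder.lexi_pair negb_and negbK implybE.
Qed.

(** Optimality for the objective [v] and, among its maximizers, for [u]; that is,
    optimality for [v] perturbed by an infinitesimal multiple of [u]. *)
Definition lex_opt l v u a T y : Prop :=
  [/\ in_box l y, dot l a y = T
    & forall x, in_box l x -> dot l a x = T ->
      dot l v x <= dot l v y
      /\ (dot l v x = dot l v y -> dot l u x <= dot l u y)].

(** Complementary slackness for the multiplier [(t1, t2)] of the constraint, in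
    lexicographic form. *)
Lemma lex_opt_cert l v u a T y (t1 t2 : R) :
  in_box l y -> dot l a y = T ->
  (forall i, i \in l ->
     let r1 := v i - t1 * a i in let r2 := u i - t2 * a i in
     [/\ 0 < r1 -> y i = 1, r1 < 0 -> y i = 0,
         r1 = 0 -> 0 < r2 -> y i = 1 & r1 = 0 -> r2 < 0 -> y i = 0]) ->
  lex_opt l v u a T y.
Proof.
move=> yb yT H; split=> // x xb xT.
have red (c : nat -> R) (t : R) : dot l c x - dot l c y =
    \sum_(i <- l) (c i - t * a i) * (x i - y i).
  rewrite (eq_bigr (fun i => (c i * x i - c i * y i) -
     t * (a i * x i - a i * y i))); last by move=> i _; ring.
  rewrite sumrB -mulr_sumr !sumrB -!/(dot _ _ _) xT yT; ring.
have le1 i : i \in l -> (v i - t1 * a i) * (x i - y i) <= 0.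
  move=> il; have [h1 h2 _ _] := H i il; have /andP[x0 x1] := xb i il.
  have [r|r|->] := ltgtP (v i - t1 * a i) 0; last by rewrite mul0r.
  - by rewrite h2 // subr0 nmulr_rle0.
  - by rewrite h1 // pmulr_rle0 // subr_le0.
have L : dot l v x - dot l v y <= 0.
  by rewrite (red v t1) big_seq sumr_le0.
split; first by rewrite -subr_le0.
move=> E; rewrite -subr_le0 (red u t2) big_seq sumr_le0 // => i il.
have : \sum_(i <- l) (v i - t1 * a i) * (x i - y i) = 0.
  by rewrite -red E subrr.
move=> S0; have Z : (v i - t1 * a i) * (x i - y i) = 0.
  have : \sum_(j <- l | j \in l) - ((v j - t1 * a j) * (x j - y j)) = 0.
    by rewrite -big_seq sumrN S0 oppr0.
  move/eqP; rewrite psumr_eq0; last by move=> j jl; rewrite oppr_ge0 le1.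
  by move=> /allP/(_ i il); rewrite il oppr_eq0 => /eqP.
have [h1 h2 h3 h4] := H i il; have /andP[x0 x1] := xb i il.
move/eqP: Z; rewrite mulf_eq0 => /orP[/eqP r1|/eqP->]; last by rewrite mulr0.
have [r|r|->] := ltgtP (u i - t2 * a i) 0; last by rewrite mul0r.
- by rewrite h4 // subr0 nmulr_rle0.
- by rewrite h3 // pmulr_rle0 // subr_le0.
Qed.

(** The items tied with the threshold all get the same fraction, so no order among
    them has to be chosen; an item with negative coefficient is filled as its
    complement. *)
Definition fill v u a (t1 t2 phi : R) (i : nat) : R :=
  let r1 := v i - t1 * a i in let r2 := u i - t2 * a i in
  if lex_le r1 r2 0 0 then
    if lex_le 0 0 r1 r2 then (if 0 <= a i then phi else 1 - phi) else 0
  else 1.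

(** Replacing [y i] by [1 - y i] where [a i < 0] gives a knapsack with weights
    [`|a i|] and capacity [T'] in which the ratios [v i / a i] are unchanged, and
    the greedy solution is optimal.  Items with [a i = 0] have weight 0 and do not
    affect the threshold; [fill] decides them by the sign of their objective. *)
Lemma fill_opt l v u a T p k1 k2 w :
  (forall i, i \in l -> k1 i = v i / a i) ->
  (forall i, i \in l -> k2 i = u i / a i) ->
  (forall i, i \in l -> w i = `|a i|) ->
  let T' := T + \sum_(i <- l | a i < 0) - a i in
  let W1 := above (lkey k1 k2) p l w in
  let W2 := from (lkey k1 k2) p l w in
  W1 <= T' <= W2 ->
  lex_opt l v u a T (fill v u a (k1 p) (k2 p) ((T' - W1) / (W2 - W1))).
Proof.
move=> k1E k2E wE T' W1 W2 /between /=.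
set phi := _ / _ => -[phi01 phiE].
have lexP (r1 r2 : R) : lex_le r1 r2 0 0 = (r1 < 0) || (r1 == 0) && (r2 <= 0).
  rewrite /lex_le negb_and negbK.
  by case: (ltgtP r1 0).
have lexN (r1 r2 : R) : lex_le 0 0 r1 r2 = (0 < r1) || (r1 == 0) && (0 <= r2).
  rewrite /lex_le negb_and negbK.
  by case: (ltgtP r1 0).
apply: (@lex_opt_cert _ _ _ _ _ _ (k1 p) (k2 p)).
- move=> i il; by rewrite /fill; do ?case: ifP => _; rewrite ?lexx ?ler01 //; lra.
- have term i : i \in l -> a i * fill v u a (k1 p) (k2 p) phi i =
     (if a i < 0 then a i else 0) + w i *
      ((1 - phi) * (if (lkey k1 k2 p < lkey k1 k2 i)%O then 1 else 0) +
       phi * (if (lkey k1 k2 p <= lkey k1 k2 i)%O then 1 else 0)).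
    move=> il; rewrite wE // (ltNge (lkey k1 k2 p)) -!lex_leE (k1E i il) (k2E i il).
    rewrite /fill /lex_le.
    set r1 := v i - _; set r2 := u i - _.
    have E1 : (k1 p * a i <= v i) = (0 <= r1) by rewrite subr_ge0.
    have E2 : (v i <= k1 p * a i) = (r1 <= 0) by rewrite subr_le0.
    have E3 : (k2 p * a i <= u i) = (0 <= r2) by rewrite subr_ge0.
    have E4 : (u i <= k2 p * a i) = (r2 <= 0) by rewrite subr_le0.
    case: (ltgtP (a i) 0) => [ai|ai|->]; last by rewrite normr0 !mul0r addr0.
    + rewrite !ler_ndivlMr // !ler_ndivrMr // E1 E2 E3 E4 (ltr0_norm ai).
      case: (ltgtP r1 0) => _ /=; case: (ltgtP r2 0) => _ /=; ring.
    + rewrite !ler_pdivlMr // !ler_pdivrMr // E1 E2 E3 E4 (gtr0_norm ai).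
      case: (ltgtP r1 0) => _ /=; case: (ltgtP r2 0) => _ /=; ring.
  rewrite /dot (eq_big_seq _ term) big_split /= -big_mkcond /=.
  rewrite [X in _ + X](eq_bigr (fun i => (1 - phi) *
      (if (lkey k1 k2 p < lkey k1 k2 i)%O then w i else 0) +
     phi * (if (lkey k1 k2 p <= lkey k1 k2 i)%O then w i else 0))); last first.
    by move=> i _; case: (_ < _)%O; case: (_ <= _)%O; ring.
  rewrite big_split /= -!mulr_sumr -!big_mkcond /= -/(above _ _ _ _).
  rewrite -/(from _ _ _ _) -/W1 -/W2 phiE /T' sumrN; ring.
- move=> i il r1 r2; rewrite /fill -/r1 -/r2 lexP lexN.
  split=> [h|h|h1 h2|h1 h2].
  + by rewrite (lt_gtF h) (gt_eqF h).
  + by rewrite h /= (lt_gtF h) (lt_eqF h).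
  + by rewrite h1 ltxx eqxx /= (leNgt r2) h2.
  + by rewrite h1 ltxx eqxx /= (ltW h2) leNgt h2.
Qed.

End OneConstraint.

(** * Queries for two equality constraints *)
Section TwoConstraints.
Variable R : realFieldType.
Implicit Types (l J : seq nat) (q v u a s x y : nat -> R) (T K B : R).

Definition feasible2 l a T u U y : Prop :=
  [/\ in_box l y, dot l a y = T & dot l u y = U].

Definition optimal2 l v a T u U y : Prop :=
  feasible2 l a T u U y /\
  forall x, feasible2 l a T u U x -> dot l v x <= dot l v y.

(** The relaxation that drops the constraint [u y = U] has a solution on side [g]
    of it that is strictly better than every solution of the full program.  In
    dual terms, the multiplier of this constraint is strictly on one side of the
    value already absorbed in [v]. *)
Definition overshoots l v a T u U (g : R) : Prop :=
  exists y, [/\ in_box l y, dot l a y = T, 0 < g * (dot l u y - U)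
    & forall x, feasible2 l a T u U x -> dot l v x < dot l v y].

(** Strictness is where the second objective is needed: even the maximizer of [v]
    with the largest [u] stays below [U], so no maximizer of [v] attains [U]. *)
Lemma overshoots_neg l v u a T U y :
  lex_opt l v u a T y -> dot l u y < U -> overshoots l v a T u U (-1).
Proof.
move=> [yb yT yo] lt; exists y; split=> //; first by rewrite mulN1r; lra.
move=> x [xb xT xU]; have [le eqle] := yo x xb xT.
rewrite lt_neqAle le andbT; apply/eqP => /eqle; rewrite xU.
by rewrite leNgt lt.
Qed.

Lemma overshoots_pos l v u a T U y :
  lex_opt l v (fun i => (-1) * u i) a T y -> U < dot l u y ->
  overshoots l v a T u U 1.
Proof.
have dotN x : dot l (fun i => (-1) * u i) x = - dot l u x.
  by rewrite /dot -sumrN; apply: eq_bigr => i _; ring.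
move=> [yb yT yo] lt; exists y; split=> //; first by rewrite mul1r subr_gt0.
move=> x [xb xT xU]; have [le eqle] := yo x xb xT.
rewrite lt_neqAle le andbT; apply/eqP => /eqle; rewrite !dotN xU lerN2.
by rewrite leNgt lt.
Qed.

Lemma optimal2_mix l v u a T U y1 y2 :
  lex_opt l v u a T y1 -> lex_opt l v (fun i => (-1) * u i) a T y2 ->
  dot l u y2 <= U <= dot l u y1 ->
  let t := (U - dot l u y2) / (dot l u y1 - dot l u y2) in
  optimal2 l v a T u U (comb t y2 y1).
Proof.
move=> [b1 T1 o1] [b2 T2 o2] /between/=; set t := _ / _ => -[t01 tE].
have E : dot l v y1 = dot l v y2.
  by apply/le_anti/andP; split; [case: (o2 y1 b1 T1) | case: (o1 y2 b2 T2)].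
split; first split.
- exact: box_comb.
- by rewrite dot_comb T1 T2; ring.
- by rewrite dot_comb.
- move=> x [xb xT xU]; rewrite dot_comb E.
  have [le _] := o1 x xb xT; rewrite E in le; lra.
Qed.

Lemma eq_feasible2 l a a' u u' T U y :
  {in l, a =1 a'} -> {in l, u =1 u'} ->
  feasible2 l a T u U y -> feasible2 l a' T u' U y.
Proof.
move=> aE uE [yb yT yU]; split=> //.
- by rewrite -yT; apply: eq_big_seq => i /aE ->.
- by rewrite -yU; apply: eq_big_seq => i /uE ->.
Qed.

Lemma eq_optimal2 l v v' a a' u u' T U y :
  {in l, v =1 v'} -> {in l, a =1 a'} -> {in l, u =1 u'} ->
  optimal2 l v a T u U y -> optimal2 l v' a' T u' U y.
Proof.
move=> vE aE uE [yf yo]; split; first exact: eq_feasible2 yf.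
have dE x : dot l v' x = dot l v x by apply: eq_big_seq => i /vE ->.
move=> x xf; rewrite !dE; apply: yo; apply: eq_feasible2 xf.
- by move=> i /aE.
- by move=> i /uE.
Qed.

Lemma eq_overshoots l v v' a a' u u' T U g :
  {in l, v =1 v'} -> {in l, a =1 a'} -> {in l, u =1 u'} ->
  overshoots l v a T u U g -> overshoots l v' a' T u' U g.
Proof.
move=> vE aE uE [y [yb yT yg yo]].
have dE x : dot l v' x = dot l v x by apply: eq_big_seq => i /vE ->.
exists y; split=> //.
- by rewrite -yT; apply: eq_big_seq => i /aE ->.
- by rewrite [dot _ u' _](eq_big_seq (fun i => u i * y i)) // => i /uE ->.
- move=> x xf; rewrite !dE; apply: yo; apply: eq_feasible2 xf.
  + by move=> i /aE.
  + by move=> i /uE.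
Qed.

Section Prune.
Variables (l : seq nat) (q s : nat -> R) (K B lam mu g1 g2 : R).
Hypothesis (ul : uniq l).
Hypothesis (g1E : g1 = 1 \/ g1 = -1) (g2E : g2 = 1 \/ g2 = -1).

Let bound : R := (1 - g2) / 2%:R.
Let one : nat -> R := fun=> 1.
Definition fixed J y : Prop := forall j, j \in J -> y j = bound.

(** The queries locate the optimal multipliers in an open quadrant with corner
    [(lam, mu)].  The line [q i = L * s i + M] in the plane of the multipliers
    [(L, M)] misses this quadrant exactly under this test, and then the reduced
    profit of item [i] has a known strict sign. *)
Definition prunable (i : nat) : bool :=
  (0 <= g1 * g2 * s i) && (g2 * (q i - lam * s i - mu) <= 0).

Let E J y := feasible2 l one K s B y /\ fixed J y.

(** Both strict query answers, for the program in which the items of [J] are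
    already fixed at [bound]. *)
Definition cornered J : Prop :=
  (exists y, [/\ in_box l y /\ fixed J y, dot l one y = K,
     0 < g1 * (dot l s y - B)
   & forall x, E J x -> dot l q x - lam * B < dot l q y - lam * dot l s y])
  /\
  (exists y, [/\ in_box l y /\ fixed J y, dot l s y = B,
     0 < g2 * (dot l one y - K)
   & forall x, E J x -> dot l q x - mu * K < dot l q y - mu * dot l one y]).

(** A primal argument.  Combining the two query solutions and moving item [i]
    beyond [bound] gives a point [z] that satisfies both constraints and is
    better than every feasible point; hence [z i] violates the box.  Moving any
    point towards [z] until item [i] reaches [bound] therefore stays in the box.
    Applied to feasible points this fixes item [i] without loss, and applied to
    the query solutions themselves it restores the hypothesis for [i :: J]. *)
Lemma cornered_fix J i :
  cornered J -> i \in l -> i \notin J -> prunable i ->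
  cornered (i :: J) /\
  forall y, E J y -> exists2 y', E (i :: J) y' & dot l q y <= dot l q y'.
Proof.
move=> [[yh [[hb hf] hK hB ho]] [yt [[tb tf] tB tK to]]] il iJ.
move=> /andP[pr1 pr2].
have sh0 : dot l s yh - B != 0 by apply/eqP => e; move: hB; rewrite e mulr0 ltxx.
have st0 : dot l one yt - K != 0 by apply/eqP => e; move: tK; rewrite e mulr0 ltxx.
(* The weights for which the excesses of the two query solutions cancel the
   move of item [i]. *)
pose al := g2 * s i / (dot l s yh - B); pose be := g2 / (dot l one yt - K).
have alE : al * (dot l s yh - B) = g2 * s i by rewrite divfK.
have beE : be * (dot l one yt - K) = g2 by rewrite divfK.
have g11 : g1 * g1 = 1 by case: g1E => ->; ring.
have g22 : g2 * g2 = 1 by case: g2E => ->; ring.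
have al0 : 0 <= al.
  rewrite -(pmulr_lge0 _ hB).
  have -> : al * (g1 * (dot l s yh - B)) = g1 * (al * (dot l s yh - B)) by ring.
  by rewrite alE mulrA.
have be0 : 0 < be.
  rewrite -(pmulr_lgt0 _ tK).
  have -> : be * (g2 * (dot l one yt - K)) = g2 * (be * (dot l one yt - K)) by ring.
  by rewrite beE g22.
have ga0 : 0 < al + be by lra.
have gaN : al + be != 0 by rewrite gt_eqF.
pose m j := al / (al + be) * yh j + be / (al + be) * yt j.
pose z j := 1 * m j + (- g2 / (al + be)) * (j == i)%:R.
have dz c : dot l c z = al / (al + be) * dot l c yh
    + be / (al + be) * dot l c yt - g2 / (al + be) * c i.
  by rewrite /z dot_delta // dot_lin; ring.
have mb j : j \in l -> 0 <= m j <= 1.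
  move=> jl; have t01 : 0 <= be / (al + be) <= 1.
    rewrite divr_ge0 ?(ltW be0) ?(ltW ga0) //= ler_pdivrMr // mul1r; lra.
  have -> : m j = (1 - be / (al + be)) * yh j + be / (al + be) * yt j.
    by rewrite /m; field.
  by apply: convex_unit; [|exact: hb|exact: tb].
have zi j : j != i -> z j = m j.
  by move=> /negbTE ji; rewrite /z ji /= mulr0 addr0 mul1r.
have dz' c : dot l c z =
    (al * dot l c yh + be * dot l c yt - g2 * c i) / (al + be).
  by rewrite dz; field.
have divE (x y : R) : x = y * (al + be) -> x / (al + be) = y.
  by move=> ->; rewrite mulfK.
have zK : dot l one z = K.
  by rewrite dz' hK; apply: divE; rewrite /one; lra.
have zB : dot l s z = B.
  by rewrite dz' tB; apply: divE; lra.
have better y : E J y -> dot l q y < dot l q z.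
  move=> Ey; have h := ho y Ey; have t := to y Ey.
  rewrite dz' ltr_pdivlMr //.
  have h' : 0 <= al * ((dot l q yh - lam * dot l s yh) - (dot l q y - lam * B)).
    by rewrite mulr_ge0 // subr_ge0 ltW.
  have t' : 0 < be * ((dot l q yt - mu * dot l one yt) - (dot l q y - mu * K)).
    by rewrite mulr_gt0 // subr_gt0.
  have e1 : lam * (al * (dot l s yh - B)) = lam * (g2 * s i) by rewrite alE.
  have e2 : mu * (be * (dot l one yt - K)) = mu * g2 by rewrite beE.
  lra.
have zJ j : j \in J -> z j = bound.
  move=> jJ; rewrite zi; last by apply: contraNneq iJ => <-.
  by rewrite /m hf // tf //; field.
have zout : (g2 = 1 /\ z i < 0) \/ (g2 = -1 /\ 1 < z i).
  have zE : z i = m i - g2 / (al + be) by rewrite /z eqxx mulr1 mul1r mulNr.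
  have mi := mb i il.
  have ig : 0 < 1 / (al + be) by rewrite divr_gt0.
  have : ~ (0 <= z i <= 1).
    move=> zi01; have Ez : E J z.
      split; last exact: zJ.
      split=> // j jl; have [->|/zi ->] // := eqVneq j i; exact: mb.
    by have := better z Ez; rewrite ltxx.
  rewrite zE; case: g2E => ->; [left | right]; split=> //.
    rewrite ltNge; apply/negP => h; apply: H; lra.
  rewrite ltNge; apply/negP => h; apply: H; lra.
have pull w : in_box l w -> fixed J w -> exists2 t, 0 <= t < 1 &
   in_box l (comb t w z) /\ fixed (i :: J) (comb t w z).
  move=> wb wf; pose t := (w i - bound) / (w i - z i).
  have w01 := wb i il.
  have wz : w i - z i != 0.
    by apply/eqP; case: zout => -[]; lra.
  have [t01 tE] : 0 <= t < 1 /\ (1 - t) * w i + t * z i = bound.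
    split; last by rewrite /t; field.
    rewrite /t /bound; case: zout => -[-> zi0].
      have p : 0 < w i - z i by lra.
      by rewrite ltr_pdivrMr // divr_ge0 /=; lra.
    have p : 0 < z i - w i by lra.
    rewrite -[X in X / _]opprB -[X in _ / X]opprB invrN mulrNN.
    by rewrite ltr_pdivrMr // divr_ge0 /=; lra.
  exists t => //; split=> [j jl|j].
    have [->|ji] := eqVneq j i.
      by rewrite /comb tE /bound; case: g2E => ->; lra.
    by rewrite /comb zi //; apply: convex_unit; [lra | exact: wb | exact: mb].
  rewrite inE => /orP[/eqP-> //|jJ].
  by rewrite /comb wf // zJ //; ring.
have Esub y : E (i :: J) y -> E J y.
  by move=> [fy fx]; split=> // j jJ; apply: fx; rewrite inE jJ orbT.
split; last first.
  move=> y Ey; have [[yb yK yB] yf] := Ey; have [t t01 [cb cf]] := pull y yb yf.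
  exists (comb t y z); first split=> //.
    by split=> //; rewrite dot_comb ?yK ?zK ?yB ?zB; ring.
  by rewrite dot_comb; have := better y Ey; nra.
split.
- have [t t01 cbf] := pull yh hb hf; exists (comb t yh z).
  split=> //.
  + by rewrite dot_comb hK zK; ring.
  + rewrite dot_comb zB.
    have -> : g1 * ((1 - t) * dot l s yh + t * B - B) =
       (1 - t) * (g1 * (dot l s yh - B)) by ring.
    by rewrite mulr_gt0 //; lra.
  + move=> x /Esub Ex; have h1 := ho x Ex; have h2 := better x Ex.
    rewrite !dot_comb zB; nra.
- have [t t01 cbf] := pull yt tb tf; exists (comb t yt z).
  split=> //.
  + by rewrite dot_comb tB zB; ring.
  + rewrite dot_comb zK.
    have -> : g2 * ((1 - t) * dot l one yt + t * K - K) =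
       (1 - t) * (g2 * (dot l one yt - K)) by ring.
    by rewrite mulr_gt0 //; lra.
  + move=> x /Esub Ex; have h1 := to x Ex; have h2 := better x Ex.
    rewrite !dot_comb zK; nra.
Qed.

End Prune.
End TwoConstraints.

(** * Pruning items *)
Section Reduction.
Variable R : realFieldType.
Implicit Types (q s y : nat -> R).

Section Corner.
Variables (l : seq nat) (q s : nat -> R) (K B lam mu g1 g2 : R).
Hypothesis (ul : uniq l).
Hypothesis (g1E : g1 = 1 \/ g1 = -1) (g2E : g2 = 1 \/ g2 = -1).
Hypothesis over1 :
  overshoots l (fun i => q i - lam * s i) (fun=> 1) K s B g1.
Hypothesis over2 :
  overshoots l (fun i => q i - mu) s B (fun=> 1) K g2.

Lemma corner : cornered l q s K B lam mu g1 g2 [::].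
Proof.
have dotB (a : R) (c d : nat -> R) y :
    dot l (fun i => c i - a * d i) y = dot l c y - a * dot l d y.
  by rewrite /dot mulr_sumr -sumrB; apply: eq_bigr => i _; ring.
have dot1 y : dot l (fun i => q i - mu) y = dot l q y - mu * dot l (fun=> 1) y.
  by rewrite -dotB; apply: eq_bigr => i _; rewrite mulr1.
split.
- have [y [yb yK yg yo]] := over1; exists y; split=> // x [[xb xK xB] _].
  have := yo x; rewrite !dotB xB; by apply; split.
- have [y [yb yB yg yo]] := over2; exists y; split=> // x [[xb xK xB] _].
  have := yo x; rewrite !dot1 xK; by apply; split.
Qed.

Let P := prunable q s lam mu g1 g2.
Let v : R := (1 - g2) / 2%:R.

Lemma prune_all J y : uniq J -> {subset J <= l} -> all P J ->
  feasible2 l (fun=> 1) K s B y ->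
  exists2 y', feasible2 l (fun=> 1) K s B y' /\ fixed g2 J y'
    & dot l q y <= dot l q y'.
Proof.
move=> uJ sJ PJ yf.
suff [_ H] : cornered l q s K B lam mu g1 g2 J /\
    exists2 y', feasible2 l (fun=> 1) K s B y' /\ fixed g2 J y'
    & dot l q y <= dot l q y' by [].
elim: J uJ sJ PJ => [|i J IH] /=.
  by move=> _ _ _; split; [exact: corner | exists y].
move=> /andP[iJ uJ] sJ /andP[Pi PJ].
have [|cJ [y' Ey' le]] := IH uJ _ PJ.
  by move=> j jJ; apply: sJ; rewrite inE jJ orbT.
have [|ciJ H] := @cornered_fix R l q s K B lam mu g1 g2 ul g1E g2E J i cJ _ iJ Pi.
  by apply: sJ; rewrite inE eqxx.
split=> //; have [y2 Ey2 le2] := H y' Ey'; exists y2 => //.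
exact: le_trans le le2.
Qed.

Let J := [seq i <- l | P i].
Let l' := [seq i <- l | ~~ P i].
Let K' := K - \sum_(i <- J) v.
Let B' := B - \sum_(i <- J) s i * v.

Lemma dot_split c y : dot l c y = dot J c y + dot l' c y.
Proof.
by rewrite /dot /J /l' !big_filter (bigID P) /=.
Qed.

Lemma feasible2_split y : fixed g2 J y ->
  feasible2 l' (fun=> 1) K' s B' y -> feasible2 l (fun=> 1) K s B y.
Proof.
move=> yf [yb yK yB].
have dJ c : dot J c y = \sum_(i <- J) c i * v.
  by apply: eq_big_seq => i /yf ->.
split.
- move=> i il; case Pi: (P i); last by apply: yb; rewrite mem_filter Pi.
  by rewrite yf ?mem_filter ?Pi //; case: g2E => ->; lra.
- rewrite dot_split yK dJ /K'; under eq_bigr do rewrite mul1r; ring.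
- by rewrite dot_split yB dJ /B'; ring.
Qed.

Lemma feasible2_restrict y : fixed g2 J y ->
  feasible2 l (fun=> 1) K s B y -> feasible2 l' (fun=> 1) K' s B' y.
Proof.
move=> yf [yb yK yB].
have dJ c : dot J c y = \sum_(i <- J) c i * v.
  by apply: eq_big_seq => i /yf ->.
split.
- by move=> i; rewrite mem_filter => /andP[_ /yb].
- move: yK; rewrite dot_split dJ /K' => <-.
  have -> : \sum_(i <- J) 1 * v = \sum_(i <- J) v.
    by apply: eq_bigr => i _; rewrite mul1r.
  by rewrite addrAC subrr add0r.
- by move: yB; rewrite dot_split dJ /B' => <-; rewrite addrAC subrr add0r.
Qed.

Lemma prune_feasible y : feasible2 l (fun=> 1) K s B y ->
  exists y', feasible2 l' (fun=> 1) K' s B' y'.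
Proof.
move=> yf; have [|||y' [yf' fx] _] := prune_all (J := J) _ _ _ yf.
- exact: filter_uniq.
- by move=> i; rewrite mem_filter => /andP[].
- exact: filter_all.
by exists y'; apply: feasible2_restrict.
Qed.

Lemma prune_optimal y : fixed g2 J y ->
  optimal2 l' q (fun=> 1) K' s B' y -> optimal2 l q (fun=> 1) K s B y.
Proof.
move=> fy [yf yo]; split; first exact: feasible2_split.
move=> x xf; have [|||x' [xf' fx] le] := prune_all (J := J) _ _ _ xf.
- exact: filter_uniq.
- by move=> i; rewrite mem_filter => /andP[].
- exact: filter_all.
apply: le_trans le _; rewrite !dot_split.
have -> : dot J q x' = dot J q y by apply: eq_big_seq => i iJ; rewrite fx // fy.
by rewrite lerD2l; apply/yo/feasible2_restrict.
Qed.

End Corner.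

(** The pairs made of the j-th item from the left and the j-th from the right are
    disjoint. *)
Lemma count_pairs (P bad : pred nat) arr h :
  (h.*2 <= size arr)%N ->
  (forall j, (j < h)%N -> bad (nth 0%N arr j) ->
     P (nth 0%N arr j) || P (nth 0%N arr (size arr - 1 - j))) ->
  (count bad (take h arr) <= count P arr)%N.
Proof.
move=> le H.
suff : (count bad (take h arr) <=
        count P (take h arr) + count P (drop (size arr - h) arr))%N.
  move/leq_trans; apply.
  rewrite -[X in (_ <= count P X)%N](cat_take_drop (size arr - h)) count_cat.
  rewrite leq_add2r -[X in (_ <= count P X)%N](cat_take_drop h) count_cat.
  by rewrite take_takel ?leq_addr //; lia.
elim: h le H => [|h IH] le H; first by rewrite take0.
have {}IH := IH _ _; have lt1 : (h < size arr)%N by lia.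
rewrite !(take_nth 0%N) // -!cats1 !count_cat /=.
rewrite (@drop_nth _ 0%N (size arr - h.+1)) /=; last by lia.
have -> : ((size arr - h.+1).+1 = size arr - h)%N by lia.
have -> : (size arr - h.+1 = size arr - 1 - h)%N by lia.
have := H h (ltnSn h).
have : (count bad (take h arr) <=
     count P (take h arr) + count P (drop (size arr - h) arr))%N.
  by apply: IH; [lia | move=> j jh; apply: H; lia].
case: (bad _) => /= h1 h2; last by lia.
by move: (h2 isT) => /orP[] ->; lia.
Qed.

(** The lines of two items with slopes of opposite signs cross at [(pl, pm)].  If
    this point is outside the open quadrant in both coordinates, then one of the
    two lines misses the quadrant: the one whose slope leads it past the corner. *)
Lemma crossing_prunable q s (lam mu g1 g2 : R) i j :
  (g1 = 1 \/ g1 = -1) -> (g2 = 1 \/ g2 = -1) ->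
  s i <= 0 <= s j ->
  let pl := (q j - q i) / (s j - s i) in
  let pm := q i - s i * pl in
  g1 * pl <= g1 * lam -> g2 * pm <= g2 * mu ->
  prunable q s lam mu g1 g2 i || prunable q s lam mu g1 g2 j.
Proof.
move=> g1E g2E /andP[si sj] pl pm hl hm; rewrite /prunable.
have E : s i = s j -> s i = 0 /\ s j = 0 by move=> e; split; lra.
have qi : q i = pm + s i * pl by rewrite /pm; ring.
have [e|ne] := eqVneq (s i) (s j).
  have [si0 sj0] := E e.
  rewrite si0 !mulr0 lexx /= subr0.
  by apply/orP; left; move: hm; rewrite /pm si0; lra.
have qj : q j = pm + s j * pl.
  by rewrite /pm /pl; field; rewrite subr_eq0 eq_sym.
clearbody pl pm.
case: g1E hl => ->; case: g2E hm => -> hm hl; apply/orP.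
- by right; apply/andP; split; [lra | rewrite qj; nra].
- by left; apply/andP; split; [lra | rewrite qi; nra].
- by left; apply/andP; split; [lra | rewrite qi; nra].
- by right; apply/andP; split; [lra | rewrite qj; nra].
Qed.

Lemma threshold_side l (k : nat -> R) (g : R) p :
  (g = 1 \/ g = -1) ->
  threshold (R := R) (lkey k (fun=> 0)) l (fun=> 1) ((size l)%:R / 2%:R) p ->
  (size l <= (count (fun i => (g * k i <= g * k p)%R) l).*2)%N.
Proof.
move=> gE /threshold_count [h1 h2].
have E i j : (lkey k (fun=> 0) i <= lkey k (fun=> 0) j)%O = (k i <= k j).
  by rewrite -lex_leE /lex_le lexx /= andbF andbT.
case: gE => ->.
- rewrite -(eq_count (a1 := fun i => (lkey k (fun=> 0) i <= lkey k (fun=> 0) p)%O)) // => i.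
  by rewrite E !mul1r.
- rewrite -(eq_count (a1 := fun i => (lkey k (fun=> 0) p <= lkey k (fun=> 0) i)%O)) // => i.
  by rewrite E !mulN1r lerN2.
Qed.

End Reduction.

(** * The relaxation of the colored knapsack problem *)
Section ColoredKnapsack.
Variables (R : realFieldType) (l : seq nat) (p w : nat -> R) (col : nat -> nat).
Variable (b : R).
Hypothesis (w_ge0 : forall i, i \in l -> 0 <= w i) (b_gt0 : 0 < b).

Definition knapsack x : Prop := in_box l x /\ dot l w x <= b.

(** The left-hand side of the color constraint. *)
Definition excess (c : nat) (x : nat -> R) : R :=
  \sum_(i <- l | col i == c) x i - \sum_(i <- l | col i != c) x i.

Definition colored x : Prop := knapsack x /\ forall c, excess c x <= 1.

Lemma eq_colored x x' : {in l, x =1 x'} -> colored x -> colored x'.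
Proof.
move=> E [[xb xw] xc]; split; first split.
- by move=> i il; rewrite -E // xb.
- by rewrite -(eq_dot _ E).
- have S (P : pred nat) : \sum_(i <- l | P i) x i = \sum_(i <- l | P i) x' i.
    rewrite big_seq_cond [RHS]big_seq_cond.
    by apply: eq_bigr => i /andP[il _]; exact: E.
  by move=> c; rewrite /excess -!S; exact: xc.
Qed.

(** An additional item [k] of profit 0 and weight [b] turns the capacity
    constraint into an equality. *)
Lemma slack_optimal k v u a y :
  k \notin l ->
  (forall i, i \in l -> v i = p i) -> v k = 0 ->
  (forall i, i \in l -> a i = w i) -> a k = b ->
  lex_opt (rcons l k) v u a b y ->
  knapsack y /\ forall x, knapsack x -> dot l p x <= dot l p y.
Proof.
move=> kl vE vk aE ak [yb yT yo].
have dotr c x : dot (rcons l k) c x = dot l c x + c k * x k.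
  by rewrite /dot -cats1 big_cat big_seq1.
have vp x : dot l v x = dot l p x by apply: eq_big_seq => i /vE ->.
have aw x : dot l a x = dot l w x by apply: eq_big_seq => i /aE ->.
have yk : 0 <= y k <= 1 by apply: yb; rewrite mem_rcons inE eqxx.
split.
  split; first by move=> i il; apply: yb; rewrite mem_rcons inE il orbT.
  have /andP[yk0 _] := yk; have := mulr_ge0 (ltW b_gt0) yk0.
  by move: yT; rewrite dotr aw ak; lra.
move=> x [xb xw]; pose x' i := if i == k then (b - dot l w x) / b else x i.
have xE c : dot l c x' = dot l c x.
  by apply: eq_dot => i il; rewrite /x' ifN //; apply: contraNneq kl => <-.
have [||le _] := yo x'.
- move=> i; rewrite mem_rcons inE /x'; case: eqVneq => /= [_ _|_]; last exact: xb.
  have w0 : 0 <= dot l w x.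
    rewrite /dot big_seq sumr_ge0 // => i' il; rewrite mulr_ge0 ?w_ge0 //.
    by have /andP[] := xb _ il.
  apply/andP; split; first by apply: divr_ge0; [rewrite subr_ge0 | exact: ltW].
  by rewrite ler_pdivrMr // mul1r; lra.
- by rewrite dotr xE aw ak /x' eqxx; field; rewrite gt_eqF.
by move: le; rewrite !dotr xE !vp vk !mul0r !addr0.
Qed.

Lemma excess_split c (x : nat -> R) :
  \sum_(i <- l) x i =
  \sum_(i <- l | col i == c) x i + \sum_(i <- l | col i != c) x i.
Proof. exact: bigID. Qed.

Lemma excessE c x : excess c x =
  (\sum_(i <- l | col i == c) x i) *+ 2 - \sum_(i <- l) x i.
Proof. by rewrite /excess (excess_split c) mulr2n; ring. Qed.

(** At most one color constraint can be violated: the items of another color all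
    count against color [c]. *)
Lemma excess_other c c' x :
  in_box l x -> c' != c -> 0 <= excess c x -> excess c' x <= 0.
Proof.
move=> xb cc; rewrite !excessE (excess_split c).
have : \sum_(i <- l | col i == c') x i <= \sum_(i <- l | col i != c) x i.
  rewrite big_seq_cond [X in _ <= X]big_seq_cond.
  rewrite [X in _ <= X](bigID (fun i => col i == c')) /=.
  rewrite [X in _ <= X + _](eq_bigl (fun i => (i \in l) && (col i == c'))).
    rewrite lerDl sumr_ge0 // => i /andP[/andP[il _] _].
    by have /andP[] := xb i il.
  move=> i; rewrite -andbA; congr (_ && _).
  by case: (eqVneq (col i) c') => [->|]; rewrite ?andbF // cc.
lra.
Qed.

Section Violated.
Variable c : nat.

Definition side (i : nat) : R := if col i == c then 1 else -1.
(** Complementing the items of the other colors turns the tight constraint of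
    color [c] into a cardinality constraint. *)
Definition flip (x : nat -> R) (i : nat) : R :=
  if col i == c then x i else 1 - x i.

Lemma flipK x : flip (flip x) =1 x.
Proof. by move=> i; rewrite /flip; case: (col i == c) => //; ring. Qed.

Lemma box_flip x : in_box l x -> in_box l (flip x).
Proof. by move=> xb i /xb; rewrite /flip; case: ifP => // _; lra. Qed.

Lemma dot_flip f x : dot l (fun i => side i * f i) (flip x) =
  dot l f x - \sum_(i <- l | col i != c) f i.
Proof.
rewrite /dot [X in _ = _ - X]big_mkcond -sumrB; apply: eq_bigr => i _ /=.
by rewrite /side /flip; case: eqP => _ /=; ring.
Qed.

Lemma excess_side x : excess c x = dot l side x.
Proof.
rewrite /excess /dot [in RHS](bigID (fun i => col i == c)) /= -sumrN.
by congr (_ + _); apply: eq_bigr => i; rewrite /side;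
  [move=> -> | move/negbTE->]; ring.
Qed.

Let q i := side i * p i.
Let s i := side i * w i.
Let K : R := 1 + \sum_(i <- l | col i != c) 1.
Let B : R := b - \sum_(i <- l | col i != c) w i.
Let one : nat -> R := fun=> 1.

Lemma dot_one_flip x : dot l one (flip x) = excess c x + (K - 1).
Proof.
have -> : dot l one (flip x) = dot l (fun i => side i * side i) (flip x).
  by apply: eq_bigr => i _; rewrite /one /side; case: ifP => _; ring.
rewrite dot_flip -excess_side /K; congr (_ + _).
rewrite addrC addKr -sumrN; apply: eq_bigr => i /negbTE ci.
by rewrite /side ci opprK.
Qed.

Lemma dot_s_flip x : dot l s (flip x) = dot l w x + (B - b).
Proof. by rewrite dot_flip /B; ring. Qed.

(** The program with color constraint [c] tight and all others dropped, in the
    complemented variables. *)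
Definition tight_optimal y : Prop :=
  [/\ in_box l y, dot l one y = K, dot l s y <= B
    & forall y', in_box l y' -> dot l one y' = K -> dot l s y' <= B ->
        dot l q y' <= dot l q y].

Variable x0 : nat -> R.
Hypothesis x0k : knapsack x0.
Hypothesis x0o : forall x, knapsack x -> dot l p x <= dot l p x0.
Hypothesis x0c : 1 < excess c x0.

Lemma tighten x : knapsack x -> excess c x <= 1 ->
  exists2 x', knapsack x' /\ excess c x' = 1 & dot l p x <= dot l p x'.
Proof.
move=> xk xc; have [xb xw] := xk; have [b0 w0] := x0k.
have [||t [t01 tb tE le]] := @reach R l side p 1 x x0 xb b0 _ _ (x0o xk).
- by rewrite -excess_side.
- by rewrite -excess_side ltW.
exists (comb t x x0) => //; split; last by rewrite excess_side.
by split=> //; rewrite dot_comb; nra.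
Qed.

(** Dropping the other color constraints is harmless by [excess_other], and
    requiring constraint [c] to be tight is harmless by [tighten]. *)
Lemma tight_colored y : tight_optimal y ->
  colored (flip y) /\ forall x, colored x -> dot l p x <= dot l p (flip y).
Proof.
move=> [yb yK yB yo].
have yE : dot l one y = dot l one (flip (flip y)).
  by apply: eq_dot => i _; rewrite flipK.
have ex : excess c (flip y) = 1.
  by move: (dot_one_flip (flip y)); rewrite -yE yK; lra.
have qE x : dot l p x = dot l q (flip x) + \sum_(i <- l | col i != c) p i.
  by rewrite dot_flip; ring.
have flipE f : dot l f (flip (flip y)) = dot l f y.
  by apply: eq_dot => i _; rewrite flipK.
split.
  split.
    split; first exact: box_flip.
    by move: (dot_s_flip (flip y)); rewrite flipE; move: yB; lra.
  move=> c'; have [->|cc] := eqVneq c' c; first by rewrite ex.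
  have h : excess c' (flip y) <= 0.
    by apply: excess_other cc _; [exact: box_flip | rewrite ex].
  exact: le_trans h ler01.
move=> x [xk xc]; have [x' [[x'b x'w] x'c] le] := tighten xk (xc c).
apply: le_trans le _; rewrite !qE lerD2r flipE; apply: yo.
- exact: box_flip.
- by rewrite dot_one_flip x'c; ring.
- by rewrite dot_s_flip; lra.
Qed.

Lemma tight_exists :
  exists y, [/\ in_box l y, dot l one y = K & dot l s y <= B].
Proof.
have dot0 f : dot l f (fun=> 0) = 0.
  by rewrite /dot big1 // => i _; rewrite mulr0.
have [||x' [[x'b x'w] x'c] _] := @tighten (fun=> 0).
- by split; [move=> i _; rewrite lexx ler01 | rewrite dot0 ltW].
- by rewrite excess_side dot0.
exists (flip x'); split; first exact: box_flip.
  by rewrite dot_one_flip x'c; ring.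
by rewrite dot_s_flip; lra.
Qed.

Variable y1 : nat -> R.
Hypothesis y1o : lex_opt l q (fun i => (-1) * s i) one K y1.

Lemma cheap_optimal : dot l s y1 <= B -> tight_optimal y1.
Proof.
move: y1o => [yb yK yo] le; split=> // y' yb' yK' _.
by have [] := yo y' yb' yK'.
Qed.

(** When the cheapest optimum without the capacity constraint violates it, the
    constraint can also be required to be tight. *)
Lemma feasible2_reach y : B < dot l s y1 ->
  in_box l y -> dot l one y = K -> dot l s y <= B ->
  exists2 y', feasible2 l one K s B y' & dot l q y <= dot l q y'.
Proof.
move: y1o => [y1b y1K y1m] lt yb yK yB.
have [le _] := y1m y yb yK.
have [t [_ tb tB leq]] := reach yb y1b yB (ltW lt) le.
exists (comb t y y1) => //; split=> //.
by rewrite dot_comb yK y1K; ring.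
Qed.

Lemma feasible2_exists : B < dot l s y1 ->
  exists y, feasible2 l one K s B y.
Proof.
move=> lt; have [y [yb yK yB]] := tight_exists.
by have [y' yf _] := feasible2_reach lt yb yK yB; exists y'.
Qed.

Lemma equality_optimal y : B < dot l s y1 ->
  optimal2 l q one K s B y -> tight_optimal y.
Proof.
move=> lt [[yb yK yB] yo]; split=> //; first by rewrite yB.
move=> y' yb' yK' yB'; have [y2 yf le] := feasible2_reach lt yb' yK' yB'.
exact: le_trans le (yo _ yf).
Qed.

End Violated.
End ColoredKnapsack.

(** * Weighted selection in linear time *)

(** Number tables, all indexed by item except the last: output; the two components
    of the selection keys and the selection weights; objective, constraint and
    second objective of a one-constraint program; a saved solution; profits and
    slopes of the two-constraint program; the two coordinates of the crossing
    point of a pair; and the sums of the colors. *)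
Notation tY := 2%N (only parsing).
Notation tK1 := 3%N (only parsing).
Notation tK2 := 4%N (only parsing).
Notation tWt := 5%N (only parsing).
Notation tV := 6%N (only parsing).
Notation tA := 7%N (only parsing).
Notation tU := 8%N (only parsing).
Notation tY1 := 9%N (only parsing).
Notation tQ := 10%N (only parsing).
Notation tS := 11%N (only parsing).
Notation tPL := 12%N (only parsing).
Notation tPM := 13%N (only parsing).
Notation tX := 14%N (only parsing).

Notation pMED3 := 0%N (only parsing).
Notation pWSEL := 1%N (only parsing).

Notation "c1 ;; c2" := (Seq c1 c2) (at level 61, right associativity).
Notation cur := (IReg 4).

Definition NLt e1 e2 := BNot (NLe e2 e1).

Definition BLex k1 k2 k1' k2' :=
  BAnd (NLe k1 k1') (BNot (BAnd (NLe k1' k1) (BNot (NLe k2 k2')))).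

Definition BKey i j :=
  BLex (NRead tK1 i) (NRead tK2 i) (NRead tK1 j) (NRead tK2 j).

(** Number registers 3 and 4 receive the weights above and from the item in index
    register 5. *)
Definition sums wt :=
  foreach 0 1
    (If (BKey (IReg 5) cur)
      (NSet 4 (NAdd (NReg 4) wt) ;;
       If (BKey cur (IReg 5)) Skip (NSet 3 (NAdd (NReg 3) wt)))
      Skip).

(** Appends the items that satisfy [cond] to the block at register [rd], whose
    length is register [rc]. *)
Definition filt rs rl rd rc cond :=
  foreach rs rl
    (If cond
      (IWrite 1 (IAdd (IReg rd) (IReg rc)) cur ;;
       ISet rc (IAdd (IReg rc) (IConst 1)))
      Skip).

Definition med3_read : cmd :=
  ISet 5 (IRead 1 (IAdd (IReg 0) (IReg 3))) ;;
  ISet 6 (IRead 1 (IAdd (IReg 0) (IAdd (IReg 3) (IConst 1)))) ;;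
  ISet 7 (IRead 1 (IAdd (IReg 0) (IAdd (IReg 3) (IConst 2)))).

Definition med3_pick : cmd :=
  If (BKey (IReg 5) (IReg 6))
    (If (BKey (IReg 6) (IReg 7)) (ISet 5 (IReg 6))
      (If (BKey (IReg 5) (IReg 7)) (ISet 5 (IReg 7)) Skip))
    (If (BKey (IReg 5) (IReg 7)) Skip
      (If (BKey (IReg 6) (IReg 7)) (ISet 5 (IReg 7)) (ISet 5 (IReg 6)))).

Definition med3_push : cmd :=
  IWrite 1 (IAdd (IReg 2) (IReg 4)) (IReg 5) ;;
  ISet 4 (IAdd (IReg 4) (IConst 1)) ;;
  NSet 0 (NAdd (NReg 0) (NConst 1)) ;;
  ISet 3 (IAdd (IReg 3) (IConst 3)).

Definition med3 : cmd :=
  ISet 3 (IConst 0) ;; ISet 4 (IConst 0) ;; NSet 0 (NConst 0) ;;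
  While (ILe (IAdd (IReg 3) (IConst 3)) (IReg 1))
    (med3_read ;; med3_pick ;; med3_push) ;;
  ISet 0 (IReg 4) ;; NSet 0 (NDiv (NReg 0) (NConst 2)).

(** The caller passes (0, 1) for weighted selection and (1, 0) for unit weights, so
    that one procedure selects medians as well. *)
Definition wt_exp := NAdd (NReg 1) (NMul (NReg 2) (NRead tWt cur)).

Definition wsel_rec cond T :=
  ISet 8 (IConst 0) ;; filt 0 1 2 8 cond ;;
  Call pWSEL [:: IReg 2; IReg 8; IAdd (IReg 2) (IReg 8)]
    [:: T; NReg 1; NReg 2] 0 0.

(** The median of the medians of medians is found by a recursive call.  Short lists
    take their first item as pivot; since every round discards the pivot, this
    also terminates. *)
Definition wsel_pivot : cmd :=
  If (ILe (IReg 1) (IConst 8)) (ISet 5 (IRead 1 (IReg 0)))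
    (Call pMED3 [:: IReg 0; IReg 1; IReg 2] [::] 6 3 ;;
     Call pMED3 [:: IReg 2; IReg 6; IAdd (IReg 2) (IReg 6)] [::] 7 3 ;;
     Call pWSEL
       [:: IAdd (IReg 2) (IReg 6); IReg 7;
           IAdd (IAdd (IReg 2) (IReg 6)) (IReg 7)]
       [:: NReg 3; NConst 1; NConst 0] 5 3).

Definition wsel : cmd :=
  wsel_pivot ;;
  NSet 3 (NConst 0) ;; NSet 4 (NConst 0) ;; sums wt_exp ;;
  If (NLt (NReg 0) (NReg 3))
    (wsel_rec (BNot (BKey cur (IReg 5))) (NReg 0))
    (If (NLt (NReg 4) (NReg 0))
      (wsel_rec (BNot (BKey (IReg 5) cur)) (NSub (NReg 0) (NReg 4)))
      (ISet 0 (IReg 5))).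

Section Selection.
Variable R : realFieldType.
Implicit Types (fr : frame R) (s : store R) (l : seq nat) (w : nat -> R).

(** The calling convention: index table 1 is preserved below [free], where the
    live lists are, and serves as scratch space above. *)
Record keeps (tn : seq nat) (free : nat) s s' : Prop := Keeps {
  keeps_ntab : forall a, a \notin tn -> ntab s' a = ntab s a;
  keeps_itab : forall a, a != 1%N -> itab s' a = itab s a;
  keeps_list : forall j, (j < free)%N -> itab s' 1%N j = itab s 1%N j }.

Lemma keeps_trans tn free s1 s2 s3 :
  keeps tn free s1 s2 -> keeps tn free s2 s3 -> keeps tn free s1 s3.
Proof.
move=> [a1 b1 c1] [a2 b2 c2]; split=> x xP.
- by rewrite a2 // a1.
- by rewrite b2 // b1.
- by rewrite c2 // c1.
Qed.

Lemma keeps_sub tn tn' free free' s s' :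
  keeps tn free s s' -> {subset tn <= tn'} -> (free' <= free)%N ->
  keeps tn' free' s s'.
Proof.
move=> [a b c] sub le; split=> // x xP.
- by apply: a; apply: contra xP => /sub.
- by apply: c; exact: leq_trans xP le.
Qed.

Lemma keeps_same xi xn tn free fr s fr' s' :
  same_off xi xn [::] tn fr s fr' s' -> keeps tn free s s'.
Proof.
by move=> so; split=> x xP; [apply: (same_ntab so) | rewrite (same_itab so) ..].
Qed.

Lemma keeps_block tn free s s' src len :
  keeps tn free s s' -> (src + len <= free)%N ->
  block s' src len = block s src len.
Proof.
by move=> k le; apply: eq_block => j /andP[_ lt]; apply: (keeps_list k); lia.
Qed.

Let key s := lkey (ntab s tK1) (ntab s tK2).

Lemma keyE s i j :
  (ntab s tK1 i <= ntab s tK1 j) &&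
    ~~ ((ntab s tK1 j <= ntab s tK1 i) && ~~ (ntab s tK2 i <= ntab s tK2 j))
  = (key s i <= key s j)%O.
Proof. by rewrite /key -lex_leE. Qed.

Lemma sum_rcons (P : pred nat) w l i :
  \sum_(j <- rcons l i | P j) w j =
  \sum_(j <- l | P j) w j + (if P i then w i else 0).
Proof.
by rewrite -cats1 big_cat /= big_cons big_nil; case: ifP => _; rewrite addr0.
Qed.

Lemma runs_sums ps wt w fr s N (Q : frame R -> store R -> Prop) :
  let l := block s (ireg fr 0%N) (ireg fr 1%N) in
  (ncost wt <= 10)%N -> (100 * (ireg fr 1%N).+2 <= N)%N ->
  nreg fr 3%N = 0 -> nreg fr 4%N = 0 ->
  (forall fr1, (forall x, x \notin [:: 3; 4]%N -> ireg fr1 x = ireg fr x) ->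
     (forall x, x \notin [:: 4; 3]%N -> nreg fr1 x = nreg fr x) ->
     neval fr1 s wt = w (ireg fr1 4%N)) ->
  (forall fr1,
     (forall x, x \notin [:: 3; 4]%N -> ireg fr1 x = ireg fr x) ->
     (forall x, x \notin [:: 4; 3]%N -> nreg fr1 x = nreg fr x) ->
     nreg fr1 3%N = above (key s) (ireg fr 5%N) l w ->
     nreg fr1 4%N = from (key s) (ireg fr 5%N) l w -> Q fr1 s) ->
  runs ps (sums wt) fr s N Q.
Proof.
move=> l cw leN n3 n4 wE HQ.
pose Inv pre fr1 s1 := [/\ s1 = s,
  nreg fr1 3%N = above (key s) (ireg fr 5%N) pre w &
  nreg fr1 4%N = from (key s) (ireg fr 5%N) pre w].
apply: (@runs_foreach R ps 0 1 _ l fr s Inv 100) => //=.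
- by rewrite /BKey /=; lia.
- by rewrite /l size_block.
- by rewrite /Inv /above /from !big_nil.
- move=> pre i post fr1 s1 _ so iE [s1E i3 i4]; subst s1.
  have w1 : neval fr1 s wt = w i.
    by rewrite -iE; apply: wE; [apply: (same_ireg so)|apply: (same_nreg so)].
  have w2 v : neval (set_nreg fr1 4%N v) s wt = w i.
    rewrite wE /= ?iE // => x xN; first exact: (same_ireg so).
    by rewrite -(same_nreg so) // /upd; case: eqP xN => // ->.
  have r5 : ireg fr1 5%N = ireg fr 5%N by apply: (same_ireg so).
  rewrite /Inv /above /from !sum_rcons -/(above _ _ _ _) -/(from _ _ _ _).
  rewrite -i3 -i4 !keyE w1 w2 iE r5.
  rewrite ltNge; case: (leP (key s (ireg fr 5%N))) => /= [le1|/ltW ->].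
    by case: ifP => //= _; rewrite ?addr0.
  by rewrite !addr0.
- by left.
- move=> fr1 s1 so [-> i3 i4]; apply: HQ => //.
  by apply: (same_ireg so).
  by apply: (same_nreg so).
Qed.

Lemma runs_filt ps rs rl rd rc cond (P : pred nat) l0 fr s N
    (Q : frame R -> store R -> Prop) :
  let l := block s (ireg fr rs) (ireg fr rl) in
  let d := ireg fr rd in
  [/\ rs \notin [:: 3; 4; rc]%N, rl \notin [:: 3; 4; rc]%N,
      rd \notin [:: 3; 4; rc]%N & rc \notin [:: 3; 4]%N] ->
  (bcost cond <= 40)%N -> (100 * (ireg fr rl).+2 <= N)%N ->
  (ireg fr rs + ireg fr rl <= d)%N ->
  block s d (ireg fr rc) = l0 ->
  (forall fr1 s1, same_off [:: 3; 4; rc]%N [::] [:: 1]%N [::] fr s fr1 s1 ->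
     beval fr1 s1 cond = P (ireg fr1 4%N)) ->
  (forall fr1 s1, same_off [:: 3; 4; rc]%N [::] [:: 1]%N [::] fr s fr1 s1 ->
     (forall j, (j < d)%N -> itab s1 1%N j = itab s 1%N j) ->
     block s1 d (ireg fr1 rc) = l0 ++ [seq i <- l | P i] -> Q fr1 s1) ->
  runs ps (filt rs rl rd rc cond) fr s N Q.
Proof.
move=> l d [rsN rlN rdN rcN] cc leN lesd l0E condE HQ.
pose Inv pre fr1 s1 :=
  (forall j, (j < d)%N -> itab s1 1%N j = itab s 1%N j) /\
  block s1 d (ireg fr1 rc) = l0 ++ [seq i <- pre | P i].
have neq34 x : x \in [:: 3; 4]%N -> (rc == x) = false.
  by move=> x34; apply: contraNF rcN => /eqP->.
apply: (@runs_foreach R ps rs rl _ l fr s Inv 100) => //=.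
- by lia.
- by rewrite /l size_block.
- by split=> //; rewrite inE eq_sym neq34.
- by rewrite /Inv cats0.
- move=> x pre fr1 s1 v x34 [I1 I2]; split=> //=.
  by rewrite /upd neq34.
- move=> pre i post fr1 s1 _ so iE [I1 I2].
  rewrite (condE _ _ so) iE /Inv filter_rcons; case: ifP => Pi //=.
  rewrite (same_ireg so rdN) -/d; split.
    by move=> j lt; rewrite /upd /= -(I1 _ lt) ifN //; lia.
  by rewrite {1}/upd eqxx addn1 block_push I2 rcons_cat.
- right=> pre post fr1 s1 _ [I1 _]; rewrite /l; apply: eq_block => j /andP[_ lt].
  by apply: I1; lia.
- by move=> fr1 s1 so [I1 I2]; apply: HQ.
Qed.

Lemma run_pick fr s :
  let st := run med3_pick (fr, s) in
  [/\ st.2 = s, nreg st.1 = nreg fr,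
    forall x, x != 5%N -> ireg st.1 x = ireg fr x
  & ireg st.1 5%N =
      median3 (key s) (ireg fr 5%N) (ireg fr 6%N) (ireg fr 7%N)].
Proof.
rewrite /= !keyE /median3 /upd.
by do 3?case: ifP => _; split=> //= x; rewrite /upd => /negbTE ->.
Qed.

Lemma runs_med3 ps fr s N (Q : frame R -> store R -> Prop) :
  let len := ireg fr 1%N in let dst := ireg fr 2%N in
  let l := block s (ireg fr 0%N) len in
  (ireg fr 0%N + len <= dst)%N -> (250 * (len %/ 3).+2 <= N)%N ->
  (forall fr' s', keeps [::] dst s s' -> ireg fr' 0%N = (len %/ 3)%N ->
     nreg fr' 0%N = (len %/ 3)%:R / 2%:R ->
     block s' dst (len %/ 3) = medians (key s) l -> Q fr' s') ->
  runs ps med3 fr s N Q.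
Proof.
move=> len dst l le leN HQ.
have szm : size (medians (key s) l) = (len %/ 3)%N.
  by rewrite size_medians size_block.
pose Inv j fr1 s1 := [/\ ireg fr1 3%N = (3 * j)%N, ireg fr1 4%N = j,
  nreg fr1 0%N = j%:R,
  (forall i, (i < dst)%N -> itab s1 1%N i = itab s 1%N i)
  & block s1 dst j = take j (medians (key s) l)].
do 3!(apply: (@runs_seq_straight _ _ _ _ _ _ 5) => //=; first by lia).
apply: runs_seq.
- apply: (@runs_while _ _ _ _ _ _ (len %/ 3) 250 Inv) => //.
  + by split=> //=; rewrite take0.
  + move=> j fr1 s1 ltj so [r3 r4 n0 I bl].
    have r0 : ireg fr1 0%N = ireg fr 0%N by apply: (same_ireg so).
    have r1 : ireg fr1 1%N = len by apply: (same_ireg so).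
    have r2 : ireg fr1 2%N = dst by apply: (same_ireg so).
    have keys : key s1 = key s by rewrite /key !(same_ntab so).
    split; first by rewrite /= r1 r3; lia.
    have rd k : (k < 3)%N ->
        itab s1 1%N (ireg fr 0%N + (3 * j + k)) = nth 0%N l (3 * j + k).
      by move=> k3; rewrite nth_block ?I //; rewrite -/len; lia.
    have := rd 0%N; have := rd 1%N; have := rd 2%N.
    rewrite addn0 => /(_ isT) rd2 /(_ isT) rd1 /(_ isT) rd0.
    have := nth_medians (key s) (l := l) (j := j).
    rewrite size_block => /(_ ltj) nm.
    have RS c1 c2 (st : frame R * store R) : run (c1 ;; c2) st = run c2 (run c1 st) by [].
    rewrite (RS med3_read) (RS med3_pick).
    have -> : run med3_read (fr1, s1) = ((run med3_read (fr1, s1)).1, s1) by [].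
    have [] := run_pick (run med3_read (fr1, s1)).1 s1.
    case: (run med3_pick _) => fr3 s3 /= -> n3 i3; rewrite /upd /=.
    rewrite r3 r0 rd0 rd1 rd2 keys -nm => pk.
    have := i3 3%N isT; have := i3 4%N isT; have := i3 2%N isT.
    rewrite /upd /= r2 r3 r4 => e2 e4 e3.
    rewrite e2 e3 e4 n3 n0 pk; split=> //=.
    * by rewrite /upd /= mulnS addnC.
    * by rewrite /upd /= addn1.
    * by rewrite /upd /= natr1.
    * by move=> i lti; rewrite /upd /= -(I i lti) ltn_eqF //; lia.
    * rewrite block_push bl (take_nth 0%N) //; last by rewrite szm.
  + move=> fr1 s1 so [r3 _ _ _ _].
    have r1 : ireg fr1 1%N = len by apply: (same_ireg so).
    by rewrite /= r1 r3; lia.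
- by lia.
- move=> fr1 s1 [so [r3 r4 n0 I bl]].
  apply: runs_straight => //=; first by lia.
  apply: HQ => //=; last by rewrite bl -szm take_size.
  + split=> //= a a1; first by rewrite (same_ntab so).
    by rewrite (same_itab so) // inE.
  + by rewrite /upd /= n0.
Qed.

(** For [n > 8] the recursive calls have sizes [n %/ 9] and at most
    [n - 2 * (n %/ 9)], which leaves a multiple of [n %/ 9] for the loops. *)
Definition wsel_cost n := (500 * (40 * n + 4))%N.

Section Wsel.
Variable ps : seq cmd.
Hypothesis ps_med3 : nth Skip ps pMED3 = med3.
Hypothesis ps_wsel : nth Skip ps pWSEL = wsel.

(** On the empty list the result is an arbitrary index, which is still a
    threshold. *)
Definition wsel_correct n : Prop := forall fr s N Q,
  let l := block s (ireg fr 0%N) n in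
  let w := fun i => nreg fr 1%N + nreg fr 2%N * ntab s tWt i in
  ireg fr 1%N = n -> (ireg fr 0%N + n <= ireg fr 2%N)%N ->
  (forall i, i \in l -> 0 <= w i) -> 0 <= nreg fr 0%N <= \sum_(i <- l) w i ->
  (wsel_cost n <= N)%N ->
  (forall fr' s', keeps [::] (ireg fr 2%N) s s' ->
     threshold (key s) l w (nreg fr 0%N) (ireg fr' 0%N) ->
     (l != [::] -> ireg fr' 0%N \in l) -> Q fr' s') ->
  runs ps wsel fr s N Q.

Definition good_pivot s l p : Prop :=
  (l != [::] -> p \in l) /\
  ((8 < size l)%N ->
   ((size l %/ 9).*2 <= count (fun i => key s i <= key s p)%O l)%N
   /\ ((size l %/ 9).*2 <= count (fun i => key s p <= key s i)%O l)%N).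

Definition pivot_cost n : nat :=
  if (n <= 8)%N then 20
  else (250 * (n %/ 3).+2 + 250 * (n %/ 9).+2 + 100 + wsel_cost (n %/ 9))%N.

Lemma runs_pivot n fr s N (Q : frame R -> store R -> Prop) :
  (forall m, (m < n)%N -> wsel_correct m) ->
  let l := block s (ireg fr 0%N) n in
  ireg fr 1%N = n -> (ireg fr 0%N + n <= ireg fr 2%N)%N ->
  (pivot_cost n <= N)%N ->
  (forall fr' s', same_off [:: 5; 6; 7]%N [:: 3]%N [:: 1]%N [::] fr s fr' s' ->
     keeps [::] (ireg fr 2%N) s s' -> good_pivot s l (ireg fr' 5%N) ->
     Q fr' s') ->
  runs ps wsel_pivot fr s N Q.
Proof.
move=> IH l r1 le leN HQ; rewrite /pivot_cost in leN.
apply: (@runs_if _ _ _ _ _ _ _ 5) => /=; [|rewrite r1 => n8|rewrite r1 => n8].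
- by case: ifP leN; lia.
- rewrite n8 in leN; apply: runs_straight => //=; first by lia.
  apply: HQ => //=; first by split=> //= x; rewrite /upd inE negb_or => /andP[/negbTE->].
  split; last by rewrite size_block; lia.
  rewrite /upd /= -{1}size_eq0 size_block -lt0n => n0.
  by rewrite -{1}(addn0 (ireg fr 0%N)) -(nth_block s (ireg fr 0%N) n0) mem_nth ?size_block.
rewrite (negbTE n8) in leN; rewrite -ltnNge in n8.
set free := ireg fr 2%N in le HQ *; set m1 := (n %/ 3)%N in leN *.
set m2 := (n %/ 9)%N in leN *; have m2E : (m1 %/ 3 = m2)%N by lia.
apply: (@runs_seq _ _ _ _ _ _ (250 * m1.+2 + 10) _ (fun fr1 s1 =>
  [/\ fr1 = set_nreg (set_ireg fr 6 m1) 3 (m1%:R / 2%:R),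
    keeps [::] free s s1 & block s1 free m1 = medians (key s) l])).
- apply: (@runs_call _ _ _ _ _ _ _ _ _ 10); first by rewrite /=; lia.
  rewrite ps_med3; apply: runs_med3 => /=; rewrite ?r1 //; first by lia.
  by move=> fr1 s1 k1 -> -> bl1.
- by lia.
move=> fr1 s1 [-> k1 bl1].
apply: (@runs_seq _ _ _ _ _ _ (250 * m2.+2 + 10) _ (fun fr2 s2 =>
  [/\ fr2 = set_nreg (set_ireg (set_nreg (set_ireg fr 6 m1)
      3 (m1%:R / 2%:R)) 7 m2) 3 (m2%:R / 2%:R),
    keeps [::] (free + m1) s1 s2
  & block s2 (free + m1) m2 = medians (key s) (medians (key s) l)])).
- apply: (@runs_call _ _ _ _ _ _ _ _ _ 10); first by rewrite /=; lia.
  rewrite ps_med3; apply: runs_med3 => /=; rewrite /upd /= ?m2E //; first by lia.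
  move=> fr2 s2 k2 -> -> bl2; split=> //=.
  by rewrite bl2 bl1 /key !(keeps_ntab k1).
- by lia.
move=> fr2 s2 [-> k2 bl2].
apply: (@runs_call _ _ _ _ _ _ _ _ _ 20); first by rewrite /=; lia.
rewrite ps_wsel.
have ltm2 : (m2 < n)%N by lia.
have szM : size (medians (key s) (medians (key s) l)) = m2.
  by rewrite !size_medians size_block.
apply: (IH _ ltm2) => /=; rewrite /upd /= -/free ?bl2.
- by [].
- by lia.
- by move=> i _; rewrite mul0r addr0.
- rewrite (eq_bigr (fun=> 1)); last by move=> i _; rewrite mul0r addr0.
  rewrite big_const_seq iter_addr_0 count_predT szM.
  have : 0 <= m2%:R :> R by rewrite ler0n.
  lra.
- by lia.
move=> fr3 s3 k3 th3 mem3.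
have [keys2 keys3] : key s2 = key s /\ key s3 = key s.
  by rewrite /key !(keeps_ntab k3) // !(keeps_ntab k2) // !(keeps_ntab k1).
have k13 : keeps [::] free s s3.
  apply: (keeps_trans k1); apply: (keeps_trans (keeps_sub k2 _ _)) => //.
    by rewrite leq_addr.
  by apply: (keeps_sub k3) => //; lia.
apply: HQ => //=.
  split=> //= x.
  + by rewrite !inE !negb_or /upd => /and3P[/negbTE -> /negbTE -> /negbTE ->].
  + by rewrite !inE /upd => /negbTE ->.
  + by rewrite inE => x1; apply: (keeps_itab k13).
  + by rewrite (keeps_ntab k13).
split; rewrite /upd /=.
  move=> _; apply/(mem_medians (key := key s))/(mem_medians (key := key s))/mem3.
  by rewrite -size_eq0 szM; lia.
move=> _; apply: (pivot_rank (R := R)); rewrite szM.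
rewrite -/(key s2) keys2 in th3.
by apply: eq_threshold th3 => i _; rewrite mul0r addr0.
Qed.

Lemma runs_wsel_rec cond T (P : pred nat) n fr s N
    (Q : frame R -> store R -> Prop) :
  let l := block s (ireg fr 0%N) n in
  let w := fun i => nreg fr 1%N + nreg fr 2%N * ntab s tWt i in
  let l' := [seq i <- l | P i] in
  (forall m, (m < n)%N -> wsel_correct m) ->
  ireg fr 1%N = n -> (ireg fr 0%N + n <= ireg fr 2%N)%N ->
  (bcost cond <= 40)%N -> (ncost T <= 10)%N ->
  (forall fr1 s1, same_off [:: 3; 4; 8]%N [::] [:: 1]%N [::] fr s fr1 s1 ->
     beval fr1 s1 cond = P (ireg fr1 4%N)) ->
  (forall fr1 s1, same_off [:: 3; 4; 8]%N [::] [:: 1]%N [::] fr s fr1 s1 ->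
     neval fr1 s1 T = neval fr s T) ->
  (size l' < n)%N ->
  (forall i, i \in l -> 0 <= w i) ->
  0 <= neval fr s T <= \sum_(i <- l') w i ->
  (100 * n.+2 + 50 + wsel_cost (size l') <= N)%N ->
  (forall fr' s', keeps [::] (ireg fr 2%N) s s' ->
     threshold (key s) l' w (neval fr s T) (ireg fr' 0%N) ->
     (l' != [::] -> ireg fr' 0%N \in l') -> Q fr' s') ->
  runs ps (wsel_rec cond T) fr s N Q.
Proof.
move=> l w l' IH r1 le cc cT condE TE lt w0 T0 leN HQ.
apply: (@runs_seq_straight _ _ _ _ _ _ 5) => //=; first by lia.
apply: (@runs_seq _ _ _ _ _ _ (100 * n.+2) _ (fun fr1 s1 =>
  [/\ same_off [:: 3; 4; 8]%N [::] [:: 1]%N [::] fr s fr1 s1,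
    keeps [::] (ireg fr 2%N) s s1
  & block s1 (ireg fr 2%N) (ireg fr1 8%N) = l'])).
- have so0 : same_off [:: 3; 4; 8]%N [::] [:: 1]%N [::] fr s (set_ireg fr 8 0) s.
    by split=> //= x; rewrite !inE !negb_or /upd => /and3P[_ _ /negbTE->].
  apply: (@runs_filt _ _ _ _ _ _ P [::]) => /=; rewrite /upd /= ?r1 //.
    by move=> fr1 s1 so; apply: condE; apply: same_off_trans so0 so.
  move=> fr1 s1 so I1 bl1; split=> //; first exact: same_off_trans so0 so.
  by split=> //= a a1; [rewrite (same_ntab so) | rewrite (same_itab so) // inE].
- by lia.
move=> fr1 s1 [so k1 bl1].
have e8 : ireg fr1 8%N = size l' by rewrite -bl1 size_block.
have [e2 n1 n2] : [/\ ireg fr1 2%N = ireg fr 2%N, nreg fr1 1%N = nreg fr 1%N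
  & nreg fr1 2%N = nreg fr 2%N].
  by split; [apply: (same_ireg so) | apply: (same_nreg so) ..].
apply: (@runs_call _ _ _ _ _ _ _ _ _ 30); first by rewrite /=; lia.
rewrite ps_wsel.
have wE i : nreg fr1 1%N + nreg fr1 2%N * ntab s1 tWt i = w i.
  by rewrite n1 n2 (keeps_ntab k1).
apply: (IH (size l')) => //=; rewrite ?e2 ?bl1 ?e8 //.
- by move: bl1; rewrite e8 => ->; move=> i; rewrite mem_filter wE => /andP[_ /w0].
- move: bl1; rewrite e8 => ->; rewrite (eq_bigr w) ?TE // => i _; exact: wE.
- by lia.
move: bl1; rewrite e8 => -> fr2 s2 k2 th mem.
have keys1 : key s1 = key s by rewrite /key !(keeps_ntab k1).
apply: HQ => //.
- by apply: keeps_trans k1 (keeps_sub k2 _ _) => //; rewrite leq_addr.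
- rewrite -/(key s1) keys1 TE // in th.
  by apply: eq_threshold th => i _; rewrite wE.
Qed.

Lemma runs_wsel n : wsel_correct n.
Proof.
elim/ltn_ind: n => n IH fr s N Q l w r1 le w0 T0 leN HQ.
rewrite /wsel_cost in leN.
apply: (@runs_seq _ _ _ _ _ _ (pivot_cost n) _ (fun fr1 s1 =>
  [/\ same_off [:: 5; 6; 7]%N [:: 3]%N [:: 1]%N [::] fr s fr1 s1,
   keeps [::] (ireg fr 2%N) s s1 & good_pivot s l (ireg fr1 5%N)])).
- by apply: (@runs_pivot n).
- by rewrite /pivot_cost /wsel_cost; case: ifP => n8; lia.
move=> fr1 s1 [so1 k1 [mem gp]].
have [e0 e1 e2] : [/\ ireg fr1 0%N = ireg fr 0%N, ireg fr1 1%N = n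
  & ireg fr1 2%N = ireg fr 2%N].
  by split; rewrite -?r1; apply: (same_ireg so1).
have [n0 n1 n2] : [/\ nreg fr1 0%N = nreg fr 0%N, nreg fr1 1%N = nreg fr 1%N
  & nreg fr1 2%N = nreg fr 2%N] by split; apply: (same_nreg so1).
have l1 : block s1 (ireg fr 0%N) n = l by apply: (keeps_block k1).
have keys1 : key s1 = key s by rewrite /key !(keeps_ntab k1).
do 2!(apply: (@runs_seq_straight _ _ _ _ _ _ 5) => //=;
  first by rewrite /pivot_cost /wsel_cost; case: ifP => n8; lia).
set fr2 := set_nreg _ _ _.
set p := ireg fr1 5%N in mem gp.
apply: (@runs_seq _ _ _ _ _ _ (100 * n.+2) _ (fun fr3 s3 =>
  [/\ s3 = s1, (forall x, x \notin [:: 3; 4]%N -> ireg fr3 x = ireg fr1 x),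
   (forall x, x \notin [:: 3; 4]%N -> nreg fr3 x = nreg fr1 x),
   nreg fr3 3%N = above (key s) p l w & nreg fr3 4%N = from (key s) p l w])).
- apply: (@runs_sums _ _ w); rewrite /= ?e0 ?e1 ?l1 -/(key s1) ?keys1 //.
    move=> fr3 i3 n3; rewrite n3 // n3 //= /upd /= n1 n2.
    by rewrite (keeps_ntab k1).
  move=> fr3 i3 n3 a3 f3; split=> // x xN.
  rewrite n3; last by move: xN; rewrite !inE orbC.
  by move: xN; rewrite !inE /= /upd negb_or => /andP[/negbTE -> /negbTE ->].
- by rewrite /pivot_cost /wsel_cost; case: ifP => n8; lia.
move=> fr3 s3 [-> i3 n3 a3 f3].
have r5 : ireg fr3 5%N = p by apply: i3.
have r0 : ireg fr3 0%N = ireg fr 0%N by rewrite i3.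
have r1' : ireg fr3 1%N = n by rewrite i3.
have r2 : ireg fr3 2%N = ireg fr 2%N by rewrite i3.
have m0 : nreg fr3 0%N = nreg fr 0%N by rewrite n3.
have m1 : nreg fr3 1%N = nreg fr 1%N by rewrite n3.
have m2 : nreg fr3 2%N = nreg fr 2%N by rewrite n3.
have wE i : nreg fr3 1%N + nreg fr3 2%N * ntab s1 tWt i = w i.
  by rewrite m1 m2 (keeps_ntab k1).
have nl0 (P Pc : pred nat) : Pc =1 predC P -> (l != [::] -> Pc p) ->
    (8 < size l -> (size l %/ 9).*2 <= count Pc l)%N ->
    l != [::] ->
    (size [seq i <- l | P i] < n)%N /\
    (100 * n.+2 + 50 + wsel_cost (size [seq i <- l | P i]) <=
     N - pivot_cost n - 5 - 5 - 100 * n.+2 - 10 - 10)%N.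
  move=> PE Pp cP ln.
  have -> : size [seq i <- l | P i] = count P l by rewrite size_filter.
  have E : (count P l + count Pc l = n)%N.
    rewrite -(size_block s (ireg fr 0%N) n) -/l -(count_predC P l).
    by congr (_ + _)%N; apply: eq_count.
  have c1 : (0 < count Pc l)%N.
    by rewrite -has_count; apply/hasP; exists p; [exact: mem | exact: Pp].
  have szl : size l = n by rewrite size_block.
  rewrite szl in cP; split; first by lia.
  by rewrite /pivot_cost /wsel_cost; case: ifP => n8; lia.
have lN (W : R) (P : pred nat) : 0 <= W -> W < \sum_(i <- l | P i) w i -> l != [::].
  by move=> W0; apply: contraTneq => ->; rewrite big_nil -leNgt.
have [T_ge0 T_le] := andP T0.
apply: (@runs_if _ _ _ _ _ _ _ 10) => /=.
- by rewrite /pivot_cost /wsel_cost; case: ifP => n8; lia.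
- rewrite -ltNge m0 a3 => lt.
  have ln := lN _ _ T_ge0 lt.
  have l'n : [seq i <- l | (key s p < key s i)%O] != [::].
    apply: contraTneq lt; rewrite /above -big_filter => ->.
    by rewrite big_nil -leNgt.
  have [|||lts leC] := nl0 (fun i => key s p < key s i)%O
    (fun i => key s i <= key s p)%O _ _ _ ln.
  + by move=> i /=; rewrite leNgt.
  + by [].
  + by move=> /gp [].
  apply: (@runs_wsel_rec _ _ (fun i => (key s p < key s i)%O) n) => //=;
    rewrite ?r0 ?r1' ?r2 ?l1 ?m0 //.
  + move=> fr4 s4 so; have ks4 : key s4 = key s.
      by rewrite -keys1 /key !(same_ntab so).
    have r54 : ireg fr4 5%N = p by rewrite -r5; apply: (same_ireg so).
    by rewrite keyE ks4 r54 ltNge.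
  + by move=> fr4 s4 so; rewrite (same_nreg so).
  + by move=> i il; rewrite wE; exact: w0.
  + rewrite T_ge0 (eq_bigr w) /= => [|i _]; last exact: wE.
    by rewrite big_filter ltW.
  + by apply: leq_trans leC _; lia.
  + move=> fr4 s4 k4 th mem4; apply: HQ.
    * exact: keeps_trans k1 k4.
    * rewrite keys1 in th; apply: (threshold_gt (p := p)).
        by have := mem4 l'n; rewrite mem_filter => /andP[].
      by apply: eq_threshold th => i _; exact: wE.
    * by have := mem4 l'n; rewrite mem_filter => /andP[].
rewrite negbK m0 a3 => le1.
apply: (@runs_if _ _ _ _ _ _ _ 10) => /=.
- by rewrite /pivot_cost /wsel_cost; case: ifP => n8; lia.
- rewrite -ltNge m0 f3 => lt.
  have lt' : 0 < \sum_(i <- l | (key s i < key s p)%O) w i.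
    by move: T_le; rewrite (from_split (key s) l w p); lra.
  have ln := lN 0 _ (lexx 0) lt'.
  have [|||lts leC] := nl0 (fun i => key s i < key s p)%O
    (fun i => key s p <= key s i)%O _ _ _ ln.
  + by move=> i /=; rewrite leNgt.
  + by [].
  + by move=> /gp [].
  have l'n : [seq i <- l | (key s i < key s p)%O] != [::].
    by apply: contraTneq lt'; rewrite -big_filter => ->; rewrite big_nil ltxx.
  apply: (@runs_wsel_rec _ _ (fun i => (key s i < key s p)%O) n) => //=;
    rewrite ?r0 ?r1' ?r2 ?l1 ?m0 ?f3 //.
  + move=> fr4 s4 so; have ks4 : key s4 = key s.
      by rewrite -keys1 /key !(same_ntab so).
    have r54 : ireg fr4 5%N = p by rewrite -r5; apply: (same_ireg so).
    by rewrite keyE ks4 r54 ltNge.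
  + by move=> fr4 s4 so; rewrite !(same_nreg so) // m0 f3.
  + by move=> i il; rewrite wE; exact: w0.
  + rewrite (eq_bigr w) /= => [|i _]; last exact: wE.
    rewrite big_filter; move: T_le; rewrite (from_split (key s) l w p); lra.
  + move=> fr4 s4 k4 th mem4; have := mem4 l'n; rewrite mem_filter => /andP[lt4 il4].
    apply: HQ => //; first exact: keeps_trans k1 k4.
    rewrite keys1 in th; apply: (threshold_lt (p := p)) => //.
    by apply: eq_threshold th => i _; exact: wE.
rewrite negbK m0 f3 => le2.
apply: runs_straight => //=.
  by rewrite /pivot_cost /wsel_cost; case: ifP => n8; lia.
by apply: HQ => //=; rewrite /upd /= r5 /threshold ?le1.
Qed.

End Wsel.
End Selection.

(** * One-constraint programs and queries *)

Definition median tbl : cmd :=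
  NSet 1 (NConst 0) ;;
  foreach 0 1
    (NWrite tK1 cur (NRead tbl cur) ;; NWrite tK2 cur (NConst 0) ;;
     NSet 1 (NAdd (NReg 1) (NConst 1))) ;;
  Call pWSEL [:: IReg 0; IReg 1; IReg 2]
    [:: NDiv (NReg 1) (NConst 2); NConst 1; NConst 0] 5 2 ;;
  NSet 0 (NRead tbl (IReg 5)).

Definition curV := NRead tV cur.
Definition curA := NRead tA cur.
Definition curU := NRead tU cur.

(** Number register 1 is the sign [e] of the second objective, and register 2
    accumulates the capacity after complementing the items with negative
    coefficient. *)
Definition lks_keys : cmd :=
  NWrite tK1 cur (NDiv curV curA) ;;
  NWrite tK2 cur (NDiv (NMul (NReg 1) curU) curA) ;;
  If (NLe (NConst 0) curA) (NWrite tWt cur curA)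
    (NWrite tWt cur (NSub (NConst 0) curA) ;; NSet 2 (NSub (NReg 2) curA)).

Definition lks_fill : cmd :=
  NSet 9 (NSub curV (NMul (NReg 5) curA)) ;;
  NSet 10 (NSub (NMul (NReg 1) curU) (NMul (NReg 6) curA)) ;;
  If (BLex (NReg 9) (NReg 10) (NConst 0) (NConst 0))
    (If (BLex (NConst 0) (NConst 0) (NReg 9) (NReg 10))
      (If (NLe (NConst 0) curA) (NWrite tY cur (NReg 7))
        (NWrite tY cur (NSub (NConst 1) (NReg 7))))
      (NWrite tY cur (NConst 0)))
    (NWrite tY cur (NConst 1)) ;;
  NSet 8 (NAdd (NReg 8) (NMul curU (NRead tY cur))).

Definition lks : cmd :=
  NSet 2 (NReg 0) ;; foreach 0 1 lks_keys ;;
  Call pWSEL [:: IReg 0; IReg 1; IReg 2] [:: NReg 2; NConst 0; NConst 1] 5 3 ;;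
  (NSet 5 (NRead tK1 (IReg 5)) ;; NSet 6 (NRead tK2 (IReg 5)) ;;
   NSet 3 (NConst 0) ;; NSet 4 (NConst 0)) ;;
  sums (NRead tWt cur) ;;
  (NSet 7 (NDiv (NSub (NReg 2) (NReg 3)) (NSub (NReg 4) (NReg 3))) ;;
   NSet 8 (NConst 0)) ;;
  foreach 0 1 lks_fill ;;
  NSet 0 (NReg 8).

Notation pLKS := 2%N (only parsing).

(** Solves the one-constraint program twice, with the second objective maximized
    and minimized.  If the target value of the second objective is between the
    two results, a mixture of the two solutions attains it. *)
Definition query : cmd :=
  Call pLKS [:: IReg 0; IReg 1; IReg 2] [:: NReg 0; NConst 1] 9 2 ;;
  foreach 0 1 (NWrite tY1 cur (NRead tY cur)) ;;
  Call pLKS [:: IReg 0; IReg 1; IReg 2] [:: NReg 0; NConst (-1)] 9 3 ;;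
  If (NLt (NReg 2) (NReg 1)) (NSet 0 (NConst (-1)))
    (If (NLt (NReg 1) (NReg 3)) (NSet 0 (NConst 1))
      (NSet 4 (NDiv (NSub (NReg 1) (NReg 3)) (NSub (NReg 2) (NReg 3))) ;;
       foreach 0 1
         (NWrite tY cur
           (NAdd (NMul (NSub (NConst 1) (NReg 4)) (NRead tY cur))
                 (NMul (NReg 4) (NRead tY1 cur)))) ;;
       NSet 0 (NConst 0))).

Section Knapsack.
Variable R : realFieldType.
Implicit Types (fr : frame R) (s : store R) (l : seq nat).
Variable ps : seq cmd.
Hypothesis ps_med3 : nth Skip ps pMED3 = med3.
Hypothesis ps_wsel : nth Skip ps pWSEL = wsel.

Definition filled (t t' : nat -> R) (pre : seq nat) (F : nat -> R) : Prop :=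
  forall j, t' j = if j \in pre then F j else t j.

Lemma filled_rcons t t' pre F i :
  filled t t' pre F -> filled t (upd t' i (F i)) (rcons pre i) F.
Proof.
by move=> f j; rewrite /upd mem_rcons inE f; case: eqVneq => [->|].
Qed.

Definition median_cost n : nat := (wsel_cost n + 100 * n.+2 + 100)%N.

Lemma runs_median tbl n fr s N (Q : frame R -> store R -> Prop) :
  let l := block s (ireg fr 0%N) n in
  tbl \notin [:: 3; 4]%N ->
  ireg fr 1%N = n -> (ireg fr 0%N + n <= ireg fr 2%N)%N -> (0 < n)%N ->
  (median_cost n <= N)%N ->
  (forall fr' s' p, keeps [:: 3; 4]%N (ireg fr 2%N) s s' -> p \in l ->
     nreg fr' 0%N = ntab s tbl p ->
     threshold (R := R) (lkey (ntab s tbl) (fun=> 0)) l (fun=> 1) (n%:R / 2%:R) p ->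
     Q fr' s') ->
  runs ps (median tbl) fr s N Q.
Proof.
move=> l tN r1 le n0 leN HQ; rewrite /median_cost in leN.
apply: (@runs_seq_straight _ _ _ _ _ _ 10) => //=; first by lia.
pose Q1 fr1 s1 := [/\ same_off [:: 3; 4]%N [:: 1]%N [::] [:: 3; 4]%N fr s fr1 s1,
  nreg fr1 1%N = n%:R, {in l, ntab s1 3%N =1 ntab s tbl}
  & {in l, ntab s1 4%N =1 fun=> 0}].
have so0 v : same_off [:: 3; 4]%N [:: 1]%N [::] [:: 3; 4]%N fr s (set_nreg fr 1 v) s.
  by split=> //= x; rewrite inE /upd => /negbTE->.
apply: (@runs_seq _ _ _ _ _ _ (100 * n.+2) _ Q1).
- pose Inv pre fr1 s1 := [/\ nreg fr1 1%N = (size pre)%:R,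
    filled (ntab s 3%N) (ntab s1 3%N) pre (ntab s tbl)
    & filled (ntab s 4%N) (ntab s1 4%N) pre (fun=> 0)].
  apply: (@runs_foreach R ps 0 1 _ l _ s Inv 100) => //=.
  + by rewrite size_block.
  + by rewrite /upd /= r1.
  + move=> pre i post fr1 s1 _ so iE [n1 f3 f4].
    have tE : ntab s1 tbl = ntab s tbl by apply: (same_ntab so).
    split=> /=; first by rewrite /upd /= n1 size_rcons natr1.
    * by rewrite /upd /= iE tE; exact: filled_rcons.
    * by rewrite /upd /= iE; exact: (filled_rcons i f4).
  + by left.
  + move=> fr1 s1 so [n1 f3 f4]; split.
    * exact: same_off_trans (so0 _) so.
    * by rewrite n1 size_block.
    * by move=> j jl; rewrite f3 jl.
    * by move=> j jl; rewrite f4 jl.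
- by lia.
move=> fr1 s1 [so n1 k1 k2].
have [e0 e1 e2] : [/\ ireg fr1 0%N = ireg fr 0%N, ireg fr1 1%N = n
  & ireg fr1 2%N = ireg fr 2%N] by split; rewrite -?r1; apply: (same_ireg so).
have l1 : block s1 (ireg fr 0%N) n = l by apply: (keeps_block (keeps_same (ireg fr 2%N) so)).
pose Q2 fr2 s2 := [/\ keeps [::] (ireg fr 2%N) s1 s2, ireg fr2 5%N \in l &
  threshold (R := R) (lkey (ntab s tbl) (fun=> 0)) l (fun=> 1) (n%:R / 2%:R) (ireg fr2 5%N)].
apply: (@runs_seq _ _ _ _ _ _ (wsel_cost n + 30) _ Q2).
- apply: (@runs_call _ _ _ _ _ _ _ _ _ 30); first by rewrite /=; lia.
  rewrite ps_wsel; apply: (runs_wsel ps_med3 ps_wsel (n := n)) => /=;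
    rewrite ?e0 ?e1 ?e2 ?l1 ?n1 //.
  + by move=> i _; rewrite mul0r addr0.
  + rewrite (eq_bigr (fun=> 1)); last by move=> i _; rewrite mul0r addr0.
    rewrite big_const_seq iter_addr_0 count_predT size_block.
    have : 0 <= n%:R :> R by rewrite ler0n.
    lra.
  + by rewrite addnK.
  + move=> fr2 s2 kk th mem; have pl : ireg fr2 0%N \in l.
      by apply: mem; rewrite -size_eq0 size_block; lia.
    split=> //=.
    rewrite /upd /=; apply: (eq_threshold_key (key := lkey (ntab s1 3%N) (ntab s1 4%N))) => //.
      by move=> i il; rewrite /lkey k1 // k2.
    by apply: eq_threshold th => i _; rewrite mul0r addr0.
- by lia.
move=> fr2 s2 [kk pl th]; apply: runs_straight => //=; first by lia.
apply: (HQ _ _ (ireg fr2 5%N)) => //=.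
- apply: keeps_trans (keeps_same _ so) (keeps_sub kk _ _) => //.
- by rewrite /upd /= (keeps_ntab kk) // (same_ntab so).
Qed.

Lemma eq_lex_opt l (v u a : nat -> R) T y y' :
  {in l, y =1 y'} -> lex_opt l v u a T y -> lex_opt l v u a T y'.
Proof.
move=> E [yb yT yo]; have dE c : dot l c y' = dot l c y.
  by apply: eq_dot => i /E.
split; first by move=> i il; rewrite -E // yb.
  by rewrite dE.
by move=> x xb xT; rewrite !dE; exact: yo.
Qed.

(** The capacity of the complemented knapsack is in range as soon as the program
    is feasible. *)
Lemma knapsack_range l (a y : nat -> R) :
  in_box l y ->
  0 <= dot l a y + \sum_(i <- l | a i < 0) - a i <= \sum_(i <- l) `|a i|.
Proof.
move=> yb; rewrite /dot [X in _ + X]big_mkcond -big_split /=.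
apply/andP; split.
  rewrite big_seq sumr_ge0 // => i il; have /andP[y0 y1] := yb i il.
  by case: ltP => ai; nra.
rewrite big_seq [X in _ <= X]big_seq; apply: ler_sum => i il.
have /andP[y0 y1] := yb i il.
by case: ltP => ai; [rewrite ltr0_norm // | rewrite ger0_norm //]; nra.
Qed.

Definition lks_cost n : nat := (wsel_cost n + 400 * n.+2 + 200)%N.

Lemma runs_lks n fr s N (Q : frame R -> store R -> Prop) :
  let l := block s (ireg fr 0%N) n in
  let v := ntab s tV in let a := ntab s tA in let u := ntab s tU in
  let e := nreg fr 1%N in let T := nreg fr 0%N in
  ireg fr 1%N = n -> (ireg fr 0%N + n <= ireg fr 2%N)%N ->
  (exists2 y, in_box l y & dot l a y = T) ->
  (lks_cost n <= N)%N ->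
  (forall fr' s', keeps [:: 2; 3; 4; 5]%N (ireg fr 2%N) s s' ->
     (forall j, j \notin l -> ntab s' tY j = ntab s tY j) ->
     lex_opt l v (fun i => e * u i) a T (ntab s' tY) ->
     nreg fr' 0%N = dot l u (ntab s' tY) -> Q fr' s') ->
  runs ps lks fr s N Q.
Proof.
move=> l v a u e T r1 le [y yb yT] leN HQ; rewrite /lks_cost in leN.
apply: (@runs_seq_straight _ _ _ _ _ _ 10) => //=; first by lia.
pose T' := T + \sum_(i <- l | a i < 0) - a i.
pose k1 i := v i / a i; pose k2 i := e * u i / a i.
have so0 w : same_off [:: 3; 4]%N [:: 2]%N [::] [:: 3; 4; 5; 5]%N fr s
   (set_nreg fr 2 w) s.
  by split=> //= x; rewrite inE /upd => /negbTE->.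
pose Q1 fr1 s1 := [/\
  same_off [:: 3; 4]%N [:: 2]%N [::] [:: 3; 4; 5; 5]%N fr s fr1 s1,
  nreg fr1 2%N = T', {in l, ntab s1 3%N =1 k1}, {in l, ntab s1 4%N =1 k2}
  & {in l, ntab s1 5%N =1 fun i => `|a i|}].
apply: (@runs_seq _ _ _ _ _ _ (100 * n.+2) _ Q1).
- pose Inv pre fr1 s1 := [/\
    nreg fr1 2%N = T + \sum_(i <- pre | a i < 0) - a i,
    filled (ntab s 3%N) (ntab s1 3%N) pre k1,
    filled (ntab s 4%N) (ntab s1 4%N) pre k2
    & filled (ntab s 5%N) (ntab s1 5%N) pre (fun i => `|a i|)].
  apply: (@runs_foreach R ps 0 1 _ l _ s Inv 100) => //=.
  + by rewrite size_block.
  + by rewrite /upd /= r1.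
  + by rewrite /Inv /= big_nil addr0; split.
  + move=> pre i post fr1 s1 _ so iE [n2 f3 f4 f5].
    have [vE aE uE] : [/\ ntab s1 6%N = v, ntab s1 7%N = a & ntab s1 8%N = u].
      by split; apply: (same_ntab so).
    have eE : nreg fr1 1%N = e by apply: (same_nreg so).
    have g3 := filled_rcons i f3; have g4 := filled_rcons i f4.
    have g5 := filled_rcons i f5.
    rewrite /upd /= /upd /= vE aE uE iE eE /Inv sum_rcons.
    case: ifP => /= ai; rewrite /upd /=.
      rewrite ltNge ai addr0; split=> //.
      by move: g5; rewrite ger0_norm.
    rewrite ltNge ai /= n2; split=> //; first by ring.
    have a0 : a i < 0 by rewrite ltNge ai.
    by move: g5; rewrite ltr0_norm // sub0r.
  + by left.
  + move=> fr1 s1 so [n2 f3 f4 f5]; split=> //.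
    * exact: same_off_trans (so0 _) so.
    * by move=> j jl; rewrite f3 jl.
    * by move=> j jl; rewrite f4 jl.
    * by move=> j jl; rewrite f5 jl.
- by lia.
move=> fr1 s1 [so n2 f3 f4 f5].
have [e0 e1 e2] : [/\ ireg fr1 0%N = ireg fr 0%N, ireg fr1 1%N = n
  & ireg fr1 2%N = ireg fr 2%N] by split; rewrite -?r1; apply: (same_ireg so).
have eE : nreg fr1 1%N = e by apply: (same_nreg so).
have l1 : block s1 (ireg fr 0%N) n = l by apply: (keeps_block (keeps_same (ireg fr 2%N) so)).
pose key1 := lkey (ntab s1 3%N) (ntab s1 4%N).
pose w i := `|a i|.
pose Q2 fr2 s2 := [/\ keeps [::] (ireg fr 2%N) s1 s2,
  same_off [:: 5]%N [:: 3]%N [:: 1]%N [::] fr1 s1 fr2 s2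
  & threshold key1 l w T' (ireg fr2 5%N)].
apply: (@runs_seq _ _ _ _ _ _ (wsel_cost n + 30) _ Q2).
- apply: (@runs_call _ _ _ _ _ _ _ _ _ 30); first by rewrite /=; lia.
  rewrite ps_wsel; apply: (runs_wsel ps_med3 ps_wsel (n := n)) => /=;
    rewrite ?e0 ?e1 ?e2 ?l1 ?n2 //.
  + by move=> i il; rewrite add0r mul1r f5 // normr_ge0.
  + rewrite (eq_big_seq w); last by move=> i il; rewrite add0r mul1r f5.
    by rewrite /T' -yT; exact: knapsack_range.
  + by rewrite addnK.
  + move=> fr2 s2 kk th _; split=> //=.
    * split=> //= x.
      - by rewrite inE /upd => /negbTE->.
      - by rewrite inE /upd => /negbTE->.
      - by rewrite inE => /(keeps_itab kk).
      - by move=> _; rewrite (keeps_ntab kk).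
    * by rewrite /upd /=; apply: eq_threshold th => i il; rewrite add0r mul1r f5.
- by lia.
move=> fr2 s2 [kk so2 th]; set p := ireg fr2 5%N in th.
have kk2 : keeps [:: 2; 3; 4; 5]%N (ireg fr 2%N) s s2.
  apply: keeps_trans (keeps_sub (keeps_same (ireg fr 2%N) so) _ _)
    (keeps_sub kk _ _) => //; exact/allP.
apply: (@runs_seq_straight _ _ _ _ _ _ 30) => //=; first by lia.
have l2 : block s2 (ireg fr 0%N) n = l by apply: (keeps_block kk2).
set fr3 := set_nreg _ _ _.
pose Q3 fr4 s4 := [/\ s4 = s2,
   (forall x, x \notin [:: 3; 4; 5]%N -> ireg fr4 x = ireg fr x),
   [/\ nreg fr4 1%N = e, nreg fr4 2%N = T', nreg fr4 5%N = ntab s1 3%N p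
    & nreg fr4 6%N = ntab s1 4%N p],
   nreg fr4 3%N = above key1 p l w & nreg fr4 4%N = from key1 p l w].
apply: (@runs_seq _ _ _ _ _ _ (100 * n.+2) _ Q3).
- apply: (@runs_sums _ _ _ (ntab s2 tWt)) => //=.
  + by rewrite /upd /= (same_ireg so2) // e1; lia.
  + move=> fr4 i4 n4 a4 b4.
    have r4 x : x \notin [:: 3; 4; 5]%N -> ireg fr4 x = ireg fr x.
      rewrite !inE !negb_or => /and3P[x3 x4 x5].
      rewrite i4 ?inE ?negb_or ?x3 ?x4 //= (same_ireg so2) ?inE //.
      by rewrite (same_ireg so) // !inE negb_or x3 x4.
    have keys2 : lkey (ntab s2 3%N) (ntab s2 4%N) = key1.
      by rewrite /key1 !(keeps_ntab kk).
    have wE : {in l, ntab s2 5%N =1 w}.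
      by move=> i il; rewrite (keeps_ntab kk) // f5.
    have b3 : block s2 (ireg fr3 0%N) (ireg fr3 1%N) = l.
      by rewrite /fr3 /= !(same_ireg so2) // e0 e1.
    rewrite b3 keys2 in a4 b4.
    rewrite (eq_above _ _ wE) in a4; rewrite (eq_from _ _ wE) in b4.
    split=> //; split; rewrite n4 // /fr3 /= /upd /=.
    * by rewrite (same_nreg so2).
    * by rewrite (same_nreg so2).
    * by rewrite (keeps_ntab kk).
    * by rewrite (keeps_ntab kk).
- by lia.
move=> fr4 s4 [-> i4 [n41 n42 n45 n46] n43 n44].
apply: (@runs_seq_straight _ _ _ _ _ _ 30) => //=; first by lia.
pose phi := (T' - above key1 p l w) / (from key1 p l w - above key1 p l w).
pose F := fill v (fun i => e * u i) a (ntab s1 3%N p) (ntab s1 4%N p) phi.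
set fr5 := set_nreg _ _ _.
apply: (@runs_seq _ _ _ _ _ _ (200 * n.+2) _ (fun fr6 s6 =>
  [/\ keeps [:: 2]%N (ireg fr 2%N) s2 s6, filled (ntab s2 2%N) (ntab s6 2%N) l F
   & nreg fr6 8%N = dot l u F])).
- pose Inv pre fr6 s6 := filled (ntab s2 2%N) (ntab s6 2%N) pre F /\
    nreg fr6 8%N = dot pre u F.
  apply: (@runs_foreach R ps 0 1 _ l _ s2 Inv 200) => //=.
  + by rewrite size_block.
  + by rewrite /fr5 /= !i4 // r1.
  + by rewrite /Inv /dot big_nil.
  + move=> pre i post fr6 s6 _ so6 iE [f2 n8].
    have [vE aE uE] : [/\ ntab s6 6%N = v, ntab s6 7%N = a & ntab s6 8%N = u].
      by split; rewrite (same_ntab so6) // (keeps_ntab kk2).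
    have g2 := filled_rcons i f2.
    have phiE : nreg fr6 7%N = phi.
      by rewrite (same_nreg so6) // /fr5 /= /upd /= n42 n43 n44.
    have eE6 : nreg fr6 1%N = e by rewrite (same_nreg so6).
    have n5E : nreg fr6 5%N = ntab s1 3%N p by rewrite (same_nreg so6).
    have n6E : nreg fr6 6%N = ntab s1 4%N p by rewrite (same_nreg so6).
    rewrite /Inv /dot -cats1 big_cat big_seq1 /= -/(dot _ _ _).
    rewrite /upd /= /upd /= ?vE ?aE ?uE ?iE ?eE6 ?n5E ?n6E ?phiE.
    rewrite mulr0z mulr1z.
    have : F i = F i by [].
    rewrite [in X in _ = X -> _]/F /fill /lex_le.
    do 3?[case: ifP => _ //=] => FiE; rewrite -FiE; split=> /=; rewrite /upd /=;
      by rewrite ?cats1 ?n8 ?iE ?eqxx ?uE.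
  + by left.
  + move=> fr6 s6 so6 [f2 n8]; split=> //.
    by apply: keeps_sub (keeps_same (ireg fr 2%N) so6) _ _ => //; exact/allP.
- by lia.
move=> fr6 s6 [k6 f2 n8]; apply: runs_straight => //=; first by lia.
have FE : {in l, F =1 ntab s6 2%N} by move=> i il; rewrite f2 il.
apply: HQ => //=.
- apply: keeps_trans kk2 (keeps_sub k6 _ _) => //; exact/allP.
- by move=> j jl; rewrite f2 (negbTE jl) (keeps_ntab kk) // (same_ntab so).
- apply: (eq_lex_opt FE); have th' := th.
  apply: (fill_opt (k1 := ntab s1 3%N) (k2 := ntab s1 4%N) (w := w)) => //.
- by rewrite /upd /= n8; apply: eq_dot => i /FE.
Qed.

Hypothesis ps_lks : nth Skip ps pLKS = lks.

Definition query_cost n : nat := (2 * lks_cost n + 200 * n.+2 + 200)%N.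

Lemma runs_query n fr s N (Q : frame R -> store R -> Prop) :
  let l := block s (ireg fr 0%N) n in
  let v := ntab s tV in let a := ntab s tA in let u := ntab s tU in
  let T := nreg fr 0%N in let U := nreg fr 1%N in
  uniq l -> ireg fr 1%N = n -> (ireg fr 0%N + n <= ireg fr 2%N)%N ->
  (exists2 y, in_box l y & dot l a y = T) ->
  (query_cost n <= N)%N ->
  (forall fr' s', keeps [:: 2; 3; 4; 5; 9]%N (ireg fr 2%N) s s' ->
     (forall j, j \notin l -> ntab s' tY j = ntab s tY j) ->
     (nreg fr' 0%N = 0 /\ optimal2 l v a T u U (ntab s' tY)) \/
     (exists g, [/\ nreg fr' 0%N = g, g = 1 \/ g = -1
        & overshoots l v a T u U g]) -> Q fr' s') ->
  runs ps query fr s N Q.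
Proof.
move=> l v a u T U ul r1 le ex leN HQ; rewrite /query_cost in leN.
pose Q1 fr1 s1 := exists th y1, [/\
   fr1 = set_nreg (set_ireg fr 9 (ireg fr1 9%N)) 2 th,
   keeps [:: 2; 3; 4; 5]%N (ireg fr 2%N) s s1,
   (forall j, j \notin l -> ntab s1 tY j = ntab s tY j),
   lex_opt l v u a T y1 & th = dot l u y1 /\ y1 = ntab s1 tY].
apply: (@runs_seq _ _ _ _ _ _ (lks_cost n + 30) _ Q1).
- apply: (@runs_call _ _ _ _ _ _ _ _ _ 30); first by rewrite /=; lia.
  rewrite ps_lks; apply: (@runs_lks n) => //=; first by rewrite addnK.
  move=> fr1 s1 k1 off opt n0.
  exists (nreg fr1 0%N), (ntab s1 tY); split=> //.
  have dE x : dot l (fun i => 1%:~R * u i) x = dot l u x.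
    by apply: eq_bigr => i _; rewrite mul1r.
  case: opt => [yb yT yo]; split=> // x xb xT.
  by have := yo x xb xT; rewrite !dE.
- by lia.
move=> fr1 s1 [th1 [y1 [fr1E k1 off1 opt1 [th1E y1E]]]].
set fr1' := set_nreg _ _ _ in fr1E.
pose Q2 fr2 s2 := [/\ same_off [:: 3; 4]%N [::] [::] [:: 9]%N fr1 s1 fr2 s2 &
  {in l, ntab s2 9%N =1 y1}].
have l1 : block s1 (ireg fr 0%N) n = l by apply: (keeps_block k1).
apply: (@runs_seq _ _ _ _ _ _ (100 * n.+2) _ Q2).
- pose Inv pre fr2 s2 := filled (ntab s1 9%N) (ntab s2 9%N) pre y1.
  apply: (@runs_foreach R ps 0 1 _ l _ s1 Inv 100) => //=.
  + by rewrite size_block.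
  + by rewrite fr1E /fr1' /= /upd /= r1.
  + move=> pre i post fr2 s2 _ so iE f9.
    rewrite /Inv /= /upd /= iE (same_ntab so) // -y1E.
    exact: filled_rcons.
  + by left.
  + by move=> fr2 s2 so f9; split=> // j jl; rewrite f9 jl.
- by lia.
move=> fr2 s2 [so2 y1l].
have k2 : keeps [:: 2; 3; 4; 5; 9]%N (ireg fr 2%N) s s2.
  apply: keeps_trans (keeps_sub k1 _ _)
    (keeps_sub (keeps_same (ireg fr 2%N) so2) _ _) => //; exact/allP.
have l2 : block s2 (ireg fr 0%N) n = l by apply: (keeps_block k2).
have i2 x : x \notin [:: 3; 4; 9]%N -> ireg fr2 x = ireg fr x.
  rewrite !inE !negb_or => /and3P[x3 x4 x9].
  rewrite (same_ireg so2); last by rewrite !inE negb_or x3.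
  by rewrite fr1E /fr1' /= /upd (negbTE x9).
have n2 x : x != 2%N -> nreg fr2 x = nreg fr x.
  by move=> x2; rewrite (same_nreg so2) // fr1E /fr1' /= /upd (negbTE x2).
have n22 : nreg fr2 2%N = th1 by rewrite (same_nreg so2) // fr1E.
have tabE : [/\ ntab s2 6%N = v, ntab s2 7%N = a & ntab s2 8%N = u].
  by split; rewrite (keeps_ntab k2).
pose Q3 fr3 s3 := [/\
   (forall x, x \notin [:: 3; 4; 9]%N -> ireg fr3 x = ireg fr x),
   [/\ nreg fr3 1%N = U, nreg fr3 2%N = th1
     & nreg fr3 3%N = dot l u (ntab s3 tY)],
   keeps [:: 2; 3; 4; 5]%N (ireg fr 2%N) s2 s3,
   (forall j, j \notin l -> ntab s3 tY j = ntab s2 tY j)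
   & lex_opt l v (fun i => (-1) * u i) a T (ntab s3 tY)].
apply: (@runs_seq _ _ _ _ _ _ (lks_cost n + 30) _ Q3).
- apply: (@runs_call _ _ _ _ _ _ _ _ _ 30); first by rewrite /=; lia.
  have [vE aE uE] := tabE.
  rewrite ps_lks; apply: (@runs_lks n) => //=; rewrite ?i2 ?n2 ?l2 ?vE ?aE ?uE //.
    by rewrite addnK.
  move=> fr3 s3 k3 off opt n0; split=> //=; rewrite /upd /=.
  + by move=> x xN; rewrite ifN ?i2 //; move: xN; rewrite !inE !negb_or => /and3P[].
  + by split; [exact: n2 | exact: n22 | exact: n0].
- by lia.
move=> fr3 s3 [i3 [n31 n32 n33] k3 off3 opt3].
have k23 : keeps [:: 2; 3; 4; 5; 9]%N (ireg fr 2%N) s s3.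
  apply: keeps_trans k2 (keeps_sub k3 _ _) => //; exact/allP.
have off : forall j, j \notin l -> ntab s3 tY j = ntab s tY j.
  by move=> j jl; rewrite off3 // (same_ntab so2) // off1.
apply: (@runs_if _ _ _ _ _ _ _ 10) => /=; first by lia.
- rewrite -ltNge n31 n32 => lt; apply: runs_straight => //=; first by lia.
  apply: HQ => //; right; exists (-1); split=> //; last first.
    by apply: overshoots_neg opt1 _; rewrite -th1E.
  by right.
rewrite negbK n31 n32 => le1.
apply: (@runs_if _ _ _ _ _ _ _ 10) => /=; first by lia.
- rewrite -ltNge n31 n33 => lt; apply: runs_straight => //=; first by lia.
  apply: HQ => //; right; exists 1; split=> //; last first.
    by apply: overshoots_pos opt3 lt.
  by left.
rewrite negbK n31 n33 => le2.
apply: (@runs_seq_straight _ _ _ _ _ _ 10) => //=; first by lia.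
have := optimal2_mix (U := U) opt1 opt3; rewrite -th1E le1 le2 => /(_ isT) /=.
set t := _ / _ => opt.
pose Q4 fr4 s4 := keeps [:: 2]%N (ireg fr 2%N) s3 s4 /\
  filled (ntab s3 2%N) (ntab s4 2%N) l (comb t (ntab s3 tY) y1).
have l3 : block s3 (ireg fr 0%N) n = l by apply: (keeps_block k23).
apply: (@runs_seq _ _ _ _ _ _ (100 * n.+2) _ Q4).
- pose Inv pre fr4 s4 := filled (ntab s3 2%N) (ntab s4 2%N) pre (comb t (ntab s3 tY) y1).
  apply: (@runs_foreach R ps 0 1 _ l _ s3 Inv 100) => //=.
  + by rewrite size_block.
  + by rewrite !i3 // r1.
  + move=> pre i post fr4 s4 lE so iE f9.
    have ipre : i \notin pre.
      by move: ul; rewrite lE cat_uniq /= => /and3P[_ /norP[]].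
    have il : i \in l by rewrite lE mem_cat inE eqxx orbT.
    have n4 : nreg fr4 4%N = t.
      by rewrite (same_nreg so) //= /upd /= n31 n32 n33.
    have y4 : ntab s4 2%N i = ntab s3 2%N i by rewrite f9 (negbTE ipre).
    have y14 : ntab s4 9%N i = y1 i.
      by rewrite (same_ntab so) // (keeps_ntab k3) // y1l.
    rewrite /Inv /= /upd /= iE n4 y4 y14.
    exact: (filled_rcons i f9).
  + by left.
  + move=> fr4 s4 so f9; split=> //; exact: keeps_same so.
- by lia.
move=> fr4 s4 [k4 f4]; apply: runs_straight => //=; first by lia.
apply: HQ.
- apply: keeps_trans k23 (keeps_sub k4 _ _) => //; exact/allP.
- by move=> j jl; rewrite f4 (negbTE jl) off.
left; split=> //.
have E : {in l, comb t (ntab s3 tY) y1 =1 ntab s4 tY} by move=> i il; rewrite f4 il.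
have dE c : dot l c (ntab s4 tY) = dot l c (comb t (ntab s3 tY) y1).
  by apply: eq_dot => i il; rewrite E.
have [[yb yT yU] yo] := opt; split; last by move=> x xf; rewrite dE; exact: yo.
by split; rewrite ?dE // => i il; rewrite -E // yb.
Qed.

End Knapsack.

(** * Prune and search for two constraints *)

Notation pMS := 3%N (only parsing).
Notation pMPL := 4%N (only parsing).
Notation pMPM := 5%N (only parsing).
Notation pQUERY := 6%N (only parsing).
Notation pPS := 7%N (only parsing).

Definition curQ := NRead tQ cur.
Definition curS := NRead tS cur.
Definition NIs0 e := BAnd (NLe e (NConst 0)) (NLe (NConst 0) e).

(** Subtracting a multiple of the cardinality constraint from the other one makes 0
    a median of the slopes, so that the items can be paired into nonpositive and
    nonnegative slopes. *)
Definition ps_shift : cmd :=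
  Call pMS [:: IReg 0; IReg 1; IReg 2] [::] 9 3 ;;
  foreach 0 1 (NWrite tS cur (NSub curS (NReg 3))) ;;
  NSet 1 (NSub (NReg 1) (NMul (NReg 3) (NReg 0))).

(** The list is rearranged by the sign of the slope; the j-th item is then paired
    with the j-th item from the end. *)
Definition ps_split : cmd :=
  ISet 8 (IConst 0) ;;
  filt 0 1 2 8 (NLt curS (NConst 0)) ;;
  filt 0 1 2 8 (NIs0 curS) ;;
  filt 0 1 2 8 (NLt (NConst 0) curS).

Definition ps_pairs : cmd :=
  ISet 10 (IConst 0) ;;
  While (ILe (IAdd (IAdd (IReg 10) (IReg 10)) (IConst 2)) (IReg 1))
    (ISet 6 (IRead 1 (IAdd (IReg 2) (IReg 10))) ;;
     ISet 7 (IRead 1 (IAdd (IReg 2)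
              (ISub (ISub (IReg 1) (IConst 1)) (IReg 10)))) ;;
     NWrite tPL (IReg 6)
       (NDiv (NSub (NRead tQ (IReg 7)) (NRead tQ (IReg 6)))
             (NSub (NRead tS (IReg 7)) (NRead tS (IReg 6)))) ;;
     NWrite tPM (IReg 6)
       (NSub (NRead tQ (IReg 6))
             (NMul (NRead tS (IReg 6)) (NRead tPL (IReg 6)))) ;;
     ISet 10 (IAdd (IReg 10) (IConst 1))) ;;
  ISet 11 (IAdd (IReg 2) (IReg 1)).

(** The first query, at the median of the first coordinates of the crossing
    points. *)
Definition ps_lambda : cmd :=
  Call pMPL [:: IReg 2; IReg 10; IReg 11] [::] 9 5 ;;
  foreach 0 1
    (NWrite tV cur (NSub curQ (NMul (NReg 5) curS)) ;;
     NWrite tA cur (NConst 1) ;; NWrite tU cur curS) ;;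
  Call pQUERY [:: IReg 0; IReg 1; IReg 11] [:: NReg 0; NReg 1] 9 6.

(** The second query, at the median of the second coordinates of those crossing
    points whose first coordinate is on the far side of the first query. *)
Definition ps_mu : cmd :=
  ISet 12 (IConst 0) ;;
  filt 2 10 11 12
    (NLe (NMul (NReg 6) (NRead tPL cur)) (NMul (NReg 6) (NReg 5))) ;;
  Call pMPM [:: IReg 11; IReg 12; IAdd (IReg 11) (IReg 12)] [::] 9 8 ;;
  foreach 0 1
    (NWrite tV cur (NSub curQ (NReg 8)) ;;
     NWrite tA cur curS ;; NWrite tU cur (NConst 1)) ;;
  Call pQUERY [:: IReg 0; IReg 1; IReg 11] [:: NReg 1; NReg 0] 9 9.

Definition ps_test : bexp :=
  BAnd (NLe (NConst 0) (NMul (NMul (NReg 6) (NReg 9)) curS))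
    (NLe (NMul (NReg 9) (NSub (NSub curQ (NMul (NReg 5) curS)) (NReg 8)))
         (NConst 0)).

Definition ps_prune : cmd :=
  ISet 8 (IConst 0) ;;
  filt 0 1 2 8 (BNot ps_test) ;;
  foreach 0 1
    (If ps_test
      (NWrite tY cur (NDiv (NSub (NConst 1) (NReg 9)) (NConst 2)) ;;
       NSet 0 (NSub (NReg 0) (NRead tY cur)) ;;
       NSet 1 (NSub (NReg 1) (NMul curS (NRead tY cur))))
      Skip) ;;
  Call pPS [:: IReg 2; IReg 8; IAdd (IReg 2) (IReg 8)] [:: NReg 0; NReg 1] 9 10.

Definition psearch : cmd :=
  If (ILe (IReg 1) (IConst 1))
    (If (ILe (IConst 1) (IReg 1)) (NWrite tY (IRead 1 (IReg 0)) (NReg 0)) Skip)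
    (ps_shift ;; ps_split ;; ps_pairs ;; ps_lambda ;;
     If (NIs0 (NReg 6)) Skip
       (ps_mu ;; If (NIs0 (NReg 9)) Skip ps_prune)).

Section PruneSearch.
Variable R : realFieldType.
Implicit Types (fr : frame R) (s : store R) (l : seq nat).
Variable ps : seq cmd.
Hypothesis ps_med3 : nth Skip ps pMED3 = med3.
Hypothesis ps_wsel : nth Skip ps pWSEL = wsel.
Hypothesis ps_lks : nth Skip ps pLKS = lks.
Hypothesis ps_MS : nth Skip ps pMS = median tS.
Hypothesis ps_MPL : nth Skip ps pMPL = median tPL.
Hypothesis ps_MPM : nth Skip ps pMPM = median tPM.
Hypothesis ps_query : nth Skip ps pQUERY = query.
Hypothesis ps_PS : nth Skip ps pPS = psearch.

Lemma key0E (k : nat -> R) i j :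
  (lkey k (fun=> 0) i <= lkey k (fun=> 0) j)%O = (k i <= k j).
Proof. by rewrite -lex_leE /lex_le lexx /= andbF andbT. Qed.

Lemma runs_ps_shift n fr s N (Q : frame R -> store R -> Prop) :
  let l := block s (ireg fr 0%N) n in
  uniq l -> ireg fr 1%N = n -> (ireg fr 0%N + n <= ireg fr 2%N)%N -> (0 < n)%N ->
  (median_cost n + 100 * n.+2 + 100 <= N)%N ->
  (forall fr' s' sg,
     (forall x, x \notin [:: 3; 4; 9]%N -> ireg fr' x = ireg fr x) ->
     nreg fr' 0%N = nreg fr 0%N ->
     nreg fr' 1%N = nreg fr 1%N - sg * nreg fr 0%N ->
     keeps [:: 3; 4; 11]%N (ireg fr 2%N) s s' ->
     {in l, ntab s' tS =1 fun i => ntab s tS i - sg} ->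
     (n <= (count (fun i => (ntab s' tS i <= 0)%R) l).*2)%N ->
     (n <= (count (fun i => (0 <= ntab s' tS i)%R) l).*2)%N -> Q fr' s') ->
  runs ps ps_shift fr s N Q.
Proof.
move=> l ul r1 le n0 leN HQ.
pose Q1 fr1 s1 := exists2 p,
  [/\ fr1 = set_nreg (set_ireg fr 9 (ireg fr1 9%N)) 3 (ntab s tS p),
    p \in l & keeps [:: 3; 4]%N (ireg fr 2%N) s s1]
  & threshold (R := R) (lkey (ntab s tS) (fun=> 0)) l (fun=> 1) (n%:R / 2%:R) p.
apply: (@runs_seq _ _ _ _ _ _ (median_cost n + 30) _ Q1).
- apply: (@runs_call _ _ _ _ _ _ _ _ _ 30); first by rewrite /=; lia.
  rewrite ps_MS; apply: (runs_median ps_med3 ps_wsel (n := n)) => //=.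
    by rewrite addnK.
  move=> fr1 s1 p k1 pl n1 th; exists p => //; split=> //.
  by rewrite n1.
- by lia.
move=> fr1 s1 [p [fr1E pl k1] th].
set fr1' := set_nreg _ _ _ in fr1E.
have l1 : block s1 (ireg fr 0%N) n = l by apply: (keeps_block k1).
pose sg := ntab s tS p; pose F i := ntab s tS i - sg.
pose Q2 fr2 s2 := same_off [:: 3; 4]%N [::] [::] [:: 11]%N fr1 s1 fr2 s2 /\
  {in l, ntab s2 11%N =1 F}.
apply: (@runs_seq _ _ _ _ _ _ (100 * n.+2) _ Q2).
- pose Inv pre fr2 s2 := filled (ntab s1 11%N) (ntab s2 11%N) pre F.
  apply: (@runs_foreach R ps 0 1 _ l _ s1 Inv 100) => //=.
  + by rewrite size_block.
  + by rewrite fr1E /fr1' /= /upd /= r1.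
  + move=> pre i post fr2 s2 lE so iE f11.
    have ipre : i \notin pre.
      by move: ul; rewrite lE cat_uniq /= => /and3P[_ /norP[]].
    have n3 : nreg fr2 3%N = sg by rewrite (same_nreg so) // fr1E /fr1'.
    have e11 : ntab s2 11%N i = ntab s 11%N i.
      by rewrite f11 (negbTE ipre) (keeps_ntab k1).
    rewrite /Inv /= /upd /= iE n3 e11.
    exact: (filled_rcons i f11).
  + by left.
  + by move=> fr2 s2 so f11; split=> // j jl; rewrite f11 jl.
- by lia.
move=> fr2 s2 [so2 sE]; apply: runs_straight => //=; first by lia.
have n2 x : x != 3%N -> nreg fr2 x = nreg fr x.
  by move=> x3; rewrite (same_nreg so2) // fr1E /fr1' /= /upd (negbTE x3).
have n23 : nreg fr2 3%N = sg by rewrite (same_nreg so2) // fr1E.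
have szl : size l = n by rewrite size_block.
rewrite -szl in th; have [h1 h2] := threshold_count th.
apply: (HQ _ _ sg) => //=.
- move=> x; rewrite !inE !negb_or => /and3P[x3 x4 x9].
  rewrite (same_ireg so2); last by rewrite !inE negb_or x3.
  by rewrite fr1E /fr1' /= /upd (negbTE x9).
- by rewrite /upd /= n2.
- by rewrite /upd /= n23 !n2.
- apply: keeps_trans (keeps_sub k1 _ _)
    (keeps_sub (keeps_same (ireg fr 2%N) so2) _ _) => //; exact/allP.
- rewrite -szl -(eq_in_count (a1 := fun i => (lkey (ntab s tS) (fun=> 0) i <=
    lkey (ntab s tS) (fun=> 0) p)%O)) // => i il.
  by rewrite key0E sE // /F subr_le0.
- rewrite -szl -(eq_in_count (a1 := fun i => (lkey (ntab s tS) (fun=> 0) p <=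
    lkey (ntab s tS) (fun=> 0) i)%O)) // => i il.
  by rewrite key0E sE // /F subr_ge0.
Qed.

Lemma runs_ps_split n fr s N (Q : frame R -> store R -> Prop) :
  let l := block s (ireg fr 0%N) n in let sv := ntab s tS in
  ireg fr 1%N = n -> (ireg fr 0%N + n <= ireg fr 2%N)%N ->
  (n <= (count (fun i => (sv i <= 0)%R) l).*2)%N ->
  (n <= (count (fun i => (0 <= sv i)%R) l).*2)%N ->
  (300 * n.+2 + 100 <= N)%N ->
  (forall fr' s' arr,
     (forall x, x \notin [:: 3; 4; 8]%N -> ireg fr' x = ireg fr x) ->
     (forall x, nreg fr' x = nreg fr x) -> keeps [::] (ireg fr 2%N) s s' ->
     block s' (ireg fr 2%N) n = arr -> perm_eq arr l ->
     (forall j, (j < n./2)%N ->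
        sv (nth 0%N arr j) <= 0 <= sv (nth 0%N arr (n - 1 - j))) -> Q fr' s') ->
  runs ps ps_split fr s N Q.
Proof.
move=> l sv r1 le c1 c2 leN HQ.
have so0 : same_off [:: 3; 4; 8]%N [::] [:: 1]%N [::] fr s (set_ireg fr 8 0) s.
  by split=> //= x; rewrite !inE !negb_or /upd => /and3P[_ _ /negbTE->].
pose L (P : pred nat) := [seq i <- l | P i].
pose Qi l0 fr1 s1 := [/\
   same_off [:: 3; 4; 8]%N [::] [:: 1]%N [::] fr s fr1 s1,
   keeps [::] (ireg fr 2%N) s s1 & block s1 (ireg fr 2%N) (ireg fr1 8%N) = l0].
have pass l0 cond (P : pred nat) fr1 s1 M Q' : (bcost cond <= 40)%N ->
   (forall fr2 s2, same_off [:: 3; 4; 8]%N [::] [:: 1]%N [::] fr s fr2 s2 ->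
     beval fr2 s2 cond = P (ireg fr2 4%N)) ->
   Qi l0 fr1 s1 -> (100 * n.+2 <= M)%N ->
   (forall fr2 s2, Qi (l0 ++ L P) fr2 s2 -> Q' fr2 s2) ->
   runs ps (filt 0 1 2 8 cond) fr1 s1 M Q'.
  move=> cc cE [so k1 bl] leM HQ'.
  have [e0 e1 e2] : [/\ ireg fr1 0%N = ireg fr 0%N, ireg fr1 1%N = n
    & ireg fr1 2%N = ireg fr 2%N] by split; rewrite -?r1; apply: (same_ireg so).
  have l1 : block s1 (ireg fr 0%N) n = l by apply: (keeps_block k1).
  apply: (@runs_filt _ _ _ _ _ _ _ P l0) => //=; rewrite ?e0 ?e1 ?e2 ?l1 //.
    by move=> fr2 s2 so2; apply: cE; apply: same_off_trans so so2.
  move=> fr2 s2 so2 I2 bl2; apply: HQ'; split=> //.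
    exact: same_off_trans so so2.
  apply: keeps_trans k1 _; split=> //= a a1; first by rewrite (same_ntab so2).
  by rewrite (same_itab so2) // inE.
apply: (@runs_seq_straight _ _ _ _ _ _ 5) => //=; first by lia.
pose P1 i := sv i < 0; pose P2 i := (sv i <= 0) && (0 <= sv i).
pose P3 i := 0 < sv i.
have svE fr2 s2 : same_off [:: 3; 4; 8]%N [::] [:: 1]%N [::] fr s fr2 s2 ->
  ntab s2 11%N = sv by move=> so; apply: (same_ntab so).
apply: (@runs_seq _ _ _ _ _ _ (100 * n.+2) _ (Qi (L P1))).
- apply: (pass [::] _ P1) => //; first by move=> fr2 s2 /svE /= ->; rewrite -ltNge.
- by lia.
move=> fr1 s1 q1.
apply: (@runs_seq _ _ _ _ _ _ (100 * n.+2) _ (Qi (L P1 ++ L P2))).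
- apply: (pass (L P1) _ P2) => //; first by move=> fr2 s2 /svE /= ->.
- by lia.
move=> fr2 s2 q2.
apply: (pass (L P1 ++ L P2) _ P3) => //.
- by move=> fr3 s3 /svE /= ->; rewrite -ltNge.
- by lia.
move=> fr3 s3 [so3 k3 bl3].
set arr := _ ++ _ in bl3.
have szl : size l = n by rewrite size_block.
have pe : perm_eq (L P1 ++ L P2) [seq i <- l | sv i <= 0].
  rewrite perm_sym -(perm_filterC (fun i => sv i < 0)).
  rewrite -!filter_predI; apply: perm_cat.
    rewrite [X in perm_eq X _](_ : _ = L P1) //; apply: eq_filter => i /=.
    by rewrite /P1; case: ltgtP.
  rewrite [X in perm_eq X _](_ : _ = L P2) //; apply: eq_filter => i /=.
  by rewrite /P2 -leNgt andbC.
have cl : perm_eq arr l.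
  rewrite perm_sym -(perm_filterC (fun i => sv i <= 0)) /arr.
  apply: perm_cat; first by rewrite perm_sym.
  rewrite [X in perm_eq X _](_ : _ = L P3) //; apply: eq_filter => i /=.
  by rewrite /P3 ltNge.
have sza : size arr = n by rewrite (perm_size cl).
have e8 : ireg fr3 8%N = n by rewrite -sza -bl3 size_block.
apply: (HQ _ _ arr) => //.
- exact: (same_ireg so3).
- by move=> x; apply: (same_nreg so3).
- by rewrite -e8.
have C1 : (size (L P1 ++ L P2) = count (fun i => sv i <= 0)%R l)%N.
  by rewrite (perm_size pe) size_filter.
have C2 : (size (L P1) + count (fun i => 0 <= sv i)%R l = n)%N.
  rewrite size_filter -szl -(count_predC P1 l); congr (_ + _)%N.
  by apply: eq_count => i /=; rewrite /P1 -leNgt.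
have c1' : (n <= (size (L P1 ++ L P2)).*2)%N by rewrite C1.
have c2' : (size (L P1) + n <= size (L P1) + (n - size (L P1)).*2)%N.
  by rewrite leq_add2l -{2}C2 addKn.
move=> j jn; apply/andP; split.
- have jl : (j < size (L P1 ++ L P2))%N by lia.
  rewrite /arr nth_cat jl; have := mem_nth 0%N jl.
  by rewrite mem_cat !mem_filter /P1 /P2 => /orP[/andP[/ltW]|/andP[/andP[]]].
- have jl : (n - 1 - j < size (L P1))%N = false by lia.
  have jr : (n - 1 - j - size (L P1) < size (L P2 ++ L P3))%N.
    by move: sza; rewrite /arr !size_cat; lia.
  rewrite /arr -catA nth_cat jl; have := mem_nth 0%N jr.
  by rewrite mem_cat !mem_filter /P2 /P3 => /orP[/andP[/andP[]]|/andP[/ltW]].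
Qed.

Lemma runs_ps_pairs n fr s N (Q : frame R -> store R -> Prop) :
  let arr := block s (ireg fr 2%N) n in
  let q := ntab s tQ in let sv := ntab s tS in
  uniq arr -> ireg fr 1%N = n -> (100 * n.+2 + 100 <= N)%N ->
  (forall fr' s',
     (forall x, x \notin [:: 6; 7; 10; 11]%N -> ireg fr' x = ireg fr x) ->
     (forall x, nreg fr' x = nreg fr x) ->
     ireg fr' 10%N = n./2 -> ireg fr' 11%N = (ireg fr 2%N + n)%N ->
     (forall a, itab s' a = itab s a) ->
     (forall a, a \notin [:: 12; 13]%N -> ntab s' a = ntab s a) ->
     (forall j, (j < n./2)%N ->
        let i := nth 0%N arr j in let k := nth 0%N arr (n - 1 - j) in
        ntab s' tPL i = (q k - q i) / (sv k - sv i) /\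
        ntab s' tPM i = q i - sv i * ntab s' tPL i) -> Q fr' s') ->
  runs ps ps_pairs fr s N Q.
Proof.
move=> arr q sv ua r1 leN HQ.
have sza : size arr = n by rewrite size_block.
apply: (@runs_seq_straight _ _ _ _ _ _ 5) => //=; first by lia.
pose good t12 t13 j := let i := nth 0%N arr j in
  let k := nth 0%N arr (n - 1 - j) in
  t12 i = (q k - q i) / (sv k - sv i) /\ t13 i = q i - sv i * t12 i.
pose Inv j fr1 s1 := ireg fr1 10%N = j /\
  forall i, (i < j)%N -> good (ntab s1 12%N) (ntab s1 13%N) i.
set fr0 := set_ireg fr 10 0%N.
apply: runs_seq.
- apply: (@runs_while _ _ _ _ fr0 s n./2 100 Inv) => //.
  + move=> j fr1 s1 ltj so [r10 gd].
    have r1' : ireg fr1 1%N = n by rewrite -r1; apply: (same_ireg so).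
    have r2 : ireg fr1 2%N = ireg fr 2%N by apply: (same_ireg so).
    have rd k : (k < n)%N -> itab s1 1%N (ireg fr 2%N + k) = nth 0%N arr k.
      by move=> kn; rewrite (same_itab so) // nth_block.
    split; first by rewrite /= r10 r1'; lia.
    have qE : ntab s1 10%N = q by apply: (same_ntab so).
    have sE : ntab s1 11%N = sv by apply: (same_ntab so).
    rewrite /Inv /= /upd /= r10 r1' r2 qE sE !rd ?addn1; try by lia.
    split=> // i; rewrite ltnS leq_eqVlt => /orP[/eqP->|lti].
      by rewrite /good eqxx.
    have ne : (nth 0%N arr i == nth 0%N arr j) = false.
      by rewrite nth_uniq ?sza //; lia.
    by have [g1 g2] := gd i lti; rewrite /good ne.
  + move=> fr1 s1 so [r10 _]; rewrite /= r10.
    have -> : ireg fr1 1%N = n by rewrite -r1; apply: (same_ireg so).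
    by lia.
- by lia.
move=> fr1 s1 [so [r10 gd]]; apply: runs_straight => //=; first by lia.
apply: HQ => //=.
- move=> x; rewrite !inE !negb_or => /and4P[x6 x7 x10 x11].
  rewrite /upd (negbTE x11) (same_ireg so) /fr0 /= /upd ?(negbTE x10) //.
  by rewrite !inE !negb_or x6 x7.
- by move=> x; rewrite (same_nreg so).
- by rewrite /upd /= !(same_ireg so) // /fr0 /= /upd /= r1.
- by move=> a; rewrite (same_itab so).
- by move=> a aN; rewrite (same_ntab so).
Qed.

Lemma runs_ps_lambda n h fr s N (Q : frame R -> store R -> Prop) :
  let l := block s (ireg fr 0%N) n in let pl := block s (ireg fr 2%N) h in
  let q := ntab s tQ in let sv := ntab s tS in let free := ireg fr 11%N in
  let K := nreg fr 0%N in let B := nreg fr 1%N in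
  uniq l -> ireg fr 1%N = n -> ireg fr 10%N = h -> (0 < h)%N ->
  (ireg fr 0%N + n <= free)%N -> (ireg fr 2%N + h <= free)%N ->
  (exists y, feasible2 l (fun=> 1) K sv B y) ->
  (median_cost h + query_cost n + 100 * n.+2 + 100 <= N)%N ->
  (forall fr' s' p,
     (forall x, x \notin [:: 3; 4; 9]%N -> ireg fr' x = ireg fr x) ->
     nreg fr' 0%N = K -> nreg fr' 1%N = B -> nreg fr' 5%N = ntab s tPL p ->
     keeps [:: 2; 3; 4; 5; 6; 7; 8; 9]%N free s s' ->
     (forall j, j \notin l -> ntab s' tY j = ntab s tY j) ->
     threshold (R := R) (lkey (ntab s tPL) (fun=> 0)) pl (fun=> 1)
       (h%:R / 2%:R) p ->
     (nreg fr' 6%N = 0 /\ optimal2 l q (fun=> 1) K sv B (ntab s' tY)) \/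
     (exists g, [/\ nreg fr' 6%N = g, g = 1 \/ g = -1
        & overshoots l (fun i => q i - ntab s tPL p * sv i) (fun=> 1) K sv B g])
     -> Q fr' s') ->
  runs ps ps_lambda fr s N Q.
Proof.
move=> l pl q sv free K B ul r1 r10 h0 le1 le2 [y0 [y0b y0K y0B]] leN HQ.
pose Q1 fr1 s1 := exists2 p,
  [/\ fr1 = set_nreg (set_ireg fr 9 (ireg fr1 9%N)) 5 (ntab s tPL p),
    p \in pl & keeps [:: 3; 4]%N free s s1]
  & threshold (R := R) (lkey (ntab s tPL) (fun=> 0)) pl (fun=> 1) (h%:R / 2%:R) p.
apply: (@runs_seq _ _ _ _ _ _ (median_cost h + 30) _ Q1).
- apply: (@runs_call _ _ _ _ _ _ _ _ _ 30); first by rewrite /=; lia.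
  rewrite ps_MPL; apply: (runs_median ps_med3 ps_wsel (n := h)) => //=.
    by rewrite addnK.
  move=> fr1 s1 p k1 ppl n1 th; exists p => //; split=> //.
  by rewrite n1.
- by lia.
move=> fr1 s1 [p [fr1E ppl k1] th].
set fr1' := set_nreg _ _ _ in fr1E.
have l1 : block s1 (ireg fr 0%N) n = l by apply: (keeps_block k1).
pose lam := ntab s tPL p; pose F i := q i - lam * sv i.
pose Q2 fr2 s2 := [/\
  same_off [:: 3; 4]%N [::] [::] [:: 6; 7; 8]%N fr1 s1 fr2 s2,
  {in l, ntab s2 6%N =1 F}, {in l, ntab s2 7%N =1 fun=> 1}
  & {in l, ntab s2 8%N =1 sv}].
apply: (@runs_seq _ _ _ _ _ _ (100 * n.+2) _ Q2).
- pose Inv pre fr2 s2 := [/\ filled (ntab s1 6%N) (ntab s2 6%N) pre F,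
    filled (ntab s1 7%N) (ntab s2 7%N) pre (fun=> 1)
    & filled (ntab s1 8%N) (ntab s2 8%N) pre sv].
  apply: (@runs_foreach R ps 0 1 _ l _ s1 Inv 100) => //=.
  + by rewrite size_block.
  + by rewrite fr1E /fr1' /= /upd /= r1.
  + move=> pre i post fr2 s2 lE so iE [f6 f7 f8].
    have n5 : nreg fr2 5%N = lam by rewrite (same_nreg so) // fr1E /fr1'.
    have qE : ntab s2 10%N = q by rewrite (same_ntab so) // (keeps_ntab k1).
    have sE : ntab s2 11%N = sv by rewrite (same_ntab so) // (keeps_ntab k1).
    rewrite /Inv /= /upd /= iE n5 qE sE; split.
    * exact: (filled_rcons i f6).
    * exact: (filled_rcons i f7).
    * exact: (filled_rcons i f8).
  + by left.
  + move=> fr2 s2 so [f6 f7 f8]; split=> // j jl;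
      by rewrite ?f6 ?f7 ?f8 jl.
- by lia.
move=> fr2 s2 [so2 vE aE uE].
have k2 : keeps [:: 3; 4; 6; 7; 8]%N free s s2.
  apply: keeps_trans (keeps_sub k1 _ _)
    (keeps_sub (keeps_same free so2) _ _) => //; exact/allP.
have l2 : block s2 (ireg fr 0%N) n = l by apply: (keeps_block k2).
have i2 x : x \notin [:: 3; 4; 9]%N -> ireg fr2 x = ireg fr x.
  rewrite !inE !negb_or => /and3P[x3 x4 x9].
  rewrite (same_ireg so2); last by rewrite !inE negb_or x3.
  by rewrite fr1E /fr1' /= /upd (negbTE x9).
have n2 x : x != 5%N -> nreg fr2 x = nreg fr x.
  by move=> x5; rewrite (same_nreg so2) // fr1E /fr1' /= /upd (negbTE x5).
have n25 : nreg fr2 5%N = lam by rewrite (same_nreg so2) // fr1E.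
apply: (@runs_call _ _ _ _ _ _ _ _ _ 30); first by rewrite /=; lia.
rewrite ps_query; apply: (runs_query ps_med3 ps_wsel ps_lks (n := n)) => /=;
  rewrite ?i2 ?n2 ?l2 //.
- by exists y0 => //; rewrite -/K -y0K; apply: eq_big_seq => i /aE ->.
- by lia.
move=> fr3 s3 k3 off3 H; apply: (HQ _ _ p) => //=.
- move=> x xN; rewrite /upd ifN ?i2 //.
  by move: xN; rewrite !inE !negb_or => /and3P[].
- by rewrite /upd /= n2.
- by rewrite /upd /= n2.
- apply: keeps_trans (keeps_sub k2 _ _) (keeps_sub k3 _ _) => //; exact/allP.
- by move=> j jl; rewrite off3 // (keeps_ntab k2).
case: H => [[g0 opt]|[g [gE g1 ov]]]; [left|right].
- split; first by rewrite /upd.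
  have := eq_optimal2 vE aE uE opt.
  move=> [yf yo]; split=> // x xf; have := yo x xf.
  have dE z : dot l F z = dot l q z - lam * dot l sv z.
    by rewrite /dot mulr_sumr -sumrB; apply: eq_bigr => i _; rewrite /F; ring.
  by case: xf => _ _ xB; case: yf => _ _ yB; rewrite !dE xB yB lerD2r.
- exists g; split=> //; exact: eq_overshoots ov.
Qed.

Lemma runs_ps_mu n h fr s N (Q : frame R -> store R -> Prop) :
  let l := block s (ireg fr 0%N) n in let pl := block s (ireg fr 2%N) h in
  let q := ntab s tQ in let sv := ntab s tS in let free := ireg fr 11%N in
  let K := nreg fr 0%N in let B := nreg fr 1%N in
  let g := nreg fr 6%N in
  let sel := [seq i <- pl | g * ntab s tPL i <= g * nreg fr 5%N] in
  uniq l -> ireg fr 1%N = n -> ireg fr 10%N = h -> sel != [::] -> (h <= n)%N ->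
  (ireg fr 0%N + n <= free)%N -> (ireg fr 2%N + h <= free)%N ->
  (exists y, feasible2 l (fun=> 1) K sv B y) ->
  (median_cost (size sel) + query_cost n + 200 * n.+2 + 100 <= N)%N ->
  (forall fr' s' p,
     (forall x, x \notin [:: 3; 4; 9; 12]%N -> ireg fr' x = ireg fr x) ->
     (forall x, x \notin [:: 8; 9]%N -> nreg fr' x = nreg fr x) ->
     nreg fr' 8%N = ntab s tPM p ->
     keeps [:: 2; 3; 4; 5; 6; 7; 8; 9]%N free s s' ->
     (forall j, j \notin l -> ntab s' tY j = ntab s tY j) ->
     threshold (R := R) (lkey (ntab s tPM) (fun=> 0)) sel (fun=> 1)
       ((size sel)%:R / 2%:R) p ->
     (nreg fr' 9%N = 0 /\ optimal2 l q (fun=> 1) K sv B (ntab s' tY)) \/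
     (exists g2, [/\ nreg fr' 9%N = g2, g2 = 1 \/ g2 = -1
        & overshoots l (fun i => q i - ntab s tPM p) sv B (fun=> 1) K g2])
     -> Q fr' s') ->
  runs ps ps_mu fr s N Q.
Proof.
move=> l pl q sv free K B g sel ul r1 r10 sel0 hn le1 le2 [y0 [y0b y0K y0B]] leN HQ.
apply: (@runs_seq_straight _ _ _ _ _ _ 5) => //=; first by lia.
have so0 : same_off [:: 3; 4; 12]%N [::] [:: 1]%N [::] fr s (set_ireg fr 12 0) s.
  by split=> //= x; rewrite !inE !negb_or /upd => /and3P[_ _ /negbTE->].
pose Q0 fr1 s1 := [/\ same_off [:: 3; 4; 12]%N [::] [:: 1]%N [::] fr s fr1 s1,
  keeps [::] free s s1, ireg fr1 12%N = size sel & block s1 free (size sel) = sel].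
apply: (@runs_seq _ _ _ _ _ _ (100 * n.+2) _ Q0).
- apply: (@runs_filt _ _ _ _ _ _ _
    (fun i => g * ntab s tPL i <= g * nreg fr 5%N) [::]) => /=;
    rewrite /upd /= ?r10 //; first by lia.
    move=> fr1 s1 so1; have so := same_off_trans so0 so1.
    by rewrite !(same_nreg so) // (same_ntab so).
  move=> fr1 s1 so I1 bl1.
  have sz : ireg fr1 12%N = size sel by rewrite /sel -bl1 size_block.
  split=> //; first exact: same_off_trans so0 so.
    by split=> //= a a1; [rewrite (same_ntab so) | rewrite (same_itab so) // inE].
  by rewrite -sz.
- by lia.
move=> fr1 s1 [so1 k1 r12 bl1].
pose Q1 fr2 s2 := exists2 p,
  [/\ fr2 = set_nreg (set_ireg fr1 9 (ireg fr2 9%N)) 8 (ntab s tPM p),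
    p \in sel & keeps [:: 3; 4]%N free s1 s2]
  & threshold (R := R) (lkey (ntab s tPM) (fun=> 0)) sel (fun=> 1)
      ((size sel)%:R / 2%:R) p.
have e11 : ireg fr1 11%N = free by apply: (same_ireg so1).
have tPME : ntab s1 13%N = ntab s 13%N by apply: (same_ntab so1).
apply: (@runs_seq _ _ _ _ _ _ (median_cost (size sel) + 30) _ Q1).
- apply: (@runs_call _ _ _ _ _ _ _ _ _ 30); first by rewrite /=; lia.
  rewrite ps_MPM; apply: (runs_median ps_med3 ps_wsel (n := size sel)) => /=;
    rewrite ?e11 ?r12 ?bl1 //.
  + by rewrite lt0n size_eq0.
  + by rewrite addnK.
  + move=> fr2 s2 p k2 ppl n1 th; exists p => //; last by rewrite -tPME.
    split=> //; first by rewrite n1 tPME.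
    by apply: (keeps_sub k2) => //; rewrite leq_addr.
- by lia.
move=> fr2 s2 [p [fr2E psel k2] th].
set fr2' := set_nreg _ _ _ in fr2E.
have k12 : keeps [:: 3; 4]%N free s s2.
  by apply: keeps_trans (keeps_sub k1 _ _) k2.
have l2 : block s2 (ireg fr 0%N) n = l by apply: (keeps_block k12).
pose mu := ntab s tPM p; pose F i := q i - mu.
pose Q2 fr3 s3 := [/\
  same_off [:: 3; 4]%N [::] [::] [:: 6; 7; 8]%N fr2 s2 fr3 s3,
  {in l, ntab s3 6%N =1 F}, {in l, ntab s3 7%N =1 sv}
  & {in l, ntab s3 8%N =1 fun=> 1}].
have i2 x : x \notin [:: 3; 4; 9; 12]%N -> ireg fr2 x = ireg fr x.
  rewrite !inE !negb_or => /and4P[x3 x4 x9 x12].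
  rewrite fr2E /fr2' /= /upd (negbTE x9) (same_ireg so1) //.
  by rewrite !inE !negb_or x3 x4.
apply: (@runs_seq _ _ _ _ _ _ (100 * n.+2) _ Q2).
- pose Inv pre fr3 s3 := [/\ filled (ntab s2 6%N) (ntab s3 6%N) pre F,
    filled (ntab s2 7%N) (ntab s3 7%N) pre sv
    & filled (ntab s2 8%N) (ntab s3 8%N) pre (fun=> 1)].
  apply: (@runs_foreach R ps 0 1 _ l _ s2 Inv 100) => //=.
  + by rewrite size_block.
  + by rewrite !i2 // r1.
  + move=> pre i post fr3 s3 lE so iE [f6 f7 f8].
    have n8 : nreg fr3 8%N = mu by rewrite (same_nreg so) // fr2E /fr2'.
    have qE : ntab s3 10%N = q by rewrite (same_ntab so) // (keeps_ntab k12).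
    have sE : ntab s3 11%N = sv by rewrite (same_ntab so) // (keeps_ntab k12).
    rewrite /Inv /= /upd /= iE n8 qE sE; split.
    * exact: (filled_rcons i f6).
    * exact: (filled_rcons i f7).
    * exact: (filled_rcons i f8).
  + by left.
  + move=> fr3 s3 so [f6 f7 f8]; split=> // j jl;
      by rewrite ?f6 ?f7 ?f8 jl.
- by lia.
move=> fr3 s3 [so3 vE aE uE].
have k3 : keeps [:: 3; 4; 6; 7; 8]%N free s s3.
  apply: keeps_trans (keeps_sub k12 _ _)
    (keeps_sub (keeps_same free so3) _ _) => //; exact/allP.
have l3 : block s3 (ireg fr 0%N) n = l by apply: (keeps_block k3).
have i3 x : x \notin [:: 3; 4; 9; 12]%N -> ireg fr3 x = ireg fr x.
  move=> xN; rewrite (same_ireg so3) ?i2 //.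
  by move: xN; rewrite !inE !negb_or => /and4P[-> ->].
have n3 x : x != 8%N -> nreg fr3 x = nreg fr x.
  move=> x8; rewrite (same_nreg so3) // fr2E /fr2' /= /upd (negbTE x8).
  by rewrite (same_nreg so1).
have n38 : nreg fr3 8%N = mu by rewrite (same_nreg so3) // fr2E.
apply: (@runs_call _ _ _ _ _ _ _ _ _ 30); first by rewrite /=; lia.
rewrite ps_query; apply: (runs_query ps_med3 ps_wsel ps_lks (n := n)) => /=;
  rewrite ?i3 ?n3 ?l3 //.
- by exists y0 => //; rewrite -/B -y0B; apply: eq_big_seq => i /aE ->.
- by lia.
move=> fr4 s4 k4 off4 H; apply: (HQ _ _ p) => //=.
- move=> x xN; rewrite /upd ifN ?i3 //.
  by move: xN; rewrite !inE !negb_or => /and4P[].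
- move=> x; rewrite !inE negb_or /upd => /andP[x8 x9].
  by rewrite (negbTE x9) n3.
- apply: keeps_trans (keeps_sub k3 _ _) (keeps_sub k4 _ _) => //; exact/allP.
- by move=> j jl; rewrite off4 // (keeps_ntab k3).
case: H => [[g0 opt]|[g2 [gE g1 ov]]]; [left|right].
- split; first by rewrite /upd.
  have [[yb yB yK] yo] := eq_optimal2 vE aE uE opt.
  split=> // x [xb xK xB]; have := yo x (And3 xb xB xK).
  have dE z : dot l F z = dot l q z - mu * dot l (fun=> 1) z.
    by rewrite /dot mulr_sumr -sumrB; apply: eq_bigr => i _; rewrite /F; ring.
  by rewrite !dE xK yK lerD2r.
- exists g2; split=> //; exact: eq_overshoots ov.
Qed.

(** Every round costs a constant times its length and removes a twelfth of the
    items, so it is paid for by the items that it removes. *)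
Definition ps_cost n : nat := (5000 * (1000 * n) + 1000)%N.

Definition psearch_correct n : Prop := forall fr s N Q,
  let l := block s (ireg fr 0%N) n in
  let q := ntab s tQ in let sv := ntab s tS in let free := ireg fr 2%N in
  let K := nreg fr 0%N in let B := nreg fr 1%N in
  uniq l -> ireg fr 1%N = n -> (ireg fr 0%N + n <= free)%N ->
  (exists y, feasible2 l (fun=> 1) K sv B y) ->
  (ps_cost n <= N)%N ->
  (forall fr' s',
     keeps [:: 2; 3; 4; 5; 6; 7; 8; 9; 11; 12; 13]%N free s s' ->
     (forall j, j \notin l -> ntab s' tY j = ntab s tY j) ->
     optimal2 l q (fun=> 1) K sv B (ntab s' tY) -> Q fr' s') ->
  runs ps psearch fr s N Q.

Lemma runs_ps_prune n fr s N (Q : frame R -> store R -> Prop) :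
  let l := block s (ireg fr 0%N) n in
  let q := ntab s tQ in let sv := ntab s tS in let free := ireg fr 2%N in
  let K := nreg fr 0%N in let B := nreg fr 1%N in
  let P := prunable q sv (nreg fr 5%N) (nreg fr 8%N) (nreg fr 6%N) (nreg fr 9%N) in
  let v := (1 - nreg fr 9%N) / 2%:R in
  let J := [seq i <- l | P i] in let l' := [seq i <- l | ~~ P i] in
  let K' := K - \sum_(i <- J) v in
  let B' := B - \sum_(i <- J) sv i * v in
  (forall m, (m < n)%N -> psearch_correct m) ->
  uniq l -> ireg fr 1%N = n -> (ireg fr 0%N + n <= free)%N ->
  (size l' < n)%N ->
  (exists y, feasible2 l' (fun=> 1) K' sv B' y) ->
  (ps_cost (size l') + 300 * n.+2 + 100 <= N)%N ->
  (forall fr' s',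
     keeps [:: 2; 3; 4; 5; 6; 7; 8; 9; 11; 12; 13]%N free s s' ->
     (forall j, j \notin l -> ntab s' tY j = ntab s tY j) ->
     (forall j, j \in J -> ntab s' tY j = v) ->
     optimal2 l' q (fun=> 1) K' sv B' (ntab s' tY) -> Q fr' s') ->
  runs ps ps_prune fr s N Q.
Proof.
move=> l q sv free K B P v J l' K' B' IH ul r1 le lt ex leN HQ.
apply: (@runs_seq_straight _ _ _ _ _ _ 5) => //=; first by lia.
have so0 : same_off [:: 3; 4; 8]%N [::] [:: 1]%N [::] fr s (set_ireg fr 8 0) s.
  by split=> //= x; rewrite !inE !negb_or /upd => /and3P[_ _ /negbTE->].
pose Q0 fr1 s1 := [/\ same_off [:: 3; 4; 8]%N [::] [:: 1]%N [::] fr s fr1 s1,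
  keeps [::] free s s1, ireg fr1 8%N = size l' & block s1 free (size l') = l'].
apply: (@runs_seq _ _ _ _ _ _ (100 * n.+2) _ Q0).
- apply: (@runs_filt _ _ _ _ _ _ _ (fun i => ~~ P i) [::]) => /=;
    rewrite /upd /= ?r1 //.
    move=> fr1 s1 so1; have so := same_off_trans so0 so1.
    by rewrite !(same_nreg so) // !(same_ntab so).
  move=> fr1 s1 so I1 bl1.
  have sz : ireg fr1 8%N = size l' by rewrite /l' -bl1 size_block.
  split=> //; first exact: same_off_trans so0 so.
    by split=> //= a a1; [rewrite (same_ntab so) | rewrite (same_itab so) // inE].
  by rewrite -sz.
- by lia.
move=> fr1 s1 [so1 k1 r8 bl1].
have l1 : block s1 (ireg fr 0%N) n = l by apply: (keeps_block k1).
pose Q1 fr2 s2 := [/\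
  same_off [:: 3; 4]%N [:: 0; 1]%N [::] [:: 2]%N fr1 s1 fr2 s2,
  nreg fr2 0%N = K', nreg fr2 1%N = B'
  & filled (ntab s1 2%N) (ntab s2 2%N) J (fun=> v)].
have q1E : ntab s1 10%N = q by apply: (same_ntab so1).
have s1E : ntab s1 11%N = sv by apply: (same_ntab so1).
apply: (@runs_seq _ _ _ _ _ _ (100 * n.+2) _ Q1).
- pose Inv pre fr2 s2 := [/\ nreg fr2 0%N = K - \sum_(i <- pre | P i) v,
    nreg fr2 1%N = B - \sum_(i <- pre | P i) sv i * v
    & filled (ntab s1 2%N) (ntab s2 2%N) [seq i <- pre | P i] (fun=> v)].
  apply: (@runs_foreach R ps 0 1 _ l _ s1 Inv 100) => //=.
  + by rewrite size_block.
  + by rewrite !(same_ireg so1) // r1.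
  + by rewrite /Inv /= !big_nil !subr0 !(same_nreg so1).
  + move=> pre i post fr2 s2 lE so iE [n0 n1 f2].
    have qE : ntab s2 10%N = q by rewrite (same_ntab so).
    have sE : ntab s2 11%N = sv by rewrite (same_ntab so).
    have nE x : x \notin [:: 0; 1]%N -> nreg fr2 x = nreg fr x.
      by move=> xN; rewrite (same_nreg so) // (same_nreg so1).
    rewrite qE sE iE (nE 5%N) // (nE 6%N) // (nE 8%N) // (nE 9%N) // /Inv.
    rewrite filter_rcons !sum_rcons.
    rewrite -[_ && _]/(P i).
    case: ifP => Pi; last by rewrite !addr0.
    rewrite /= /upd /= ?iE ?eqxx sE; split.
    * by rewrite n0 /v; ring.
    * by rewrite n1 /v; ring.
    * exact: (filled_rcons i f2).
  + by left.
  + by move=> fr2 s2 so [n0 n1 f2]; split=> //; rewrite ?n0 ?n1 /K' /B' /J big_filter.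
- by lia.
move=> fr2 s2 [so2 n0 n1 f2].
have k2 : keeps [:: 2]%N free s s2.
  by apply: keeps_trans (keeps_sub k1 _ _) (keeps_same free so2).
have l2 : block s2 free (size l') = l'.
  by rewrite -[RHS]bl1; apply: eq_block_tab; apply: (same_itab so2).
have e8 : ireg fr2 8%N = size l' by rewrite -r8; apply: (same_ireg so2).
have e2 : ireg fr2 2%N = free by rewrite (same_ireg so2) // (same_ireg so1).
have [q2E s2E] : ntab s2 10%N = q /\ ntab s2 11%N = sv.
  by split; rewrite (keeps_ntab k2).
apply: (@runs_call _ _ _ _ _ _ _ _ _ 30); first by rewrite /=; lia.
rewrite ps_PS; apply: (IH _ lt) => /=; rewrite ?e8 ?e2 ?l2 ?q2E ?s2E ?n0 ?n1 //.
- exact: filter_uniq.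
- by lia.
move=> fr3 s3 k3 off3 opt; apply: HQ => //.
- apply: keeps_trans (keeps_sub k2 _ _) (keeps_sub k3 _ _) => //; first exact/allP.
  by rewrite leq_addr.
- move=> j jl; rewrite off3; last by rewrite mem_filter (negbTE jl) andbF.
  by rewrite f2 mem_filter (negbTE jl) andbF (keeps_ntab k1).
- move=> j jJ; rewrite off3; first by rewrite f2 jJ.
  by move: jJ; rewrite !mem_filter => /andP[->].
Qed.

Lemma dot_shift l (sv sv' y : nat -> R) sg :
  {in l, sv' =1 fun i => sv i - sg} ->
  dot l sv' y = dot l sv y - sg * dot l (fun=> 1) y.
Proof.
move=> E; rewrite /dot mulr_sumr -sumrB; apply: eq_big_seq => i /E ->; ring.
Qed.

(** Both constraints are equalities, so the shift does not change the feasible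
    set. *)
Lemma feasible2_shift l (sv sv' y : nat -> R) sg K B :
  {in l, sv' =1 fun i => sv i - sg} ->
  feasible2 l (fun=> 1) K sv B y <->
  feasible2 l (fun=> 1) K sv' (B - sg * K) y.
Proof.
move=> E; split=> -[yb yK yB]; split=> //.
- by rewrite (dot_shift y E) yB yK.
- by move: yB; rewrite (dot_shift y E) yK; lra.
Qed.

Lemma optimal2_shift l (q sv sv' y : nat -> R) sg K B :
  {in l, sv' =1 fun i => sv i - sg} ->
  optimal2 l q (fun=> 1) K sv' (B - sg * K) y ->
  optimal2 l q (fun=> 1) K sv B y.
Proof.
move=> E [yf yo]; split; first exact/(feasible2_shift _ _ _ E).
by move=> x /(feasible2_shift _ _ _ E) /yo.
Qed.

(** Half of the pairs pass the first median and half of these the second one; each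
    of them loses an item by [crossing_prunable]. *)
Lemma count_pruned n l arr (q sv tl tm : nat -> R) g1 g2 p1 p2 :
  let h := n./2 in
  let sel := [seq i <- take h arr | g1 * tl i <= g1 * tl p1] in
  size arr = n -> perm_eq arr l -> (1 < n)%N ->
  g1 = 1 \/ g1 = -1 -> g2 = 1 \/ g2 = -1 ->
  (forall j, (j < h)%N ->
     sv (nth 0%N arr j) <= 0 <= sv (nth 0%N arr (n - 1 - j))) ->
  (forall j, (j < h)%N ->
     let i := nth 0%N arr j in let k := nth 0%N arr (n - 1 - j) in
     tl i = (q k - q i) / (sv k - sv i) /\ tm i = q i - sv i * tl i) ->
  threshold (R := R) (lkey tl (fun=> 0)) (take h arr) (fun=> 1)
    (h%:R / 2%:R) p1 ->
  threshold (R := R) (lkey tm (fun=> 0)) sel (fun=> 1)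
    ((size sel)%:R / 2%:R) p2 ->
  (n <= 12 * count (prunable q sv (tl p1) (tm p2) g1 g2) l)%N.
Proof.
move=> h sel sza pa n1 g1E g2E hs hc th1 th2.
have szt : size (take h arr) = h by rewrite size_takel ?sza //; lia.
have := threshold_side g1E (l := take h arr) (k := tl) (p := p1).
rewrite szt => /(_ th1) c1.
have := threshold_side g2E th2 => c2.
pose bad i := (g2 * tm i <= g2 * tm p2) && (g1 * tl i <= g1 * tl p1).
have c3 : (count bad (take h arr) <=
    count (prunable q sv (tl p1) (tm p2) g1 g2) arr)%N.
  apply: count_pairs; first by rewrite sza; lia.
  move=> j jh /andP[b1 b2]; rewrite sza.
  have [e1 e2] := hc j jh.
  by apply: crossing_prunable; rewrite ?hs // -e1 -?e2.
rewrite (seq.permP pa) in c3.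
have c4 : count (fun i => g2 * tm i <= g2 * tm p2) sel = count bad (take h arr).
  by rewrite /sel count_filter.
have c5 : size sel = count (fun i => g1 * tl i <= g1 * tl p1) (take h arr).
  by rewrite /sel size_filter.
rewrite c4 in c2; rewrite -c5 in c1.
apply: leq_trans (leq_mul (leqnn 12) c3).
move: c1 c2; rewrite /h; move: (size sel) (count bad _) => a b c1 c2.
by lia.
Qed.

Lemma runs_psearch n : psearch_correct n.
Proof.
elim/ltn_ind: n => n IH fr s N Q l q sv free K B ul r1 le [y0 y0f] leN HQ.
rewrite /ps_cost in leN.
have szl : size l = n by rewrite size_block.
apply: (@runs_if _ _ _ _ _ _ _ 5) => /=; first by lia.
  rewrite r1 => n1; have [y0b y0K y0B] := y0f.
  apply: (@runs_if _ _ _ _ _ _ _ 5) => /=; rewrite ?r1; first by lia.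
    move=> n2; have nE : n = 1%N by lia.
    have lE : l = [:: itab s 1%N (ireg fr 0%N)] by rewrite /l nE.
    apply: runs_straight => //=; first by lia.
    set i := itab s 1%N _ in lE *.
    have xi x : feasible2 l (fun=> 1) K sv B x -> x i = K.
      by move=> [_ xK _]; rewrite -xK lE /dot big_seq1 mul1r.
    have yE : {in l, y0 =1 ntab (set_ntab s tY i K) tY}.
      by move=> j; rewrite lE inE => /eqP->; rewrite /= /upd /= eqxx xi.
    have dE c : dot l c (ntab (set_ntab s tY i K) tY) = dot l c y0.
      by apply: eq_dot => j /yE ->.
    apply: HQ.
    + split=> //= a aN; rewrite /upd ifN //.
      by apply: contra aN => /eqP->.
    + by move=> j; rewrite lE inE /= /upd /= => /negbTE->.
    + split; first by split; rewrite ?dE // => j jl; rewrite -yE // y0b.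
      by move=> x xf; rewrite dE /dot lE !big_seq1 (xi x xf) (xi y0 y0f) lexx.
  move=> n2; have nE : n = 0%N by lia.
  have lE : l = [::] by apply/nilP; rewrite /nilp szl nE.
  apply: runs_straight => //=; first by lia.
  apply: HQ => //; split; last by move=> x _; rewrite lE /dot !big_nil.
  by move: y0f; rewrite lE => -[_]; rewrite /dot !big_nil => ? ?; split=> //;
    rewrite /dot big_nil.
rewrite r1 -ltnNge => n1.
(* One multiple of the length bounds the cost of every stage of a round. *)
have Dm (k : nat) : (k <= n)%N -> (median_cost k <= 21 * (1000 * n.+2))%N.
  by rewrite /median_cost /wsel_cost; lia.
have Dq : (query_cost n <= 43 * (1000 * n.+2))%N.
  by rewrite /query_cost /lks_cost /wsel_cost; lia.
have Dn := Dm n (leqnn n).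
apply: (@runs_seq _ _ _ _ _ _ (median_cost n + 100 * n.+2 + 100) _
  (fun fr1 s1 => exists sg, [/\
     (forall x, x \notin [:: 3; 4; 9]%N -> ireg fr1 x = ireg fr x),
     nreg fr1 0%N = K /\ nreg fr1 1%N = B - sg * K,
     keeps [:: 3; 4; 11]%N free s s1,
     {in l, ntab s1 tS =1 fun i => sv i - sg} &
     (n <= (count (fun i => (ntab s1 tS i <= 0)%R) l).*2)%N /\
     (n <= (count (fun i => (0 <= ntab s1 tS i)%R) l).*2)%N])).
- apply: (@runs_ps_shift n) => //; first by lia.
  by move=> fr1 s1 sg; exists sg.
- by lia.
move=> fr1 s1 [sg [i1 [n10 n11] k1 sE [c1 c2]]].
pose sv1 := ntab s1 tS; pose B1 := B - sg * K.
have ex1 : exists y, feasible2 l (fun=> 1) K sv1 B1 y.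
  by exists y0; apply/(feasible2_shift _ _ _ sE).
have l1 : block s1 (ireg fr 0%N) n = l by apply: (keeps_block k1).
apply: (@runs_seq _ _ _ _ _ _ (300 * n.+2 + 100) _
  (fun fr2 s2 => exists arr, [/\
     (forall x, x \notin [:: 3; 4; 8; 9]%N -> ireg fr2 x = ireg fr x),
     (forall x, nreg fr2 x = nreg fr1 x), keeps [::] free s1 s2,
     block s2 free n = arr /\ perm_eq arr l &
     forall j, (j < n./2)%N ->
        sv1 (nth 0%N arr j) <= 0 <= sv1 (nth 0%N arr (n - 1 - j))])).
- apply: (@runs_ps_split n); rewrite ?i1 ?l1 //.
  move=> fr2 s2 arr i2 n2 k2 bl pa hs; exists arr; split=> // x.
  rewrite !inE !negb_or => /and4P[x3 x4 x8 x9].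
  by rewrite i2 ?i1 // !inE !negb_or ?x3 ?x4.
- by lia.
move=> fr2 s2 [arr [i2 n2 k2 [bl2 pa] hs]].
have k12 : keeps [:: 3; 4; 11]%N free s s2.
  by apply: keeps_trans k1 (keeps_sub k2 _ _).
have sza : size arr = n by rewrite (perm_size pa).
have ua : uniq arr by rewrite (perm_uniq pa).
apply: (@runs_seq _ _ _ _ _ _ (100 * n.+2 + 100) _
  (fun fr3 s3 => [/\
     (forall x, x \notin [:: 3; 4; 6; 7; 8; 9; 10; 11]%N -> ireg fr3 x = ireg fr x),
     (forall x, nreg fr3 x = nreg fr1 x),
     ireg fr3 10%N = n./2 /\ ireg fr3 11%N = (free + n)%N,
     (forall a, itab s3 a = itab s2 a) /\
     (forall a, a \notin [:: 12; 13]%N -> ntab s3 a = ntab s2 a) &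
     (forall j, (j < n./2)%N ->
        let i := nth 0%N arr j in let k := nth 0%N arr (n - 1 - j) in
        ntab s3 tPL i = (q k - q i) / (sv1 k - sv1 i) /\
        ntab s3 tPM i = q i - sv1 i * ntab s3 tPL i)])).
- have i22 : ireg fr2 2%N = free by rewrite i2.
  have q2 : ntab s2 10%N = q by rewrite (keeps_ntab k12).
  have sv2 : ntab s2 11%N = sv1 by rewrite (keeps_ntab k2).
  apply: (@runs_ps_pairs n); rewrite ?i22 ?bl2 //; first by rewrite i2.
  move=> fr3 s3 i3 n3 e10 e11 it3 nt3 hc; split=> //.
  + move=> x; rewrite !inE !negb_or => /and5P[x3 x4 x6 x7 /and4P[x8 x9 x10 x11]].
    by rewrite i3 ?i2 // !inE !negb_or ?x3 ?x4 ?x6 ?x7 ?x8 ?x9 ?x10.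
  + by move=> x; rewrite n3 n2.
  + move=> j jh; have := hc j jh.
    by rewrite q2 sv2.
- by lia.
move=> fr3 s3 [i3 n3 [e10 e11] [it3 nt3] hc].
have k3 : keeps [:: 3; 4; 11; 12; 13]%N free s s3.
  apply: keeps_trans (keeps_sub k12 _ _) _ => //; first exact/allP.
  split=> [a aN|a _|j _]; rewrite ?it3 //.
  rewrite nt3 //; apply: contra aN; rewrite !inE.
  by move=> /orP[]->; rewrite !orbT.
have l3 : block s3 (ireg fr 0%N) n = l by apply: (keeps_block k3).
have [i30 i31 i32] : [/\ ireg fr3 0%N = ireg fr 0%N, ireg fr3 1%N = n
  & ireg fr3 2%N = free] by split; rewrite i3.
have q3 : ntab s3 10%N = q by apply: (keeps_ntab k3).
have sv3 : ntab s3 11%N = sv1 by rewrite nt3 // (keeps_ntab k2).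
have n30 : nreg fr3 0%N = K by rewrite n3.
have n31 : nreg fr3 1%N = B1 by rewrite n3.
set h := n./2 in e10 hc hs.
have hn : (h <= n)%N by rewrite /h; clear; lia.
have h0 : (0 < h)%N by rewrite /h; move: n1; clear; lia.
have pl3 : block s3 free h = take h arr.
  rewrite (@block_take _ _ _ n) //.
  by rewrite -bl2; congr (take _ _); apply: eq_block_tab.
have Dh : (median_cost h <= 21 * (1000 * n.+2))%N by apply: Dm.
apply: (@runs_seq _ _ _ _ _ _ (median_cost h + query_cost n + 100 * n.+2 + 100) _
  (fun fr4 s4 => exists p, [/\
     (forall x, x \notin [:: 3; 4; 9]%N -> ireg fr4 x = ireg fr3 x),
     [/\ nreg fr4 0%N = K, nreg fr4 1%N = B1 & nreg fr4 5%N = ntab s3 tPL p],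
     keeps [:: 2; 3; 4; 5; 6; 7; 8; 9]%N (free + n) s3 s4 /\
     (forall j, j \notin l -> ntab s4 tY j = ntab s3 tY j),
     threshold (R := R) (lkey (ntab s3 tPL) (fun=> 0)) (take h arr) (fun=> 1)
       (h%:R / 2%:R) p &
     (nreg fr4 6%N = 0 /\ optimal2 l q (fun=> 1) K sv1 B1 (ntab s4 tY)) \/
     (exists g, [/\ nreg fr4 6%N = g, g = 1 \/ g = -1
      & overshoots l (fun i => q i - ntab s3 tPL p * sv1 i) (fun=> 1) K sv1 B1 g])])).
- apply: (@runs_ps_lambda n h); rewrite ?i30 ?i32 ?e11 ?l3 ?pl3 ?q3 ?sv3 ?n30 ?n31 //.
  + exact: leq_trans le (leq_addr _ _).
  + by rewrite leq_add2l.
  + by move=> fr4 s4 p i4 n40 n41 n45 k4 off4 th4 H4; exists p.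
- by lia.
move=> fr4 s4 [p1 [i4 [n40 n41 n45] [k4 off4] th4 H4]].
have k34 : keeps [:: 2; 3; 4; 5; 6; 7; 8; 9; 11; 12; 13]%N free s s4.
  apply: keeps_trans (keeps_sub k3 _ _) (keeps_sub k4 _ _) => //;
    rewrite ?leq_addr //; exact/allP.
have offY : forall j, j \notin l -> ntab s4 tY j = ntab s tY j.
  by move=> j jl; rewrite off4 // (keeps_ntab k3).
apply: (@runs_if _ _ _ _ _ _ _ 10) => /=; first by move: leN n1 Dn Dq Dh; clear; lia.
  move=> /andP[g1 g2]; have g0 : nreg fr4 6%N = 0 by apply/le_anti/andP.
  apply: runs_straight => //=; first by move: leN n1 Dn Dq Dh; clear; lia.
  apply: HQ => //; apply: (optimal2_shift sE).
  case: H4 => [[]//|[g [gE g1E _]]].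
  by move/eqP: g0; rewrite gE; case: g1E => ->; rewrite ?oppr_eq0 oner_eq0.
move=> gN; case: H4 => [[g0 _]|[g1 [gE g1E ov1]]].
  by rewrite g0 mulr0z lexx in gN.
have [q4 sv4] : ntab s4 10%N = q /\ ntab s4 11%N = sv1.
  by rewrite !(keeps_ntab k4).
have tlE : ntab s4 12%N = ntab s3 12%N by rewrite (keeps_ntab k4).
have tmE : ntab s4 13%N = ntab s3 13%N by rewrite (keeps_ntab k4).
have [i40 i41 i42] : [/\ ireg fr4 0%N = ireg fr 0%N, ireg fr4 1%N = n
  & ireg fr4 2%N = free] by split; rewrite i4.
have [e40 e41] : ireg fr4 10%N = h /\ ireg fr4 11%N = (free + n)%N by rewrite !i4.
have l4 : block s4 (ireg fr 0%N) n = l by apply: (keeps_block k34).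
have pl4 : block s4 free h = take h arr.
  by rewrite -pl3; apply: (keeps_block k4); rewrite leq_add2l.
have szt : size (take h arr) = h by rewrite size_takel // sza.
set tl := ntab s3 12%N in th4 n45 ov1 hc tlE; set tm := ntab s3 13%N in hc tmE.
pose sel := [seq i <- take h arr | g1 * tl i <= g1 * tl p1].
have c5 : (h <= (size sel).*2)%N.
  have := threshold_side g1E (l := take h arr) (k := tl) (p := p1).
  by rewrite szt => /(_ th4); rewrite /sel size_filter.
have ns0 : (0 < size sel)%N.
  by rewrite lt0n; apply: contraTneq c5 => ->; rewrite -ltnNge.
have sel0 : sel != [::] by rewrite -size_eq0 -lt0n.
have selh : (size sel <= n)%N.
  by rewrite size_filter (leq_trans (count_size _ _)) // szt.
have Ds := Dm _ selh.
apply: (@runs_seq _ _ _ _ _ _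
  (median_cost (size sel) + query_cost n + 200 * n.+2 + 100) _
  (fun fr5 s5 => exists p, [/\
     (forall x, x \notin [:: 3; 4; 9; 12]%N -> ireg fr5 x = ireg fr4 x),
     (forall x, x \notin [:: 8; 9]%N -> nreg fr5 x = nreg fr4 x) /\
     nreg fr5 8%N = tm p,
     keeps [:: 2; 3; 4; 5; 6; 7; 8; 9]%N (free + n) s4 s5 /\
     (forall j, j \notin l -> ntab s5 tY j = ntab s4 tY j),
     threshold (R := R) (lkey tm (fun=> 0)) sel (fun=> 1)
       ((size sel)%:R / 2%:R) p &
     (nreg fr5 9%N = 0 /\ optimal2 l q (fun=> 1) K sv1 B1 (ntab s5 tY)) \/
     (exists g2, [/\ nreg fr5 9%N = g2, g2 = 1 \/ g2 = -1
        & overshoots l (fun i => q i - tm p) sv1 B1 (fun=> 1) K g2])])).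
- apply: (@runs_ps_mu n h); rewrite ?i40 ?i42 ?e41 ?l4 ?pl4 ?q4 ?sv4 ?n40 ?n41
    ?tlE ?tmE ?gE ?n45 //.
  + exact: leq_trans le (leq_addr _ _).
  + by rewrite leq_add2l.
  + by move=> fr5 s5 p i5 n5 n58 k5 off5 th5 H5; exists p.
- by lia.
move=> fr5 s5 [p2 [i5 [n5 n58] [k5 off5] th5 H5]].
have k35 : keeps [:: 2; 3; 4; 5; 6; 7; 8; 9; 11; 12; 13]%N free s s5.
  apply: keeps_trans k34 (keeps_sub k5 _ _) => //;
    rewrite ?leq_addr //; exact/allP.
have offY5 : forall j, j \notin l -> ntab s5 tY j = ntab s tY j.
  by move=> j jl; rewrite off5 // offY.
apply: (@runs_if _ _ _ _ _ _ _ 10) => /=; first by move: leN n1 Dn Dq Dh Ds; clear; lia.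
  move=> /andP[h1 h2]; have g0 : nreg fr5 9%N = 0 by apply/le_anti/andP.
  apply: runs_straight => //=; first by move: leN n1 Dn Dq Dh Ds; clear; lia.
  apply: HQ => //; apply: (optimal2_shift sE).
  case: H5 => [[]//|[g [gE2 g2E _]]].
  by move/eqP: g0; rewrite gE2; case: g2E => ->; rewrite ?oppr_eq0 oner_eq0.
move=> gN2; case: H5 => [[g0 _]|[g2 [gE2 g2E ov2]]].
  by rewrite g0 mulr0z lexx in gN2.
have [q5 sv5] : ntab s5 10%N = q /\ ntab s5 11%N = sv1.
  by rewrite !(keeps_ntab k5).
have [i50 i51 i52] : [/\ ireg fr5 0%N = ireg fr 0%N, ireg fr5 1%N = n
  & ireg fr5 2%N = free] by split; rewrite i5.
have l5 : block s5 (ireg fr 0%N) n = l by apply: (keeps_block k35).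
have [m0 m1] : nreg fr5 0%N = K /\ nreg fr5 1%N = B1 by rewrite !n5.
have [m5 m6] : nreg fr5 5%N = tl p1 /\ nreg fr5 6%N = g1 by rewrite !n5.
pose P := prunable q sv1 (tl p1) (tm p2) g1 g2.
(* The removed items pay for this round. *)
have cP : (n <= 12 * count P l)%N.
  exact: (count_pruned sza pa n1 g1E g2E hs hc th4 th5).
have szl' : (size [seq i <- l | ~~ P i] + count P l = n)%N.
  by rewrite size_filter addnC -szl count_predC.
pose m := size [seq i <- l | ~~ P i].
have [ltm bdm] : (m < n)%N /\ (n <= 12 * (n - m))%N.
  by move: cP szl' n1; rewrite -/m; move: (count P l) (m) => c a; clear; lia.
have [y1 y1f] := ex1.
have ex2 := prune_feasible ul g1E g2E ov1 ov2 y1f.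
apply: (@runs_ps_prune n); rewrite ?i50 ?i52 ?l5 ?q5 ?sv5 ?m0 ?m1 ?m5 ?m6 ?n58 ?gE2 //.
- rewrite -/P -/m /ps_cost; move: bdm ltm Dq Dn Dh Ds leN n1.
  clearbody m; clear; lia.
move=> fr6 s6 k6 off6 vJ opt; apply: HQ.
- by apply: keeps_trans k35 k6.
- by move=> j jl; rewrite off6 // offY5.
apply: (optimal2_shift sE).
exact: (prune_optimal ul g1E g2E ov1 ov2 vJ opt).
Qed.

End PruneSearch.

(** * The complete program *)

Notation tP := 0%N (only parsing).
Notation tW := 1%N (only parsing).

Definition curP := NRead tP cur.
Definition curW := NRead tW cur.
Definition curC := IRead 0 cur.

Definition main_list : cmd :=
  ISet 5 (IConst 0) ;; ISet 6 (IConst 0) ;;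
  While (ILe (IReg 6) (IReg 0))
    (IWrite 1 (IReg 6) (IReg 6) ;; ISet 6 (IAdd (IReg 6) (IConst 1))).

Definition main_knapsack : cmd :=
  foreach 5 6
    (NWrite tV cur curP ;; NWrite tA cur curW ;; NWrite tU cur (NConst 0)) ;;
  NWrite tA (IReg 0) (NReg 0) ;;
  Call pLKS [:: IReg 5; IReg 6; IReg 6] [:: NReg 0; NConst 1] 9 9.

Definition main_sums : cmd :=
  NSet 1 (NConst 0) ;;
  foreach 5 0
    (NWrite tX curC (NAdd (NRead tX curC) (NRead tY cur)) ;;
     NSet 1 (NAdd (NReg 1) (NRead tY cur))).

(** Colors without items have excess at most 0, so it suffices to test the colors
    of the items; the colors are never enumerated. *)
Definition main_find : cmd :=
  ISet 8 (IConst 0) ;;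
  foreach 5 0
    (If (NLe (NAdd (NRead tX curC) (NRead tX curC)) (NAdd (NReg 1) (NConst 1)))
      Skip (ISet 8 (IConst 1) ;; ISet 7 curC)).

Definition isC : bexp := BAnd (ILe curC (IReg 7)) (ILe (IReg 7) curC).

Definition main_flip : cmd :=
  NSet 2 (NConst 1) ;; NSet 3 (NReg 0) ;;
  foreach 5 0
    (If isC
      (NWrite tQ cur curP ;; NWrite tS cur curW)
      (NWrite tQ cur (NSub (NConst 0) curP) ;;
       NWrite tS cur (NSub (NConst 0) curW) ;;
       NSet 2 (NAdd (NReg 2) (NConst 1)) ;; NSet 3 (NSub (NReg 3) curW)) ;;
     NWrite tV cur curQ ;; NWrite tA cur (NConst 1) ;; NWrite tU cur curS).

(** The second objective of the first call makes the second constraint as cheap as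
    possible; only if it is still violated is it required to be tight. *)
Definition main_solve : cmd :=
  Call pLKS [:: IReg 5; IReg 0; IReg 0] [:: NReg 2; NConst (-1)] 9 9 ;;
  If (NLe (NReg 9) (NReg 3)) Skip
    (Call pPS [:: IReg 5; IReg 0; IReg 0] [:: NReg 2; NReg 3] 9 9).

Definition main_unflip : cmd :=
  foreach 5 0
    (If isC Skip (NWrite tY cur (NSub (NConst 1) (NRead tY cur)))).

Definition main_cmd : cmd :=
  main_list ;; main_knapsack ;; main_sums ;; main_find ;;
  If (ILe (IReg 8) (IConst 0)) Skip
    (main_flip ;; main_solve ;; main_unflip).

Definition procedures : seq cmd :=
  [:: med3; wsel; lks; median tS; median tPL; median tPM; query; psearch].

Section Main.
Variable R : realFieldType.
Implicit Types (fr : frame R) (s : store R) (l : seq nat).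

Notation ps := procedures.

Lemma iota_rcons n : iota 0 n.+1 = rcons (iota 0 n) n.
Proof. by rewrite -(addn1 n) iotaD add0n cats1. Qed.

Lemma runs_main_list n fr s N (Q : frame R -> store R -> Prop) :
  ireg fr 0%N = n -> (100 * n.+2 + 100 <= N)%N ->
  (forall fr' s',
     (forall x, x \notin [:: 5; 6]%N -> ireg fr' x = ireg fr x) ->
     nreg fr' = nreg fr ->
     ireg fr' 5%N = 0%N -> ireg fr' 6%N = n.+1 ->
     (forall a, a != 1%N -> itab s' a = itab s a) -> ntab s' = ntab s ->
     block s' 0 n.+1 = iota 0 n.+1 -> Q fr' s') ->
  runs ps main_list fr s N Q.
Proof.
move=> r0 leN HQ.
do 2!(apply: (@runs_seq_straight _ _ _ _ _ _ 5) => //=; first by lia).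
set fr0 := set_ireg _ _ _.
pose Inv j fr1 s1 := [/\ ireg fr1 6%N = j, nreg fr1 = nreg fr, ntab s1 = ntab s
  & block s1 0 j = iota 0 j].
apply: (runs_weaken (@runs_while _ _ _ _ fr0 s n.+1 50 Inv _ _ _ _ _)) => //.
- move=> j fr1 s1 ltj so [r6 n1 t1 bl].
  have r01 : ireg fr1 0%N = n by rewrite -r0; apply: (same_ireg so).
  split; first by rewrite /= r6 r01.
  rewrite /Inv /= /upd /= r6 addn1; split=> //.
  rewrite -[X in set_itab _ _ X _]add0n block_push bl.
  by rewrite -[_ :: _]/(iota 0 j.+1) iota_rcons.
- move=> fr1 s1 so [r6 _ _ _]; have r01 : ireg fr1 0%N = n.
    by rewrite -r0; apply: (same_ireg so).
  by rewrite /= r6 r01 ltnn.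
- by lia.
move=> fr1 s1 [so [r6 n1 t1 bl]]; apply: HQ => //.
- move=> x; rewrite !inE !negb_or => /andP[x5 x6].
  by rewrite (same_ireg so) ?inE // /fr0 /= /upd (negbTE x5) (negbTE x6).
- by rewrite (same_ireg so).
- by move=> a a1; rewrite (same_itab so) // inE.
Qed.

Lemma runs_main_knapsack n fr s N (Q : frame R -> store R -> Prop) :
  let p := ntab s tP in let w := ntab s tW in let b := nreg fr 0%N in
  let l := iota 0 n in
  ireg fr 0%N = n -> ireg fr 5%N = 0%N -> ireg fr 6%N = n.+1 ->
  block s 0 n.+1 = iota 0 n.+1 -> p n = 0 -> 0 < b ->
  (forall i, i \in l -> 0 <= w i) ->
  (lks_cost n.+1 + 100 * n.+3 + 100 <= N)%N ->
  (forall fr' s',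
     (forall x, x \notin [:: 3; 4; 9]%N -> ireg fr' x = ireg fr x) ->
     nreg fr' 0%N = b ->
     keeps [:: 2; 3; 4; 5; 6; 7; 8]%N n.+1 s s' ->
     knapsack l w b (ntab s' tY) ->
     (forall x, knapsack l w b x -> dot l p x <= dot l p (ntab s' tY)) ->
     Q fr' s') ->
  runs ps main_knapsack fr s N Q.
Proof.
move=> p w b l r0 r5 r6 bl pn b0 w0 leN HQ.
have lr : iota 0 n.+1 = rcons l n := iota_rcons n.
pose Q1 fr1 s1 := [/\
   same_off [:: 3; 4]%N [::] [::] [:: 6; 7; 8]%N fr s fr1 s1,
   {in rcons l n, ntab s1 6%N =1 p}, {in rcons l n, ntab s1 7%N =1 w}
   & {in rcons l n, ntab s1 8%N =1 fun=> 0}].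
apply: (@runs_seq _ _ _ _ _ _ (100 * n.+3) _ Q1).
- pose Inv pre fr2 s2 := [/\ filled (ntab s 6%N) (ntab s2 6%N) pre p,
    filled (ntab s 7%N) (ntab s2 7%N) pre w
    & filled (ntab s 8%N) (ntab s2 8%N) pre (fun=> 0)].
  apply: (@runs_foreach R ps 5 6 _ (rcons l n) _ s Inv 100) => //=.
  + by rewrite size_rcons size_iota.
  + by rewrite r5 r6 bl.
  + move=> pre i post fr2 s2 lE so iE [f6 f7 f8].
    have pE : ntab s2 0%N = p by rewrite (same_ntab so).
    have wE : ntab s2 1%N = w by rewrite (same_ntab so).
    rewrite /Inv /= /upd /= iE pE wE; split.
    * exact: (filled_rcons i f6).
    * exact: (filled_rcons i f7).
    * exact: (filled_rcons i f8).
  + by left.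
  + move=> fr2 s2 so [f6 f7 f8]; split=> // j jl;
      by rewrite ?f6 ?f7 ?f8 jl.
- by lia.
move=> fr1 s1 [so f6 f7 f8].
apply: (@runs_seq_straight _ _ _ _ _ _ 5) => //=; first by lia.
have e0 : ireg fr1 0%N = n by rewrite (same_ireg so).
have n0 : nreg fr1 0%N = b by rewrite (same_nreg so).
rewrite e0 n0; set s2 := set_ntab _ _ _ _.
have k2 : keeps [:: 6; 7; 8]%N n.+1 s s2.
  have k1 := keeps_same n.+1 so.
  split=> [a aN|a a1|j lt]; last 2 first.
  - exact: (keeps_itab k1).
  - exact: (keeps_list k1).
  rewrite /= /upd ifN ?(keeps_ntab k1) //.
  by apply: contra aN => /eqP->.
have vE : {in l, ntab s2 6%N =1 p}.
  by move=> i il; rewrite /s2 /= /upd /= f6 // mem_rcons inE il orbT.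
have nl : n \notin l by rewrite mem_iota ltnn andbF.
have aE : {in l, ntab s2 7%N =1 w}.
  move=> i il; rewrite /s2 /= /upd /= ifN; last by apply: contraNneq nl => <-.
  by rewrite f7 // mem_rcons inE il orbT.
have bl2 : block s2 0 n.+1 = rcons l n by rewrite -lr -bl; apply: (keeps_block k2).
apply: (@runs_call _ _ _ _ _ _ _ _ _ 30); first by rewrite /=; lia.
rewrite -[nth _ _ _]/lks.
apply: (@runs_lks R ps _ _ n.+1) => /=; rewrite ?(same_ireg so) ?r5 ?r6 ?n0 ?bl2 //.
- exists (fun i => (i == n)%:R).
    by move=> i _; case: (i == n); rewrite ?lexx ?ler01.
  rewrite /dot -cats1 big_cat big_seq1 /= eqxx mulr1 /upd /= eqxx.
  rewrite big1_seq ?add0r // => i /andP[_ il].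
  have -> : (i == n) = false by apply/negbTE; apply: contraNneq nl => <-.
  by rewrite mulr0.
- by lia.
move=> fr3 s3 k3 off opt n3.
have vn : ntab s2 6%N n = 0.
  by rewrite /s2 /= /upd /= f6 // mem_rcons inE eqxx.
have an : ntab s2 7%N n = b by rewrite /s2 /= /upd /= eqxx.
have [kn ko] := slack_optimal w0 b0 nl vE vn aE an opt.
apply: HQ => //=.
- move=> x; rewrite !inE !negb_or /upd => /and3P[x3 x4 x9].
  by rewrite (negbTE x9) (same_ireg so) // !inE negb_or x3.
- apply: keeps_trans (keeps_sub k2 _ _) (keeps_sub k3 _ _) => //; exact/allP.
Qed.

Lemma runs_main_sums n fr s N (Q : frame R -> store R -> Prop) :
  let y := ntab s tY in let col := itab s 0%N in let l := iota 0 n in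
  ireg fr 0%N = n -> ireg fr 5%N = 0%N -> block s 0 n = l ->
  ntab s tX =1 (fun=> 0) ->
  (100 * n.+2 + 100 <= N)%N ->
  (forall fr' s',
     (forall x, x \notin [:: 3; 4]%N -> ireg fr' x = ireg fr x) ->
     (forall x, x != 1%N -> nreg fr' x = nreg fr x) ->
     nreg fr' 1%N = \sum_(i <- l) y i ->
     itab s' = itab s -> (forall a, a != tX -> ntab s' a = ntab s a) ->
     (forall c, ntab s' tX c = \sum_(i <- l | col i == c) y i) ->
     Q fr' s') ->
  runs ps main_sums fr s N Q.
Proof.
move=> y col l r0 r5 bl X0 leN HQ.
apply: (@runs_seq_straight _ _ _ _ _ _ 5) => //=; first by lia.
pose Inv pre fr1 s1 := [/\ itab s1 = itab s, nreg fr1 1%N = \sum_(i <- pre) y i &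
  forall c, ntab s1 14%N c = \sum_(i <- pre | col i == c) y i].
apply: (@runs_foreach R ps 5 0 _ l _ s Inv 100) => //=.
- by rewrite size_iota; lia.
- by rewrite /upd /= r0 r5.
- by split=> [//||c]; rewrite ?big_nil ?X0.
- move=> pre i post fr1 s1 _ so iE [it n1 X1].
  have yE : ntab s1 2%N = y by apply: (same_ntab so).
  rewrite /Inv /= /upd /= iE yE it -/col; split=> //.
    by rewrite n1 -(sum_rcons predT).
  move=> c; rewrite sum_rcons; case: (eqVneq c (col i)) => [->|nc].
    by rewrite X1.
  by rewrite addr0 X1.
- by left.
- move=> fr1 s1 so [it n1 X1]; apply: HQ => //.
  + by move=> x xN; rewrite (same_ireg so).
  + by move=> x x1; rewrite (same_nreg so) ?inE // /= /upd (negbTE x1).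
  + by move=> a a14; rewrite (same_ntab so) // inE.
Qed.

Lemma runs_main_find n fr s N (Q : frame R -> store R -> Prop) :
  let col := itab s 0%N in let l := iota 0 n in
  let bad i := ~~ (ntab s tX (col i) + ntab s tX (col i) <= nreg fr 1%N + 1) in
  ireg fr 0%N = n -> ireg fr 5%N = 0%N -> block s 0 n = l ->
  (100 * n.+2 + 100 <= N)%N ->
  (forall fr',
     (forall x, x \notin [:: 3; 4; 7; 8]%N -> ireg fr' x = ireg fr x) ->
     (forall x, nreg fr' x = nreg fr x) ->
     (ireg fr' 8%N = 0%N /\ (forall i, i \in l -> ~~ bad i)) \/
     (ireg fr' 8%N = 1%N /\
      exists i, [/\ i \in l, bad i & ireg fr' 7%N = col i]) ->
     Q fr' s) ->
  runs ps main_find fr s N Q.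
Proof.
move=> col l bad r0 r5 bl leN HQ.
apply: (@runs_seq_straight _ _ _ _ _ _ 5) => //=; first by lia.
pose Inv (pre : seq nat) fr1 s1 := s1 = s /\
  ((ireg fr1 8%N = 0%N /\ (forall i, i \in pre -> ~~ bad i)) \/
   (ireg fr1 8%N = 1%N /\
      exists i, [/\ i \in l, bad i & ireg fr1 7%N = col i])).
apply: (@runs_foreach R ps 5 0 _ l _ s Inv 100) => //=.
- by rewrite size_iota; lia.
- by rewrite /upd /= r0 r5.
- by split=> //; left.
- by move=> x pre fr1 s1 v; rewrite !inE => /orP[] /eqP->.
- move=> pre i post fr1 s1 lE so iE [-> H].
  have n1 : nreg fr1 1%N = nreg fr 1%N by apply: (same_nreg so).
  have il : i \in l by rewrite lE mem_cat inE eqxx orbT.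
  rewrite iE n1 -/col; case: ifP => [good|/negbT badi]; split=> //=.
    case: H => [[r8 H]|H]; [left|by right].
    split=> // j; rewrite mem_rcons inE => /orP[/eqP->|/H //].
    by rewrite /bad good.
  by right; rewrite /upd /=; split=> //; exists i; split; rewrite ?iE.
- by left.
- move=> fr1 s1 so [-> H]; apply: HQ => //.
  + move=> x; rewrite !inE !negb_or => /and4P[x3 x4 x7 x8].
    rewrite (same_ireg so) /= /upd ?(negbTE x8) //.
    by rewrite !inE !negb_or x3 x4 x8.
  + by move=> x; rewrite (same_nreg so).
Qed.

Lemma runs_main_flip n fr s N (Q : frame R -> store R -> Prop) :
  let p := ntab s tP in let w := ntab s tW in let b := nreg fr 0%N in
  let col := itab s 0%N in let c := ireg fr 7%N in let l := iota 0 n in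
  let q i := side R col c i * p i in let sv i := side R col c i * w i in
  ireg fr 0%N = n -> ireg fr 5%N = 0%N -> block s 0 n = l ->
  (200 * n.+2 + 100 <= N)%N ->
  (forall fr' s',
     (forall x, x \notin [:: 3; 4]%N -> ireg fr' x = ireg fr x) ->
     nreg fr' 2%N = 1 + \sum_(i <- l | col i != c) 1 ->
     nreg fr' 3%N = b - \sum_(i <- l | col i != c) w i ->
     keeps [:: 6; 7; 8; 10; 11]%N n s s' ->
     {in l, ntab s' tQ =1 q} -> {in l, ntab s' tS =1 sv} ->
     {in l, ntab s' tV =1 q} -> {in l, ntab s' tA =1 fun=> 1} ->
     {in l, ntab s' tU =1 sv} -> Q fr' s') ->
  runs ps main_flip fr s N Q.
Proof.
move=> p w b col c l q sv r0 r5 bl leN HQ.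
do 2!(apply: (@runs_seq_straight _ _ _ _ _ _ 5) => //=; first by lia).
pose Inv pre fr1 s1 := [/\
   nreg fr1 2%N = 1 + \sum_(i <- pre | col i != c) 1,
   nreg fr1 3%N = b - \sum_(i <- pre | col i != c) w i &
   [/\ filled (ntab s 10%N) (ntab s1 10%N) pre q,
    filled (ntab s 11%N) (ntab s1 11%N) pre sv,
    filled (ntab s 6%N) (ntab s1 6%N) pre q,
    filled (ntab s 7%N) (ntab s1 7%N) pre (fun=> 1)
   & filled (ntab s 8%N) (ntab s1 8%N) pre sv]].
apply: (@runs_foreach R ps 5 0 _ l _ s Inv 200) => //=.
- by rewrite size_iota; lia.
- by rewrite /upd /= r0 r5.
- by rewrite /Inv /= !big_nil addr0 subr0 /upd.
- move=> pre i post fr1 s1 lE so iE [n2 n3 [f10 f11 f6 f7 f8]].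
  have pE : ntab s1 0%N = p by apply: (same_ntab so).
  have wE : ntab s1 1%N = w by apply: (same_ntab so).
  have cE : itab s1 0%N = col by apply: (same_itab so).
  have c7 : ireg fr1 7%N = c by apply: (same_ireg so).
  have g10 := filled_rcons i f10; have g11 := filled_rcons i f11.
  have g6 := filled_rcons i f6; have g7 := filled_rcons i f7.
  have g8 := filled_rcons i f8.
  rewrite cE c7 iE -eqn_leq.
  have qi : q i = if col i == c then p i else 0 - p i.
    by rewrite /q /side; case: ifP => _; ring.
  have si : sv i = if col i == c then w i else 0 - w i.
    by rewrite /sv /side; case: ifP => _; ring.
  rewrite qi in g10 g6; rewrite si in g11 g8.
  rewrite /Inv !sum_rcons; case: eqVneq g10 g11 g6 g8 => ci g10 g11 g6 g8;
    rewrite /= /upd /= ?iE ?pE ?wE ?eqxx ?addr0; split=> //.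
  - by rewrite n2; ring.
  - by rewrite n3; ring.
- by left.
- move=> fr1 s1 so [n2 n3 [f10 f11 f6 f7 f8]]; apply: HQ => //.
  + by move=> x xN; rewrite (same_ireg so).
  + apply: keeps_sub (keeps_same n so) _ _ => //; exact/allP.
  + by move=> j jl; rewrite f10 jl.
  + by move=> j jl; rewrite f11 jl.
  + by move=> j jl; rewrite f6 jl.
  + by move=> j jl; rewrite f7 jl.
  + by move=> j jl; rewrite f8 jl.
Qed.

Lemma runs_main_solve n (q sv : nat -> R) fr s N
    (Q : frame R -> store R -> Prop) :
  let l := iota 0 n in let one : nat -> R := fun=> 1 in
  let K := nreg fr 2%N in let B := nreg fr 3%N in
  ireg fr 0%N = n -> ireg fr 5%N = 0%N -> block s 0 n = l ->
  {in l, ntab s tQ =1 q} -> {in l, ntab s tS =1 sv} ->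
  {in l, ntab s tV =1 q} -> {in l, ntab s tA =1 one} ->
  {in l, ntab s tU =1 sv} ->
  (exists2 y, in_box l y & dot l one y = K) ->
  (forall y1, lex_opt l q (fun i => (-1) * sv i) one K y1 ->
     B < dot l sv y1 -> exists y, feasible2 l one K sv B y) ->
  (lks_cost n + ps_cost n + 100 <= N)%N ->
  (forall fr' s' y1,
     (forall x, x != 9%N -> ireg fr' x = ireg fr x) ->
     keeps [:: 2; 3; 4; 5; 6; 7; 8; 9; 11; 12; 13]%N n s s' ->
     lex_opt l q (fun i => (-1) * sv i) one K y1 ->
     (dot l sv y1 <= B /\ ntab s' tY = y1) \/
     (B < dot l sv y1 /\ optimal2 l q one K sv B (ntab s' tY)) -> Q fr' s') ->
  runs ps main_solve fr s N Q.
Proof.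
move=> l one K B r0 r5 bl tQE tSE tVE tAE tUE [y0 y0b y0K] exf leN HQ.
pose Q1 fr1 s1 := exists th, [/\
   fr1 = set_nreg (set_ireg fr 9 (ireg fr1 9%N)) 9 th,
   keeps [:: 2; 3; 4; 5]%N n s s1,
   lex_opt l q (fun i => (-1) * sv i) one K (ntab s1 tY)
   & th = dot l sv (ntab s1 tY)].
apply: (@runs_seq _ _ _ _ _ _ (lks_cost n + 30) _ Q1).
- apply: (@runs_call _ _ _ _ _ _ _ _ _ 30); first by rewrite /=; lia.
  rewrite -[nth _ _ _]/lks.
  apply: (@runs_lks R ps _ _ n) => /=; rewrite ?r0 ?r5 ?bl //.
  + by exists y0 => //; rewrite -/K -y0K; apply: eq_big_seq => i /tAE ->.
  + by lia.
  move=> fr1 s1 k1 off [yb yT yo] n1.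
  exists (nreg fr1 0%N); split=> //.
  + split=> //; first by rewrite -[RHS]yT; apply: eq_big_seq => i /tAE ->.
    move=> x xb xT; have := yo x xb.
    have -> : dot l (ntab s 7%N) x = K.
      by rewrite -xT; apply: eq_big_seq => i /tAE ->.
    move=> /(_ erefl).
    have vE z : dot l (ntab s 6%N) z = dot l q z.
      by apply: eq_big_seq => i /tVE ->.
    have uE z : dot l (fun i => (-1)%:~R * ntab s 8%N i) z =
                dot l (fun i => -1 * sv i) z.
      by apply: eq_big_seq => i /tUE ->.
    by rewrite !vE !uE.
  + by rewrite n1; apply: eq_big_seq => i /tUE ->.
- by lia.
move=> fr1 s1 [th [fr1E k1 opt thE]].
set fr1' := set_nreg _ _ _ in fr1E.
have n9 : nreg fr1 9%N = th by rewrite fr1E.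
have n3 : nreg fr1 3%N = B by rewrite fr1E.
have n2 : nreg fr1 2%N = K by rewrite fr1E.
have i1 x : x != 9%N -> ireg fr1 x = ireg fr x.
  by move=> x9; rewrite fr1E /fr1' /= /upd (negbTE x9).
have k1' : keeps [:: 2; 3; 4; 5; 6; 7; 8; 9; 11; 12; 13]%N n s s1.
  by apply: (keeps_sub k1) => //; exact/allP.
apply: (@runs_if _ _ _ _ _ _ _ 10) => /=; rewrite ?n9 ?n3 ?thE; first by lia.
  move=> le; apply: runs_straight => //=; first by lia.
  by apply: (HQ _ _ (ntab s1 tY)) => //; left.
rewrite -ltNge => lt; have [y2 y2f] := exf _ opt lt.
have bl1 : block s1 0 n = l by rewrite -bl; apply: (keeps_block k1).
have [tQ1 tS1] : ntab s1 10%N = ntab s 10%N /\ ntab s1 11%N = ntab s 11%N.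
  by rewrite !(keeps_ntab k1).
apply: (@runs_call _ _ _ _ _ _ _ _ _ 30); first by rewrite /=; lia.
rewrite -[nth _ _ _]/psearch.
apply: (@runs_psearch R ps _ _ _ _ _ _ _ _ n) => /=;
  rewrite ?i1 ?r0 ?r5 ?bl1 ?n2 ?n3 ?tQ1 ?tS1 //.
- exact: iota_uniq.
- by exists y2; apply: eq_feasible2 y2f => // i /tSE.
- by lia.
move=> fr2 s2 k2 off2 opt2; apply: (HQ _ _ (ntab s1 tY)) => //=.
- by move=> x x9; rewrite /upd (negbTE x9) i1.
- exact: keeps_trans k1' k2.
- by right; split=> //; apply: eq_optimal2 opt2.
Qed.

Lemma runs_main_unflip n fr s N (Q : frame R -> store R -> Prop) :
  let col := itab s 0%N in let c := ireg fr 7%N in let l := iota 0 n in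
  ireg fr 0%N = n -> ireg fr 5%N = 0%N -> block s 0 n = l ->
  (100 * n.+2 <= N)%N ->
  (forall fr' s', {in l, ntab s' tY =1 flip col c (ntab s tY)} -> Q fr' s') ->
  runs ps main_unflip fr s N Q.
Proof.
move=> col c l r0 r5 bl leN HQ.
pose Inv pre fr1 s1 :=
  filled (ntab s 2%N) (ntab s1 2%N) pre (flip col c (ntab s tY)).
apply: (@runs_foreach R ps 5 0 _ l _ s Inv 100) => //=.
- by rewrite size_iota; lia.
- by rewrite r0 r5.
- move=> pre i post fr1 s1 lE so iE f2.
  have cE : itab s1 0%N = col by apply: (same_itab so).
  have c7 : ireg fr1 7%N = c by apply: (same_ireg so).
  have ipre : i \notin pre.
    by have := iota_uniq 0 n; rewrite -/l lE cat_uniq /= => /and3P[_ /norP[]].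
  have yi : ntab s1 2%N i = ntab s 2%N i by rewrite f2 (negbTE ipre).
  rewrite cE c7 iE -eqn_leq /Inv yi.
  have := filled_rcons i f2; rewrite {1}/flip; case: ifP => ci //= g2.
  move=> j; rewrite -g2 /upd; case: eqP => // ->; exact: yi.
- by left.
- by move=> fr1 s1 so f2; apply: HQ => j jl; rewrite f2 jl.
Qed.

Definition main_cost n : nat :=
  (lks_cost n.+1 + lks_cost n + ps_cost n + 1000 * n.+3 + 1000)%N.

Lemma runs_main n fr s :
  let p := ntab s tP in let w := ntab s tW in let b := nreg fr 0%N in
  let col := itab s 0%N in let l := iota 0 n in
  ireg fr 0%N = n -> p n = 0 -> 0 < b -> (forall i, i \in l -> 0 <= w i) ->
  ntab s tX =1 (fun=> 0) ->
  runs ps main_cmd fr s (main_cost n) (fun _ s' =>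
    colored l w col b (ntab s' tY) /\
    forall x, colored l w col b x -> dot l p x <= dot l p (ntab s' tY)).
Proof.
move=> p w b col l r0 pn b0 w0 X0; rewrite /main_cost.
pose Q1 fr1 s1 := [/\
   (forall x, x \notin [:: 5; 6]%N -> ireg fr1 x = ireg fr x)
     /\ nreg fr1 = nreg fr,
   ireg fr1 5%N = 0%N, ireg fr1 6%N = n.+1,
   (forall a, a != 1%N -> itab s1 a = itab s a) /\ ntab s1 = ntab s
   & block s1 0 n.+1 = iota 0 n.+1].
apply: (@runs_seq _ _ _ _ _ _ (100 * n.+2 + 100) _ Q1); [|by lia|].
  by apply: (@runs_main_list n).
move=> fr1 s1 [[i1 n1] r5 r6 [it1 nt1] bl1].
have r01 : ireg fr1 0%N = n by rewrite i1.
have bln s2 tn : keeps tn n s1 s2 -> block s2 0 n = l.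
  move=> k2; rewrite (keeps_block k2) // (@block_take _ _ _ n.+1) // bl1.
  by rewrite iota_rcons -cats1 takel_cat ?size_iota // take_oversize ?size_iota.
pose Q2 fr2 s2 := [/\
   (forall x, x \notin [:: 3; 4; 9]%N -> ireg fr2 x = ireg fr1 x),
   nreg fr2 0%N = b, keeps [:: 2; 3; 4; 5; 6; 7; 8]%N n s1 s2,
   knapsack l w b (ntab s2 tY)
   & (forall x, knapsack l w b x -> dot l p x <= dot l p (ntab s2 tY))].
apply: (@runs_seq _ _ _ _ _ _ (lks_cost n.+1 + 100 * n.+3 + 100) _ Q2); [|by lia|].
  apply: (@runs_main_knapsack n); rewrite ?n1 ?nt1 //.
  by move=> fr2 s2 i2 n2 k2 kn ko; split=> //; apply: (keeps_sub k2).
move=> fr2 s2 [i2 n20 k2 kn ko].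
set x0 := ntab s2 tY in kn ko.
have bl2 := bln _ _ k2.
have [r02 r52] : ireg fr2 0%N = n /\ ireg fr2 5%N = 0%N by rewrite !i2.
have col2 : itab s2 0%N = col by rewrite (keeps_itab k2) // it1.
pose Q3 fr3 s3 := [/\
   (forall x, x \notin [:: 3; 4; 9]%N -> ireg fr3 x = ireg fr1 x),
   nreg fr3 0%N = b /\ nreg fr3 1%N = \sum_(i <- l) x0 i,
   itab s3 = itab s2, (forall a, a != tX -> ntab s3 a = ntab s2 a)
   & (forall c, ntab s3 tX c = \sum_(i <- l | col i == c) x0 i)].
apply: (@runs_seq _ _ _ _ _ _ (100 * n.+2 + 100) _ Q3); [|by lia|].
  apply: (@runs_main_sums n); rewrite ?col2 //.
    by move=> j; rewrite (keeps_ntab k2) // nt1.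
  move=> fr3 s3 i3 n3 n31 it3 nt3 X3; split=> //; last by split; [rewrite n3 | exact: n31].
  move=> x; rewrite !inE !negb_or => /and3P[x3 x4 x9].
  by rewrite i3 ?i2 // !inE !negb_or ?x3 ?x4.
move=> fr3 s3 [i3 [n30 n31] it3 nt3 X3].
have [r03 r53] : ireg fr3 0%N = n /\ ireg fr3 5%N = 0%N by rewrite !i3.
have bl3 : block s3 0 n = l.
  by rewrite -bl2; apply: eq_block_tab; rewrite it3.
have k3 : keeps [:: 2; 3; 4; 5; 6; 7; 8; 14]%N n s1 s3.
  apply: keeps_trans (keeps_sub k2 _ _) _ => //; first exact/allP.
  split=> [a aN|a _|j _]; rewrite ?it3 //.
  by rewrite nt3 //; apply: contra aN => /eqP->.
pose bad i := ~~ (ntab s3 tX (col i) + ntab s3 tX (col i) <= nreg fr3 1%N + 1).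
have col3 : itab s3 0%N = col by rewrite it3.
have badE i : bad i = (1 < excess l col (col i) x0).
  rewrite /bad -ltNge X3 n31 excessE mulr2n; apply/idP/idP; lra.
pose Q4 fr4 s4 := [/\ s4 = s3,
   (forall x, x \notin [:: 3; 4; 7; 8; 9]%N -> ireg fr4 x = ireg fr1 x),
   (forall x, nreg fr4 x = nreg fr3 x) &
   (ireg fr4 8%N = 0%N /\ (forall i, i \in l -> ~~ bad i)) \/
     (ireg fr4 8%N = 1%N /\
      exists i, [/\ i \in l, bad i & ireg fr4 7%N = col i])].
apply: (@runs_seq _ _ _ _ _ _ (100 * n.+2 + 100) _ Q4); [|by lia|].
  apply: (@runs_main_find n); rewrite ?col3 // => fr4 i4 n4 H; split=> //.
  move=> x; rewrite !inE !negb_or => /and5P[x3 x4 x7 x8 x9].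
  by rewrite i4 ?i3 // !inE !negb_or ?x3 ?x4 ?x7.
move=> fr4 s4 [-> i4 n4 H].
apply: (@runs_if _ _ _ _ _ _ _ 10) => /=; first by lia.
  move=> r8; apply: runs_straight => //=; first by lia.
  rewrite nt3 // -/x0; split; last by move=> x [xk _]; exact: ko.
  split=> // c; case: H => [[_ good]|[r81 _]]; last by rewrite r81 in r8.
  have [/hasP[i il /eqP <-]|nc] := boolP (has (fun i => col i == c) l).
    by have := good i il; rewrite badE -leNgt.
  rewrite excessE big_hasC // mul0rn sub0r.
  have : 0 <= \sum_(i <- l) x0 i.
    by rewrite big_seq sumr_ge0 // => i il; have /andP[] := kn.1 i il.
  lra.
rewrite -ltnNge => r8; case: H => [[r80 _]|[_ [i0 [i0l badi c7]]]].
  by rewrite r80 in r8.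
rewrite badE -c7 in badi; set c := ireg fr4 7%N in c7 badi.
have [r04 r54] : ireg fr4 0%N = n /\ ireg fr4 5%N = 0%N by rewrite !i4.
have p3 : ntab s3 0%N = p by rewrite (keeps_ntab k3) // nt1.
have w3 : ntab s3 1%N = w by rewrite (keeps_ntab k3) // nt1.
pose q i := side R col c i * p i; pose sv i := side R col c i * w i.
pose K : R := 1 + \sum_(i <- l | col i != c) 1.
pose B := b - \sum_(i <- l | col i != c) w i.
pose Q5 fr5 s5 := [/\
   (forall x, x \notin [:: 3; 4]%N -> ireg fr5 x = ireg fr4 x),
   nreg fr5 2%N = K /\ nreg fr5 3%N = B,
   keeps [:: 6; 7; 8; 10; 11]%N n s3 s5,
   {in l, ntab s5 tQ =1 q} /\ {in l, ntab s5 tS =1 sv} &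
   [/\ {in l, ntab s5 tV =1 q}, {in l, ntab s5 tA =1 fun=> 1}
     & {in l, ntab s5 tU =1 sv}]].
apply: (@runs_seq _ _ _ _ _ _ (200 * n.+2 + 100) _ Q5); [|by lia|].
  apply: (@runs_main_flip n); rewrite ?p3 ?w3 ?col3 ?n4 ?n30 //.
move=> fr5 s5 [i5 [n52 n53] k5 [tQE tSE] [tVE tAE tUE]].
have [r05 r55] : ireg fr5 0%N = n /\ ireg fr5 5%N = 0%N by rewrite !i5.
have bl5 : block s5 0 n = l by rewrite -bl3; apply: (keeps_block k5).
have exT := tight_exists b0 kn ko badi.
pose Q6 fr6 s6 := [/\ ireg fr6 0%N = n, ireg fr6 5%N = 0%N, ireg fr6 7%N = c,
   keeps [:: 2; 3; 4; 5; 6; 7; 8; 9; 11; 12; 13]%N n s5 s6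
   & tight_optimal l p w col b c (ntab s6 tY)].
apply: (@runs_seq _ _ _ _ _ _ (lks_cost n + ps_cost n + 100) _ Q6); [|by lia|].
  apply: (@runs_main_solve n q sv) => //; rewrite ?n52 ?n53.
  - by have [y [yb yK _]] := exT; exists y.
  - by move=> y1 y1o lt; exact: (feasible2_exists b0 kn ko badi y1o lt).
  - move=> fr6 s6 y1 i6 k6 y1o H6; split; rewrite ?i6 ?i5 //.
    case: H6 => [[le ->]|[lt opt]].
    + exact: cheap_optimal y1o le.
    + exact: (@equality_optimal R l p w col b c y1 y1o _ lt opt).
move=> fr6 s6 [r06 r56 c76 k6 opt].
have bl6 : block s6 0 n = l by rewrite -bl5; apply: (keeps_block k6).
have col6 : itab s6 0%N = col by rewrite (keeps_itab k6) // (keeps_itab k5).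
apply: (@runs_main_unflip n) => //; first by lia.
move=> fr7 s7; rewrite col6 c76 => yE.
have [cf co] := tight_colored kn ko badi opt.
split; first by apply: eq_colored cf => i /yE.
move=> x /co le; apply: le_trans le _.
by rewrite (eq_dot _ yE).
Qed.

End Main.

(** * Instances *)

Section Translation.
Variables (R : realFieldType) (n m : nat) (I : ckp n m).

Let l := iota 0 n.
Let p := ntab (input_store R I) tP.
Let w := ntab (input_store R I) tW.
Let col := itab (input_store R I) 0%N.
Let b : R := (capacity I)%:~R.

Lemma table_ofE (T : Type) (z : T) (f : 'I_n -> T) (i : 'I_n) :
  table_of z f i = f i.
Proof. by rewrite /table_of valK. Qed.

Lemma sum_iota (P : pred nat) (F : nat -> R) :
  \sum_(i <- l | P i) F i = \sum_(i < n | P i) F i.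
Proof. by rewrite /l -[in LHS](subn0 n) big_mkord. Qed.

Lemma dot_objective (y : nat -> R) :
  dot l p y = lp_objective I (fun i : 'I_n => y i).
Proof.
by rewrite /dot sum_iota; apply: eq_bigr => i _; rewrite /p /= table_ofE.
Qed.

Lemma dot_weight (y : nat -> R) :
  dot l w y = \sum_(i < n) (weight I i)%:~R * y i.
Proof.
by rewrite /dot sum_iota; apply: eq_bigr => i _; rewrite /w /= table_ofE.
Qed.

Lemma excess_color (y : nat -> R) (c : 'I_m) :
  excess l col c y = \sum_(i < n | color I i == c) y i
                     - \sum_(i < n | color I i != c) y i.
Proof.
rewrite /excess !sum_iota.
by congr (_ - _); apply: eq_bigl => i; rewrite /col /= table_ofE.
Qed.

Lemma colored_feasible (y : nat -> R) :
  colored l w col b y <-> lp_feasible I (fun i : 'I_n => y i).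
Proof.
split=> [[[yb yw] yc]|[yw yc yb]].
  split=> [|c|i]; first by rewrite -dot_weight.
    by rewrite -excess_color.
  by apply: yb; rewrite mem_iota add0n ltn_ord.
have ybox : in_box l y.
  by move=> i; rewrite mem_iota add0n => lt; exact: (yb (Ordinal lt)).
split; first by split=> //; rewrite dot_weight.
move=> c; have [lt|ge] := ltnP c m.
  by rewrite (excess_color y (Ordinal lt)); exact: yc.
rewrite excessE sum_iota big_pred0 => [|i]; last first.
  rewrite /col /= table_ofE; apply/negbTE; rewrite neq_ltn.
  by rewrite (leq_trans (ltn_ord _) ge).
rewrite mul0rn sub0r.
have : 0 <= \sum_(i <- l) y i.
  by rewrite big_seq sumr_ge0 // => i il; have /andP[] := ybox i il.
lra.
Qed.

End Translation.

Theorem mainTheorem4 (R : realFieldType) :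
  exists (P : program) (C : nat),
    forall (n m : nat) (I : ckp n m),
      exists (t : nat) (x : 'I_n -> R),
        computes_in I P t x /\ (t <= C * n)%N /\ lp_optimal I x.
Proof.
exists (Program procedures main_cmd), (3000 * 2000)%N => n m I.
have n_gt0 : (0 < n)%N.
  have := capacity_lt I; have := capacity_gt0 I; clear.
  by case: n I => [|n] // I; rewrite big_ord0 => /lt_trans h /h; rewrite ltxx.
have [||||t [fr [s [ex le [fy oy]]]]] :=
  @runs_main R n (input_frame R I) (input_store R I) erefl.
- by rewrite /= /table_of insubF // ltnn.
- by rewrite /= ltr0z capacity_gt0.
- move=> i; rewrite mem_iota add0n => lt.
  by rewrite /= (table_ofE _ _ (Ordinal lt)) ler0z ltW // weight_gt0.
- by [].
exists t, (output s); split; first by exists fr, s.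
split.
  apply: leq_trans le _.
  by rewrite /main_cost /lks_cost /ps_cost /wsel_cost; lia.
split; first exact/colored_feasible.
move=> y yf; pose y' := table_of 0 y.
have yE i : y' (i : 'I_n) = y i by rewrite /y' table_ofE.
have : colored (iota 0 n) (ntab (input_store R I) tW)
    (itab (input_store R I) 0%N) (capacity I)%:~R y'.
  apply/colored_feasible; case: yf => yw yc yb; split.
  - by under eq_bigr do rewrite yE.
  - move=> c; under eq_bigr do rewrite yE.
    by under [X in _ - X]eq_bigr do rewrite yE.
  - by move=> i; rewrite yE.
move=> /oy; rewrite !dot_objective /lp_objective.
by under eq_bigr do rewrite yE.
Qed.
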